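(* Let $\boldsymbol X=\{\boldsymbol X_j,j\in\mathbb Z\}$ be a stationary, regularly varying $\mathbb R^d$-valued time series with tail index $\alpha>0$ and $\beta$-mixing coefficients $\{\beta_n\}$. Let $\{r_n\}$ be a sequence of positive integers and $\{u_n\}$ a sequence of positive reals with $$\lim_{n\to\infty} u_n=\lim_{n\to\infty} r_n=\lim_{n\to\infty} n\mathbb P(|\boldsymbol X_0|>u_n)=\infty,\qquad \lim_{n\to\infty} \frac{r_n}{n}=\lim_{n\to\infty} r_n\mathbb P(|\boldsymbol X_0|>u_n)=0 .$$ Assume that for all $x,y>0$, $$\lim_{m\to\infty}\limsup_{n\to\infty}\mathbb P\left(\max_{m\le|j|\le r_n}|\boldsymbol X_j|>u_nx\ \Big|\ |\boldsymbol X_0|>u_ny\right)=0,$$ that for all $s,t>0$, $$\lim_{m\to\infty}\limsup_{n\to\infty}\frac1{\mathbb P(|\boldsymbol X_0|>u_n)}\sum_{j=m}^{r_n}\mathbb P(|\boldsymbol X_0|>u_ns,\ |\boldsymbol X_j|>u_nt)=0,$$ and that $$\lim_{n\to\infty}\frac1{\mathbb P(|\boldsymbol X_0|>u_n)}\sum_{i=r_n+1}^\infty\beta_i=0.$$ Let $H,\widetilde H\in\mathsf L$ (shift-invariant, as required in the definition of $H^{\mathcal A}$, $\widetilde H^{\widetilde{\mathcal A}}$), and let $\mathcal A,\widetilde{\mathcal A}\in\{\mathcal A^{(0)},\mathcal A^{(1)},\mathcal A^{(2)}\}$ be anchoring maps. Then $$\lim_{n\to\infty}n\mathbb P(|\boldsymbol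 X_0|>u_n)\,\mathrm{cov}\left(\widetilde{\boldsymbol\xi}^*_{n,r_n}(H^{\mathcal A}),\widetilde{\boldsymbol\xi}^*_{n,r_n}(\widetilde H^{\widetilde{\mathcal A}})\right)=\boldsymbol\nu^*(H\widetilde H).$$
   Context: Notation. $|\cdot|$ is a norm on $\mathbb R^d$. For $\boldsymbol x=\{\boldsymbol x_j,j\in\mathbb Z\}\in(\mathbb R^d)^{\mathbb Z}$ and $i\le j$ in $\mathbb Z\cup\{\pm\infty\}$: $\boldsymbol x_{i,j}=(\boldsymbol x_i,\dots,\boldsymbol x_j)$, $\boldsymbol x^*_{i,j}=\max_{i\le l\le j}|\boldsymbol x_l|$ (supremum if infinite), $\boldsymbol x^*=\sup_j|\boldsymbol x_j|$. A finite block $\boldsymbol x_{i,j}$ is identified with the sequence having the same coordinates at indices $i,\dots,j$ and zeros elsewhere; functionals are applied to blocks through this identification. $\beta_n$ is the $\beta$-mixing coefficient between $\sigma(\boldsymbol X_j,j\le0)$ and $\sigma(\boldsymbol X_j,j\ge n)$. Tail process: $\boldsymbol Y=\{\boldsymbol Y_j\}$ is the process such that for all $i\le j$ the law of $x^{-1}(\boldsymbol X_i,\dots,\boldsymbol X_j)$ given $|\boldsymbol X_0|>x$ converges weakly to that of $(\boldsymbol Y_i,\dots,\boldsymbol Y_j)$ as $x\to\infty$. Anchoring maps: $\mathcal A^{(0)}(\boldsymbol x)=\inf\{j:\boldsymbol x^*_{-\infty,j}=\boldsymbol x^*\}$, $\mathcal A^{(1)}(\boldsymbol x)=\inf\{j:|\boldsymbol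 x_j|>1\}$, $\mathcal A^{(2)}(\boldsymbol x)=\sup\{j:|\boldsymbol x_j|>1\}$ (with $\inf\emptyset=+\infty$). Cluster measure: $\vartheta=\mathbb P(\mathcal A^{(0)}(\boldsymbol Y)=0)$ (the value is the same for $\mathcal A^{(1)},\mathcal A^{(2)}$); $\boldsymbol Q$ has the law of $\boldsymbol Y/\boldsymbol Y^*$ conditionally on $\mathcal A^{(0)}(\boldsymbol Y)=0$; $\boldsymbol\nu^*(H)=\vartheta\int_0^\infty\mathbb E[H(r\boldsymbol Q)]\alpha r^{-\alpha-1}\,dr$. $\mathsf L$ is the class of bounded real-valued functions on $(\mathbb R^d)^{\mathbb Z}$ that are either Lipschitz continuous with respect to the uniform norm or almost surely continuous with respect to the law of $\boldsymbol Y$. For shift-invariant $H$ and an anchoring map $\mathcal A$, $H^{\mathcal A}(\boldsymbol x)=H(\boldsymbol x)\mathbf 1\{\mathcal A(\boldsymbol x)=0\}\mathbf 1\{|\boldsymbol x_0|>1\}$; on a block centred at $i$ it is evaluated after recentring at $i$: $$H^{\mathcal A}(\boldsymbol X_{i-r_n,i+r_n}/u_n)=H(\boldsymbol X_{i-r_n,i+r_n}/u_n)\,\mathbf 1\{\mathcal A(\boldsymbol X_{i-r_n,i+r_n}/u_n)=i\}\,\mathbf 1\{|\boldsymbol X_i|>u_n\}.$$ The runs statistic (data $\boldsymbol X_{1-r_n},\dots,\boldsymbol X_{n+r_n}$ are available) is $$\widetilde{\boldsymbol\xi}^*_{n,r_n}(H^{\mathcal A})=\frac1{n\mathbb P(|\boldsymbol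 X_0|>u_n)}\sum_{i=1}^nH^{\mathcal A}(\boldsymbol X_{i-r_n,i+r_n}/u_n).$$
   Formalization: As stated the limit fails (H=H~=1, X i.i.d.: left side tends to 1, ν*(1)=∞); what is proved is the limit ν*(HH~·1{x*>1}) for all H, H~ in L, hence ν*(HH~) whenever HH~ vanishes on {x*≤1}; functionals in L are taken measurable. *)

(* Defs.v *)
From HB Require Import structures.
From mathcomp Require Import all_boot all_order all_algebra.
From mathcomp Require Import all_classical all_reals all_analysis.
Set Implicit Arguments.
Unset Strict Implicit.
Unset Printing Implicit Defensive.
Import Order.TTheory GRing.Theory Num.Theory.
Import numFieldNormedType.Exports.
Local Open Scope classical_set_scope.
Local Open Scope ring_scope.

(* Vectors of R^d are row vectors 'rV[R]_d; a block
   of k consecutive vectors is a k x d matrix; (R^d)^Z is int -> 'rV[R]_d. *)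

Definition borel (R : realType) (m n : nat) :=
  g_sigma_algebraType (@open 'M[R]_(m, n)).

(* The sigma-algebra on S generated by the coordinates Z j, j in J. *)
Definition coord_sigma (R : realType) (d : nat) (S : Type)
    (Z : S -> int -> 'rV[R]_d) (J : set int) : set (set S) :=
  <<s \bigcup_(j in J) preimage_set_system setT (fun s => Z s j)
        (measurable : set (set (borel R 1 d))) >>.

(* (R^d)^Z with its product sigma-algebra. *)
Definition seq_space (R : realType) (d : nat) :=
  g_sigma_algebraType (coord_sigma (fun x : int -> 'rV[R]_d => x) setT).

Section sequences.
Context {R : realType} {d : nat}.
Implicit Types (N : 'rV[R]_d -> R) (x y : int -> 'rV[R]_d) (J : set int).

Definition is_norm N : Prop :=
  [/\ forall v, N v = 0 -> v = 0,
      forall (a : R) v, N (a *: v) = `|a| * N v &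
      forall v w, N (v + w) <= N v + N w].

Definition shift (k : int) x : int -> 'rV[R]_d := fun j => x (j + k).

Definition scale (a : R) x : int -> 'rV[R]_d := fun j => a *: x j.

Definition block (i j : int) x : int -> 'rV[R]_d :=
  fun l => if (i <= l) && (l <= j) then x l else 0.

Definition window (i : int) (k : nat) x : 'M[R]_(k, d) :=
  \matrix_(l < k) x (i + l%:Z).

(* sup_{l in J} |x_l| in the extended reals; it is -oo for empty J. *)
Definition sup_on N J x : \bar R := ereal_sup [set (N (x l))%:E | l in J].

Definition seq_norm N x : \bar R := sup_on N setT x.

(* Anchoring maps take values in Z together with -oo and +oo, embedded in
   the extended reals. *)
Definition anchor0 N x : \bar R :=
  ereal_inf [set (j%:~R)%:E |
    j in [set j : int | sup_on N [set l | l <= j] x = seq_norm N x]].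

Definition anchor1 N x : \bar R :=
  ereal_inf [set (j%:~R)%:E | j in [set j : int | 1 < N (x j)]].

Definition anchor2 N x : \bar R :=
  ereal_sup [set (j%:~R)%:E | j in [set j : int | 1 < N (x j)]].

Definition is_anchor N (A : (int -> 'rV[R]_d) -> \bar R) : Prop :=
  [\/ A = anchor0 N, A = anchor1 N | A = anchor2 N].

Definition shift_invariant (H : (int -> 'rV[R]_d) -> R) : Prop :=
  forall k x, H (shift k x) = H x.

(* H^A evaluated on a sequence centred at i; H^A itself is the case i = 0. *)
Definition anchored N (H : (int -> 'rV[R]_d) -> R)
    (A : (int -> 'rV[R]_d) -> \bar R) (i : int) x : R :=
  H x * (A x == (i%:~R)%:E)%:R * (1 < N (x i))%R%:R.

(* The uniform distance may be infinite, hence the extended reals. *)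
Definition uniform_dist N x y : \bar R := seq_norm N (fun j => x j - y j).

Definition uniform_lipschitz N (H : (int -> 'rV[R]_d) -> R) : Prop :=
  exists2 K : R, 0 < K &
    forall x y, (`|H x - H y|%:E <= K%:E * uniform_dist N x y)%E.

Definition uniform_continuous_at N (H : (int -> 'rV[R]_d) -> R) x : Prop :=
  forall e : R, 0 < e -> exists2 del : R, 0 < del &
    forall y, (uniform_dist N x y < del%:E)%E -> `|H x - H y| < e.

End sequences.

Section probability.
Context {dT : measure_display} {T : measurableType dT} {R : realType}.
Variable P : probability T R.
Implicit Types (A B : set T) (F G : set (set T)).

Definition prob A : R := fine (P A).

Definition cond_prob A B : R := prob (A `&` B) / prob B.

Definition finite_partition F (p : nat) (A : 'I_p -> set T) : Prop :=
  [/\ forall i, F (A i), trivIset setT A & \bigcup_i A i = setT].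

Definition beta_coef F G : \bar R :=
  ((2^-1)%:E * ereal_sup [set s | exists (p q : nat)
      (A : 'I_p -> set T) (B : 'I_q -> set T),
      [/\ finite_partition F A, finite_partition G B &
       s = (\sum_(i < p) \sum_(j < q)
              `|prob (A i `&` B j) - prob (A i) * prob (B j)|)%:E]])%E.

Section process.
Context {d : nat}.
Implicit Types (N : 'rV[R]_d -> R) (X : {RV P >-> seq_space R d}).

Definition stationary X : Prop :=
  forall (k : int) (B : set (seq_space R d)), measurable B ->
    P [set t | B (shift k (X t))] = P [set t | B (X t)].

Definition beta_mixing X (n : nat) : \bar R :=
  beta_coef (coord_sigma X [set j | j <= 0])
            (coord_sigma X [set j | n%:Z <= j]).

(* Regular variation of the finite-dimensional distributions: vague
   convergence on the complement of 0 to a nonzero limit, finite away from 0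
   and homogeneous of degree -alpha. Since the series is stationary, P(|X_0|>x)
   is an admissible normalization for every block. *)
Definition regularly_varying N X (alpha : R) : Prop :=
  forall (i : int) (k : nat), (0 < k)%N ->
  exists nu : {measure set (borel R k d) -> \bar R},
    [/\ nu setT != 0%E, nu [set 0] = 0%E,
        forall U : set 'M[R]_(k, d), open U -> U 0 -> (nu (~` U) < +oo)%E,
        forall (t : R) (B : set (borel R k d)), 0 < t -> measurable B ->
          nu [set t *: (z : 'M[R]_(k, d)) | z in B] =
          ((t `^ (- alpha))%:E * nu B)%E &
        forall f : 'M[R]_(k, d) -> R, continuous f ->
          (exists M : R, forall z, `|f z| <= M) ->
          (\forall z \near (0 : 'M[R]_(k, d)), f z = 0) ->
          (\int[P]_t f (window i k (scale x^-1 (X t))))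
             / prob [set t | x < N (X t 0)] @[x --> +oo]
          --> \int[nu]_z f z].

(* lim_{m -> oo} limsup_{n -> oo} v m n = 0 *)
Definition double_limit0 (v : nat -> nat -> R) : Prop :=
  limn_esup (fun n => (v m n)%:E) @[m --> \oo] --> (0 : \bar R).

Definition anticlustering N X (r : nat -> nat) (u : nat -> R) : Prop :=
  forall x y : R, 0 < x -> 0 < y ->
  double_limit0 (fun m n =>
    cond_prob
      [set t | ((u n * x)%:E <
         sup_on N [set j : int | (m%:Z <= `|j| <= (r n)%:Z)%R] (X t))%E]
      [set t | u n * y < N (X t 0)]).

Definition summability N X (r : nat -> nat) (u : nat -> R) : Prop :=
  forall s t : R, 0 < s -> 0 < t ->
  double_limit0 (fun m n =>
    (prob [set w | u n < N (X w 0)])^-1 *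
    \sum_(m <= j < (r n).+1)
       prob [set w | u n * s < N (X w 0) /\ u n * t < N (X w j%:Z)]).

(* Measurability for the product sigma-algebra makes E[H(Y)] etc. meaningful;
   in the last disjunct the set of discontinuities of H is negligible. *)
Definition class_L N (Y : {RV P >-> seq_space R d})
    (H : (int -> 'rV[R]_d) -> R) : Prop :=
  [/\ measurable_fun setT (H : seq_space R d -> R),
      exists M : R, forall x, `|H x| <= M &
      uniform_lipschitz N H \/
      {ae P, forall t, uniform_continuous_at N H (Y t)}].

Definition vartheta N (Y : {RV P >-> seq_space R d}) : R :=
  prob [set t | anchor0 N (Y t) = 0%E].

Definition runs_statistic N X (r : nat -> nat) (u : nat -> R)
    (H : (int -> 'rV[R]_d) -> R) (A : (int -> 'rV[R]_d) -> \bar R)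
    (n : nat) (t : T) : R :=
  (n%:R * prob [set w | u n < N (X w 0)])^-1 *
  \sum_(1 <= i < n.+1)
    anchored N H A i%:Z
      (scale (u n)^-1 (block (i%:Z - (r n)%:Z) (i%:Z + (r n)%:Z) (X t))).

End process.
End probability.

Section tail.
Context {R : realType} {d : nat}.
Context {d1 d2 d3 : measure_display} {T1 : measurableType d1}
  {T2 : measurableType d2} {T3 : measurableType d3}.
Context {P : probability T1 R} {PY : probability T2 R} {PQ : probability T3 R}.
Implicit Types (N : 'rV[R]_d -> R).

Definition is_tail_process N (X : {RV P >-> seq_space R d})
    (Y : {RV PY >-> seq_space R d}) : Prop :=
  forall (i : int) (k : nat) (f : 'M[R]_(k, d) -> R), continuous f ->
    (exists M : R, forall z, `|f z| <= M) ->
    (\int[P]_(t in [set t | x < N (X t 0)])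
        f (window i k (scale x^-1 (X t))))
      / prob P [set t | x < N (X t 0)] @[x --> +oo]
    --> \int[PY]_t f (window i k (Y t)).

(* Y^* is finite on the conditioning event. *)
Definition is_conditional_spectral N (Y : {RV PY >-> seq_space R d})
    (Q : {RV PQ >-> seq_space R d}) : Prop :=
  forall B : set (seq_space R d), measurable B ->
    prob PQ [set q | B (Q q)] =
    cond_prob PY
      [set t | B (scale (fine (seq_norm N (Y t)))^-1 (Y t))]
      [set t | anchor0 N (Y t) = 0%E].

Definition cluster_measure N (alpha : R) (Y : {RV PY >-> seq_space R d})
    (Q : {RV PQ >-> seq_space R d}) (H : (int -> 'rV[R]_d) -> R) : \bar R :=
  ((vartheta N Y)%:E *
   \int[lebesgue_measure]_(rho in `]0%R, +oo[)
     ('E_PQ[fun q => H (scale rho (Q q))] *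
      (alpha * rho `^ (- alpha - 1))%:E))%E.

End tail.

(* Main.v *)
Require Import Defs.
From HB Require Import structures.
From mathcomp Require Import all_boot all_order all_algebra.
From mathcomp Require Import all_classical all_reals all_analysis.
From mathcomp Require Import measurable_realfun.
From mathcomp Require Import ring lra zify.
Import Order.TTheory GRing.Theory Num.Theory.
Import numFieldNormedType.Exports.
Set Implicit Arguments.
Unset Strict Implicit.
Unset Printing Implicit Defensive.
Local Open Scope classical_set_scope.
Local Open Scope ring_scope.

(** Write [w n] for the probability that [N (X 0)] exceeds [u n], [blk i] for
    the rescaled block around time [i], and [Z i], [Z' k] for the two anchored
    functionals of the blocks around [i] and [k]. By stationarity the scaled
    covariance is the double sum over [i] and [k] of [cov (Z i) (Z' k)], divided
    by [n * w n], and its terms depend on the lag [h = k - i] only.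

    Lags. Since [Z i] vanishes unless time [i] is an exceedance, the covariance
    at lag [h] is at most a constant times the probability that times [0] and
    [h] both exceed, plus [w n ^ 2]; the summability condition makes this small
    for large [h] up to [r n]. At the lags beyond [3 r n] the blocks are
    separated, and at the lags between [r n] and [3 r n] the exceedances are,
    so beta-mixing takes over. Hence, after division by [w n], only the lags
    [|h| <= m] count, and for these the product of the means is negligible:
    the scaled covariance is close to the sum over [|h| <= m] of
    [E (Z 0 * Z' h) / w n] ([runs_cov_sum]).

    One cluster. When times [0] and [h] both exceed, the two blocks contain the
    same exceedances except on an event of small probability. Since [H'] is
    close to a continuous function of finitely many coordinates
    ([class_L_approx]) and is shift-invariant, its value on the block around
    [h] can be replaced by its value on the block around [0]. A cluster has
    exactly one anchor, so summing over [h] removes the second anchor: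
    the sum is close to [E (H * H' * 1 (A = 0))], evaluated on the block around
    [0] ([cross_anchor]). The left-hand side being symmetric in the two
    anchors, this mean does not depend on the anchor, up to [o (w n)]
    ([anchor_exchange]); the choice of the first exceedance makes the indicator
    of [A = 0] a continuous function of the tail process off a null set, and
    the mean divided by [w n] converges to
    [E (H (Y) * H' (Y) * 1 (A (Y) = 0))] ([anchor1_limit]).

    The limit. The tail process satisfies the time change formula
    ([tail_process_time_change]), which again exchanges the anchors
    ([tail_anchor_exchange]), now to the first maximum. Scaling
    ([tail_process_scale]) shows that the radius [N (Y 0)] is Pareto distributed
    and independent of the angle [Y / N (Y 0)]; on the event that the first
    maximum is at [0] the angle is [Y] divided by its norm, whose conditional
    law is that of [Q]. Integration in polar coordinates yields the cluster
    measure, restricted to the sequences of norm larger than [1] because the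
    radius is ([cluster_measureE]). *)

Local Notation shift := Defs.shift.

(** * Expectations of bounded measurable functions *)

Section Expectation.
Context {dT : measure_display} {T : measurableType dT} {R : realType}.
Implicit Types (f g h : T -> R).

(** Bounded measurable functions: the class on which expectations stay
    real-valued. *)
Definition bm f : Prop :=
  measurable_fun setT f /\ exists M : R, forall x, `|f x| <= M.

Lemma measurable_setb (b : T -> bool) : measurable_fun setT b ->
  measurable [set x | b x].
Proof.
move=> mb; rewrite (_ : [set x | b x] = setT `&` b @^-1` [set true]).
  exact: mb.
by rewrite setTI.
Qed.

Lemma measurable_boolP (b : T -> bool) : measurable [set x | b x] ->
  measurable_fun setT b.
Proof. by move=> mb; apply: (measurable_fun_bool true); rewrite setTI. Qed.

Lemma bm_cst (c : R) : bm (fun=> c).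
Proof. by split; [exact: measurable_cst | exists `|c|]. Qed.

Lemma bmD f g : bm f -> bm g -> bm (fun x => f x + g x).
Proof.
move=> [mf [M fM]] [mg [M' gM]]; split; first exact: measurable_funD.
by exists (M + M') => x; rewrite (le_trans (ler_normD _ _))// lerD.
Qed.

Lemma bmN f : bm f -> bm (fun x => - f x).
Proof.
move=> [mf [M fM]]; split; first exact: measurableT_comp.
by exists M => x; rewrite normrN.
Qed.

Lemma bmB f g : bm f -> bm g -> bm (fun x => f x - g x).
Proof. by move=> bf bg; apply: bmD => //; exact: bmN. Qed.

Lemma bmM f g : bm f -> bm g -> bm (fun x => f x * g x).
Proof.
move=> [mf [M fM]] [mg [M' gM]]; split; first exact: measurable_funM.
by exists (M * M') => x; rewrite normrM ler_pM.
Qed.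

Lemma bm_norm f : bm f -> bm (fun x => `|f x|).
Proof.
move=> [mf [M fM]]; split; first exact: measurableT_comp.
by exists M => x; rewrite normr_id.
Qed.

Lemma bm_sum (I : Type) (r : seq I) (p : pred I) (f : I -> T -> R) :
  (forall i, bm (f i)) -> bm (fun x => \sum_(i <- r | p i) f i x).
Proof.
move=> bf; elim: r => [|i r IH].
  by under eq_fun do rewrite big_nil; exact: bm_cst.
under eq_fun do rewrite big_cons.
by case: (p i) => //; apply: bmD.
Qed.

Lemma bm_bool (b : T -> bool) : measurable_fun setT b -> bm (fun x => (b x)%:R).
Proof.
move=> mb; split; last first.
  by exists 1 => x; case: (b x) => /=; rewrite ?normr1 ?normr0.
rewrite (_ : (fun x => _) = (\1_(b @^-1` [set true]) : T -> R)); last first.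
  apply/funext => x; rewrite indicE; congr (nat_of_bool _)%:R.
  by apply/idP/idP; rewrite inE.
by apply: measurable_indic; rewrite -[X in measurable X]setTI; exact: mb.
Qed.

Variable P : probability T R.

(** Real-valued expectation, which for bounded functions avoids the extended
    reals of [expectation]. *)
Definition Ex f : R := \int[P]_t f t.

Lemma bm_integrable f (A : set T) : measurable A -> bm f ->
  P.-integrable A (EFin \o f).
Proof.
move=> mA [mf [M fM]].
apply: measurable_bounded_integrable => //.
- by rewrite (le_lt_trans (probability_le1 P mA))// ltry.
- exact: measurable_funTS.
- exists M; split; first exact: num_real.
  by move=> x Mx y _ /=; rewrite (le_trans (fM y))// ltW.
Qed.

Lemma ExE f : bm f -> (Ex f)%:E = (\int[P]_t (f t)%:E)%E.
Proof.
move=> bf; rewrite /Ex /Rintegral fineK//.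
by apply: integrable_fin_num => //; exact: bm_integrable.
Qed.

Lemma ExpE f : bm f -> ('E_P[f])%E = (Ex f)%:E.
Proof. by move=> bf; rewrite ExE// unlock. Qed.

Lemma ExD f g : bm f -> bm g -> Ex (fun x => f x + g x) = Ex f + Ex g.
Proof.
by move=> bf bg; rewrite /Ex RintegralD//; exact: bm_integrable.
Qed.

Lemma ExZ (c : R) f : bm f -> Ex (fun x => c * f x) = c * Ex f.
Proof. by move=> bf; rewrite /Ex RintegralZl//; exact: bm_integrable. Qed.

Lemma ExB f g : bm f -> bm g -> Ex (fun x => f x - g x) = Ex f - Ex g.
Proof.
by move=> bf bg; rewrite /Ex RintegralB//; exact: bm_integrable.
Qed.

Lemma Ex_cst (c : R) : Ex (fun=> c) = c.
Proof.
have P1 : fine (P setT) = 1 by rewrite probability_setT.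
by rewrite /Ex Rintegral_cst// -[RHS]mulr1; congr (_ * _).
Qed.

Lemma Ex_ge0 f : (forall x, 0 <= f x) -> 0 <= Ex f.
Proof. by move=> f0; apply: Rintegral_ge0. Qed.

Lemma le_Ex f g : bm f -> bm g -> (forall x, f x <= g x) -> Ex f <= Ex g.
Proof.
by move=> bf bg fg; apply: le_Rintegral => //; exact: bm_integrable.
Qed.

Lemma le_norm_Ex f : bm f -> `|Ex f| <= Ex (fun x => `|f x|).
Proof. by move=> bf; apply: le_normr_Rintegral => //; exact: bm_integrable. Qed.

Lemma dist_Ex f g h : bm f -> bm g -> bm h ->
  (forall x, `|f x - g x| <= h x) -> `|Ex f - Ex g| <= Ex h.
Proof.
move=> bf bg bh fgh; rewrite -ExB//.
apply: (le_trans (le_norm_Ex (bmB bf bg))).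
by apply: le_Ex => //; exact/bm_norm/bmB.
Qed.

Lemma norm_Ex_le f (M : R) : bm f -> (forall x, `|f x| <= M) -> `|Ex f| <= M.
Proof.
move=> bf fM; apply: (le_trans (le_norm_Ex bf)).
rewrite -[leRHS]Ex_cst; apply: le_Ex => //; [exact: bm_norm|exact: bm_cst].
Qed.

Lemma Ex_sum (I : Type) (r : seq I) (p : pred I) (f : I -> T -> R) :
  (forall i, bm (f i)) ->
  Ex (fun x => \sum_(i <- r | p i) f i x) = \sum_(i <- r | p i) Ex (f i).
Proof.
move=> bf; elim: r => [|i r IH].
  by under eq_fun do rewrite big_nil; rewrite Ex_cst big_nil.
under eq_fun do rewrite big_cons.
rewrite big_cons; case: (p i) => //.
by rewrite ExD ?IH//; exact: bm_sum.
Qed.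

Lemma Ex_bool (b : T -> bool) : measurable_fun setT b ->
  Ex (fun x => (b x)%:R) = prob P [set x | b x].
Proof.
move=> mb; rewrite /Ex /prob /Rintegral.
have mB := measurable_setb mb.
rewrite (_ : (fun x : T => _) = (fun x => (\1_[set x | b x] x)%:E)).
  by rewrite integral_indic// setIT.
apply/funext => x; rewrite indicE; congr (nat_of_bool _)%:R%:E.
by apply/idP/idP; rewrite inE.
Qed.

Lemma Ex_bounded_cvg (f_ : nat -> T -> R) f (M : R) :
  (forall n, measurable_fun setT (f_ n)) -> measurable_fun setT f ->
  (forall n x, `|f_ n x| <= M) ->
  {ae P, forall x, f_ ^~ x @ \oo --> f x} ->
  Ex (f_ n) @[n --> \oo] --> Ex f.
Proof.
move=> mf_ mf fM fcvg.
have bfn n : bm (f_ n) by split => //; exists M.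
have [|||||fi _ h] := @dominated_convergence _ _ _ P setT measurableT
  (fun n x => (f_ n x)%:E) (EFin \o f) (cst M%:E).
- by move=> n; exact/measurable_EFinP.
- exact/measurable_EFinP.
- apply: filterS fcvg => x fx _.
  by apply: cvg_EFin => //; exact: nearW.
- by apply: bm_integrable => //; exact: bm_cst.
- by apply: aeW => x n _; rewrite /= lee_fin.
have := @fine_cvg _ _ _ _ _ (Ex f) (_ : _ --> (Ex f)%:E).
have -> : (Ex f)%:E = (\int[P]_x (EFin \o f) x)%E.
  by rewrite /Ex /Rintegral fineK//; exact: integrable_fin_num.
by move=> /(_ _ _ _ _ h).
Qed.

Lemma ae_Ex f g : bm f -> bm g -> {ae P, forall x, f x = g x} -> Ex f = Ex g.
Proof.
move=> [mf _] [mg _] fg; congr fine; apply: ae_eq_integral => //.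
- exact/measurable_EFinP.
- exact/measurable_EFinP.
- by apply: filterS fg => x /= -> .
Qed.

End Expectation.

(** * Measurability in the sequence space *)

Lemma measurable_all_countable dT (T : measurableType dT) (U : countType)
    (B : U -> set T) :
  (forall u, measurable (B u)) -> measurable [set t | forall u, B u t].
Proof.
move=> mB; have -> : [set t | forall u, B u t] = ~` \bigcup_u ~` B u.
  apply/seteqP; split => [t tB [u _]|t tB u]; first exact.
  by apply: contrapT => Bu; apply: tB; exists u.
apply/measurableC/countable_bigcupT_measurable; first exact: countableP.
by move=> u; exact: measurableC.
Qed.

Lemma measurable_ex_countable dT (T : measurableType dT) (U : countType)
    (B : U -> set T) :
  (forall u, measurable (B u)) -> measurable [set t | exists u, B u t].
Proof.
move=> mB; have -> : [set t | exists u, B u t] = \bigcup_u B u.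
  by apply/seteqP; split => [t [u tB]|t [u _ tB]]; exists u.
by apply: countable_bigcupT_measurable => //; exact: countableP.
Qed.

Section MatrixMeasurability.
Context {R : realType} {m n : nat}.

Lemma mx_nbhsP (x : 'M[R]_(m, n)) (U : set 'M[R]_(m, n)) : nbhs x U <->
  exists2 e : R, 0 < e &
    forall y : 'M[R]_(m, n), (forall i j, `|x i j - y i j| < e) -> U y.
Proof.
split=> [/nbhs_ballP[e /= e0 xU]|[e e0 xU]].
  by exists e => // y xy; apply: xU; split => // i j; rewrite -ball_normE /=.
apply/nbhs_ballP; exists e => //= y [_ xy]; apply: xU => i j.
by have := xy i j; rewrite -ball_normE.
Qed.

Lemma continuous_mxP (F : 'M[R]_(m, n) -> R) : continuous F <->
  forall (x : 'M[R]_(m, n)) (e : R), 0 < e -> exists2 del : R, 0 < del &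
    forall y : 'M[R]_(m, n),
      (forall i j, `|x i j - y i j| < del) -> `|F x - F y| < e.
Proof.
split=> [cF x e e0|cF x].
  have /(@cvgrPdist_lt _ _ _ (nbhs x) (nbhs_filter x))/(_ e e0) := cF x.
  move=> /mx_nbhsP [del d0 H].
  by exists del => // y /H.
apply/(@cvgrPdist_lt _ _ _ (nbhs x) (nbhs_filter x)) => e e0.
apply/mx_nbhsP.
by have [del d0 H] := cF x e e0; exists del.
Qed.

Lemma measurable_continuous_mx (F : 'M[R]_(m, n) -> R) : continuous F ->
  measurable_fun setT (F : borel R m n -> R).
Proof.
move=> cF; apply: (measurability _ (RGenOInfty.measurableE R)).
move=> _ [_ [a ->] <-]; rewrite setTI; apply: sub_sigma_algebra.
by move/continuousP : cF; apply; exact: rray_open.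
Qed.

(** An open set of matrices is a countable union of boxes with rational
    centres. *)
Lemma measurable_mx dT (T : measurableType dT) (f : T -> 'M[R]_(m, n)) :
  (forall i j, measurable_fun setT (fun t => f t i j)) ->
  measurable_fun setT (f : T -> borel R m n).
Proof.
move=> mf; apply: (@measurability _ _ _ (borel R m n) setT f (@open 'M[R]_(m, n))) => //.
move=> _ [U oU <-]; rewrite setTI.
pose box (qk : 'M[rat]_(m, n) * nat) : set 'M[R]_(m, n) :=
  [set y | forall i j, `|ratr (qk.1 i j) - y i j| < qk.2.+1%:R^-1].
have -> : f @^-1` U = [set t | exists qk, box qk `<=` U /\ box qk (f t)].
  apply/seteqP; split=> [t /= Uft|t [qk [qkU]]]; last exact: qkU.
  have /mx_nbhsP [e e0 H] := open_nbhs_nbhs (conj oU Uft).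
  have [k ke] : exists k : nat, k.+1%:R^-1 < e / 2.
    have e20 : 0 < e / 2 by lra.
    have [k _ /(_ k (leqnn k)) h] := near_infty_natSinv_lt (PosNum e20).
    by exists k.
  have q_ex i j : exists q : rat, `|ratr q - f t i j| < k.+1%:R^-1 :> R.
    have k0 : 0 < k.+1%:R^-1 :> R by rewrite invr_gt0.
    move: (k.+1%:R^-1) k0 => c c0.
    have /rat_in_itvoo[q] : f t i j - c < f t i j + c by lra.
    rewrite in_itv /= => /andP[h1 h2].
    by exists q; rewrite ltr_norml; apply/andP; split; lra.
  pose q := \matrix_(i, j) projT1 (cid (q_ex i j)).
  exists (q, k); split; last by move=> i j /=; rewrite mxE; case: cid.
  move=> y /= yq; apply: H => i j.
  have := yq i j; rewrite /= mxE; case: cid => /= r rf ry.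
  rewrite -(subrKA (ratr r)) (le_lt_trans (ler_normD _ _))//.
  rewrite distrC (lt_trans (ltrD rf ry))//.
  by move: (k.+1%:R^-1) ke => c; lra.
apply: measurable_ex_countable => qk.
have [qkU|qkU] := pselect (box qk `<=` U); last first.
  by rewrite [X in measurable X](_ : _ = set0)//; apply/seteqP; split => // t [].
rewrite [X in measurable X](_ : _ = [set t | forall ij : 'I_m * 'I_n,
    `|ratr (qk.1 ij.1 ij.2) - f t ij.1 ij.2| < qk.2.+1%:R^-1]); last first.
  apply/seteqP; split => [t [_ h] ij|t h]; first exact: h.
  by split => // i j; exact: (h (i, j)).
apply: measurable_all_countable => -[i j] /=.
apply: measurable_setb; apply: measurable_fun_ltr => //.
by apply: measurableT_comp => //; exact: measurable_funB.
Qed.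
End MatrixMeasurability.

Section SeqSpace.
Context {R : realType} {d : nat}.
Notation S := (seq_space R d).
Implicit Types (x y : int -> 'rV[R]_d) (N : 'rV[R]_d -> R).

Lemma measurable_coord (j : int) :
  measurable_fun setT (fun x : S => (x : int -> 'rV[R]_d) j : borel R 1 d).
Proof.
move=> _ B mB; rewrite setTI; do 2 apply: sub_sigma_algebra.
exists j; first by [].
by exists B; [exact: mB|rewrite setTI].
Qed.

Lemma measurable_entry (j : int) (c : 'I_d) :
  measurable_fun setT (fun x : S => (x : int -> 'rV[R]_d) j ord0 c).
Proof.
apply: (@measurableT_comp _ _ _ _ _ _ (fun v : borel R 1 d => (v : 'rV[R]_d) ord0 c)
  _ _ _ (measurable_coord j)).
by apply: measurable_continuous_mx; exact: coord_continuous.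
Qed.

Lemma measurable_seq dT (T : measurableType dT) (f : T -> int -> 'rV[R]_d) :
  (forall j, measurable_fun setT (fun t => f t j : borel R 1 d)) ->
  measurable_fun setT (f : T -> S).
Proof.
move=> mf; apply: (@measurability _ _ _ S setT f (\bigcup_(j in setT)
  preimage_set_system setT (fun s : int -> 'rV[R]_d => s j)
        (measurable : set (set (borel R 1 d))))).
  by apply: sigma_algebra_id; exact: smallest_sigma_algebra.
move=> _ [U [j _ [B mB <-]] <-].
by rewrite setTI; have := mf j measurableT B mB; rewrite !setTI.
Qed.

Lemma measurable_seq_entry dT (T : measurableType dT)
    (f : T -> int -> 'rV[R]_d) :
  (forall j c, measurable_fun setT (fun t => f t j ord0 c)) ->
  measurable_fun setT (f : T -> S).
Proof.
move=> mf; apply: measurable_seq => j; apply: measurable_mx => i c.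
by rewrite ord1; exact: mf.
Qed.

Lemma measurable_shift k : measurable_fun setT (shift k : S -> S).
Proof. by apply: measurable_seq => j; exact: (measurable_coord (j + k)). Qed.

Lemma measurable_scale2 dT (T : measurableType dT) (a : T -> R) (f : T -> S) :
  measurable_fun setT a -> measurable_fun setT f ->
  measurable_fun setT (fun t => scale (a t) (f t) : S).
Proof.
move=> ma mf; apply: measurable_seq_entry => j c; rewrite /scale.
under eq_fun do rewrite mxE.
apply: measurable_funM => //.
exact: (measurableT_comp (measurable_entry j c) mf).
Qed.

Lemma measurable_scale (a : R) : measurable_fun setT (scale a : S -> S).
Proof. by apply: measurable_scale2 => //; exact: measurable_id. Qed.

Lemma measurable_block i j : measurable_fun setT (block i j : S -> S).
Proof.
apply: measurable_seq => l; rewrite /block.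
by case: (_ && _); [exact: (measurable_coord l) | exact: measurable_cst].
Qed.

Lemma measurable_window i k :
  measurable_fun setT (window i k : S -> borel R k d).
Proof.
apply: measurable_mx => l c; rewrite /window.
under [X in measurable_fun _ X]eq_fun do rewrite mxE.
exact: (measurable_entry (i + l%:Z) c).
Qed.

Section Norm.
Variable N : 'rV[R]_d -> R.
Hypothesis hN : is_norm N.

Lemma normZ (a : R) v : N (a *: v) = `|a| * N v.
Proof. by case: hN. Qed.

Lemma norm_triangle v w : N (v + w) <= N v + N w.
Proof. by case: hN. Qed.

Lemma normN v : N (- v) = N v.
Proof. by rewrite -scaleN1r normZ normrN1 mul1r. Qed.

Lemma norm0 : N 0 = 0.
Proof. by rewrite -(scale0r 0) normZ normr0 mul0r. Qed.

Lemma norm_ge0 v : 0 <= N v.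
Proof.
have := norm_triangle v (- v); rewrite subrr norm0 normN; lra.
Qed.

Lemma norm_distC v w : N (v - w) = N (w - v).
Proof. by rewrite -normN opprB. Qed.

Lemma norm_lipschitz v w : `|N v - N w| <= N (v - w).
Proof.
have := norm_triangle (v - w) w; have := norm_triangle (w - v) v.
rewrite !subrK (norm_distC w v) => h1 h2.
by rewrite ler_norml; apply/andP; split; lra.
Qed.

(** All norms on row vectors are dominated by the supremum of the entries;
    this transfers the topology of matrices to [N]. *)
Lemma norm_entries : exists2 C : R, 0 < C & forall (v : 'rV[R]_d) (e : R),
  (forall c, `|v ord0 c| <= e) -> 0 <= e -> N v <= C * e.
Proof.
exists (1 + \sum_(c < d) N (delta_mx ord0 c)).
  by rewrite ltr_wpDr// sumr_ge0// => c _; exact: norm_ge0.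
move=> v e ve e0.
have Nsum (r : seq 'I_d) (f : 'I_d -> 'rV[R]_d) :
    N (\sum_(c <- r) f c) <= \sum_(c <- r) N (f c).
  elim: r => [|c r IH]; first by rewrite !big_nil norm0.
  by rewrite !big_cons (le_trans (norm_triangle _ _))// lerD2l.
rewrite {1}(row_sum_delta v) (le_trans (Nsum _ _))//.
rewrite mulrDl mul1r -[leLHS]add0r lerD// mulr_suml ler_sum// => c _.
by rewrite normZ mulrC ler_wpM2l// norm_ge0.
Qed.

Lemma is_norm_continuous : continuous (N : 'rV[R]_d -> R).
Proof.
have [C C0 NC] := norm_entries.
apply/continuous_mxP => x e e0; exists (e / C / 2).
  by rewrite !divr_gt0.
move=> y xy; rewrite (le_lt_trans (norm_lipschitz _ _))//.
apply: (@le_lt_trans _ _ (C * (e / C / 2))).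
  apply: NC => [c|]; last by rewrite !divr_ge0// ltW.
  by rewrite !mxE ltW.
rewrite mulrA mulrCA mulfV ?gt_eqF// mulr1; lra.
Qed.

Lemma measurable_norm_coord (j : int) :
  measurable_fun setT (fun x : S => N ((x : int -> 'rV[R]_d) j)).
Proof.
apply: (@measurableT_comp _ _ _ _ _ _ (N : borel R 1 d -> R)
  _ _ _ (measurable_coord j)).
by apply: measurable_continuous_mx; exact: is_norm_continuous.
Qed.

Lemma measurable_sup_on J :
  measurable_fun setT (fun x : S => sup_on N J x).
Proof.
apply: (measurability _ (ErealGenOInfty.measurableE R)).
move=> _ [_ [a ->] <-]; rewrite setTI.
rewrite (_ : _ @^-1` _ = [set x : S | exists j, J j /\ (a < N (x j))%R]).
  apply: measurable_ex_countable => j.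
  have [Jj|Jj] := pselect (J j); last first.
    by rewrite [X in measurable X](_ : _ = set0)//; apply/seteqP; split => // t [].
  rewrite [X in measurable X](_ : _ = [set x : S | (a < N (x j))%R]).
    apply: measurable_setb; apply: measurable_fun_ltr => //.
    exact: measurable_norm_coord.
  by apply/seteqP; split => x /=; [case|].
apply/seteqP; split => x /=; rewrite in_itv /= andbT.
  by move=> /ereal_sup_gt[_ [j Jj <-]]; rewrite lte_fin => aj; exists j.
move=> [j [Jj aj]]; apply: (@lt_le_trans _ _ (N (x j))%:E).
  by rewrite lte_fin.
by apply: ereal_sup_ubound; exists j.
Qed.

Lemma le_sup_on J x j : J j -> ((N (x j))%:E <= sup_on N J x)%E.
Proof. by move=> Jj; apply: ereal_sup_ubound; exists j. Qed.

Lemma sup_on_le J x (a : \bar R) : (forall j, J j -> ((N (x j))%:E <= a)%E) ->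
  (sup_on N J x <= a)%E.
Proof. by move=> h; apply: ge_ereal_sup => _ [j Jj <-]; exact: h. Qed.

End Norm.
End SeqSpace.

(** * The three anchors *)

Lemma ereal_inf_int {R : realType} (E : set int) (i : int) :
  ereal_inf [set (j%:~R : R)%:E | j in E] = (i%:~R)%:E <->
  E i /\ forall j, E j -> i <= j.
Proof.
split=> [h|[Ei iE]].
  have lb j : E j -> i <= j.
    move=> Ej; rewrite -(ler_int R) -lee_fin -h.
    by apply: ereal_inf_lbound; exists j.
  split=> //; apply: contrapT => Ei.
  have : ((i + 1)%:~R%:E <= (i%:~R : R)%:E)%E.
    rewrite -h; apply: le_ereal_inf_tmp => _ [j Ej <-].
    rewrite lee_fin ler_int; have := lb j Ej.
    have : j <> i by move=> ji; apply: Ei; rewrite -ji.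
    lia.
  by rewrite lee_fin ler_int; lia.
apply/eqP; rewrite eq_le; apply/andP; split.
  by apply: ereal_inf_lbound; exists i.
apply: le_ereal_inf_tmp => _ [j Ej <-].
by rewrite lee_fin ler_int; exact: iE.
Qed.

Lemma ereal_sup_int {R : realType} (E : set int) (i : int) :
  ereal_sup [set (j%:~R : R)%:E | j in E] = (i%:~R)%:E <->
  E i /\ forall j, E j -> j <= i.
Proof.
split=> [h|[Ei iE]].
  have lb j : E j -> j <= i.
    move=> Ej; rewrite -(ler_int R) -lee_fin -h.
    by apply: ereal_sup_ubound; exists j.
  split=> //; apply: contrapT => Ei.
  have : ((i%:~R : R)%:E <= (i - 1)%:~R%:E)%E.
    rewrite -h; apply: ge_ereal_sup => _ [j Ej <-].
    rewrite lee_fin ler_int; have := lb j Ej.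
    have : j <> i by move=> ji; apply: Ei; rewrite -ji.
    lia.
  by rewrite lee_fin ler_int; lia.
apply/eqP; rewrite eq_le; apply/andP; split.
  apply: ge_ereal_sup => _ [j Ej <-].
  by rewrite lee_fin ler_int; exact: iE.
by apply: ereal_sup_ubound; exists i.
Qed.

Lemma int_window (l : nat) (j : int) : (`|j|%N <= l)%N ->
  exists2 k : nat, (k < (l + l).+1)%N & j = k%:Z - l%:Z.
Proof. by move=> jl; exists (absz (j + l%:Z)); lia. Qed.

Section Anchors.
Context {R : realType} {d : nat}.
Notation S := (seq_space R d).
Variable N : 'rV[R]_d -> R.
Hypothesis hN : is_norm N.
Implicit Types (x y : int -> 'rV[R]_d).

(** This holds for blocks, and almost surely for the tail process with a
    random [l]. *)
Definition tame (l : nat) x : Prop := forall j, (l < `|j|)%N -> N (x j) <= 1.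

(** What [anchor0] selects as soon as large values occur at finitely many
    times. *)
Definition first_max x (i : int) : Prop :=
  (forall j, j < i -> N (x j) < N (x i)) /\
  (forall j, i <= j -> N (x j) <= N (x i)).

Definition first_exceed x (i : int) : Prop := forall j, j < i -> N (x j) <= 1.

Definition last_exceed x (i : int) : Prop := forall j, i < j -> N (x j) <= 1.

(** The infimum of a set of integers that is closed upwards is attained at [i]
    exactly if the set contains [i] but not [i - 1]. *)
Lemma anchor0P x i : anchor0 N x = (i%:~R)%:E <->
  sup_on N [set l | l <= i] x = seq_norm N x /\
  sup_on N [set l | l <= i - 1] x <> seq_norm N x.
Proof.
rewrite ereal_inf_int /=; split=> -[h1 h2]; split=> //.
  by move=> /h2; lia.
move=> j hj; rewrite leNgt; apply/negP => ji; apply: h2.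
apply/eqP; rewrite eq_le -{2}hj; apply/andP; split.
  by apply: sup_on_le => k _; exact: le_sup_on.
by apply: sup_on_le => k /= kj; apply: le_sup_on => /=; lia.
Qed.

Lemma anchor1P x i : anchor1 N x = (i%:~R)%:E <->
  1 < N (x i) /\ first_exceed x i.
Proof.
rewrite ereal_inf_int /=; split=> -[h1 h2]; split=> // j.
  by move=> ji; rewrite leNgt; apply/negP => /h2; rewrite leNgt ji.
by move=> h; rewrite leNgt; apply/negP => /h2; rewrite leNgt h.
Qed.

Lemma anchor2P x i : anchor2 N x = (i%:~R)%:E <->
  1 < N (x i) /\ last_exceed x i.
Proof.
rewrite ereal_sup_int /=; split=> -[h1 h2]; split=> // j.
  by move=> ji; rewrite leNgt; apply/negP => /h2; rewrite leNgt ji.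
by move=> h; rewrite leNgt; apply/negP => /h2; rewrite leNgt h.
Qed.

(** Only finitely many times can carry the maximum, so the first of them
    exists. *)
Lemma window_max l x (a : R) : (forall j, (l < `|j|)%N -> N (x j) <= a) ->
  (exists j, a < N (x j)) ->
  exists2 i, a < N (x i) & first_max x i.
Proof.
move=> tx [j0 aj0].
have jl j : a < N (x j) -> (`|j|%N <= l)%N.
  by move=> aj; rewrite leqNgt; apply/negP => /tx; rewrite leNgt aj.
pose f (k : nat) := N (x (k%:Z - l%:Z)).
have [k0 k0l j0E] := int_window (jl _ aj0).
have [k _ kmax] :=
  @Order.TotalTheory.arg_maxP _ _ _ (Ordinal k0l) xpredT (fun k => f k) isT.
(* first among the maximizers in the window *)
pose p (m : nat) := (m < (l + l).+1)%N &&
  [forall k' : 'I_(l + l).+1, f k' <= f m].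
have pk : exists m, p m.
  by exists k; rewrite /p ltn_ord; apply/forallP => k'; exact: kmax.
case: (ex_minnP pk) => m /andP[ml /forallP mmax] mmin.
have am : a < f m.
  by apply: lt_le_trans (mmax (Ordinal k0l)); rewrite /f /= -j0E.
have le_m j : N (x j) <= f m.
  have [jl'|jl'] := leqP `|j|%N l; last by rewrite (le_trans (tx j jl'))// ltW.
  have [k' k'l ->] := int_window jl'; exact: (mmax (Ordinal k'l)).
exists (m%:Z - l%:Z) => //; split=> [j jm|j _]; last exact: le_m.
rewrite lt_neqAle le_m andbT; apply/eqP => jE.
have [jl'|jl'] := leqP `|j|%N l; last first.
  by have := tx j jl'; rewrite jE leNgt am.
have [k' k'l jE'] := int_window jl'.
suff /mmin : p k' by lia.
rewrite /p k'l; apply/forallP => k''.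
by rewrite [leRHS](_ : _ = f m)// /f -jE' jE.
Qed.

(** The supremum over the past of the first maximum is a maximum over finitely
    many values, hence strictly below the overall supremum. *)
Lemma first_max_anchor0 l x i (a : R) :
  (forall j, (l < `|j|)%N -> N (x j) <= a) -> a < N (x i) ->
  first_max x i -> anchor0 N x = (i%:~R)%:E.
Proof.
move=> tx ai [lti lei]; apply/anchor0P.
have le_i j : N (x j) <= N (x i).
  by have [/lti/ltW//|/lei] := ltP j i.
have supE : seq_norm N x = (N (x i))%:E.
  apply/eqP; rewrite eq_le; apply/andP; split; last exact: le_sup_on.
  by apply: sup_on_le => j _; rewrite lee_fin.
rewrite supE; split.
  apply/eqP; rewrite eq_le; apply/andP; split; last by apply: le_sup_on => /=.
  by apply: sup_on_le => j _; rewrite lee_fin.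
apply/eqP; rewrite lt_eqF//.
(* finitely many values exceed a, all of them strictly below N (x i) *)
pose b := \big[Num.max/a]_(k < (l + l).+1 | (k%:Z - l%:Z < i))
  N (x (k%:Z - l%:Z)).
apply: (@le_lt_trans _ _ b%:E); last first.
  rewrite lte_fin /b; elim/big_ind: _ => //.
    by move=> u v ui vi; rewrite gt_max ui.
  by move=> k ki; exact: lti.
apply: sup_on_le => j /= ji; rewrite lee_fin.
have [jl|jl] := leqP `|j|%N l; last first.
  by rewrite (le_trans (tx j jl))// /b; exact: bigmax_ge_id.
have [k kl jE] := int_window jl.
rewrite jE; apply: (@le_bigmax_cond _ _ _ _ (Ordinal kl)
  (fun k : 'I__ => k%:Z - l%:Z < i) (fun k : 'I__ => N (x (k%:Z - l%:Z)))) => /=.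
by lia.
Qed.

Lemma anchor_inj (i j : int) : (i%:~R : R)%:E = (j%:~R)%:E -> i = j.
Proof. by move=> [] /eqP; rewrite eqr_int => /eqP. Qed.

Lemma anchor0_max l x i (a : R) :
  (forall j, (l < `|j|)%N -> N (x j) <= a) -> a < N (x i) ->
  anchor0 N x = (i%:~R)%:E <-> first_max x i.
Proof.
move=> tx ai; split; last exact: first_max_anchor0 tx ai.
have [i' ai' mi'] := window_max tx (ex_intro _ i ai).
by rewrite (first_max_anchor0 tx ai' mi') => /anchor_inj <-.
Qed.

(** On a tame sequence each anchor is the position of a peak among the
    exceedances of 1, and this position is a function of the exceedances
    alone. This common description carries the three cases of every later
    statement. *)
Lemma anchor_peak A : is_anchor N A -> exists peak : (int -> 'rV[R]_d) -> int -> Prop,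
  [/\ forall l x i, tame l x -> 1 < N (x i) -> (A x = (i%:~R)%:E <-> peak x i),
      forall l x, tame l x -> (exists j, 1 < N (x j)) ->
        exists2 i, 1 < N (x i) & peak x i &
      forall x y i, (forall j, 1 < N (x j) \/ 1 < N (y j) -> x j = y j) ->
        1 < N (x i) -> peak x i -> peak y i].
Proof.
case=> ->.
- exists first_max; split.
  + by move=> l x i tx xi; apply: anchor0_max; [exact: tx|exact: xi].
  + by move=> l x tx; exact: (window_max tx).
  + move=> x y i xy xi [h1 h2]; have yi := xy i (or_introl xi).
    have le_y j : N (x j) <= N (x i) -> N (y j) <= N (y i).
      have [y1 h|y1 _] := ltP 1 (N (y j)); first by rewrite -yi -xy//; right.
      by rewrite -yi (le_trans y1)// ltW.
    have lt_y j : N (x j) < N (x i) -> N (y j) < N (y i).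
      have [y1 h|y1 _] := ltP 1 (N (y j)); first by rewrite -yi -xy//; right.
      by rewrite -yi (le_lt_trans y1).
    by split=> j ij; [apply/lt_y/h1 | apply/le_y/h2].
- exists first_exceed; split.
  + by move=> l x i _ xi; rewrite anchor1P; split => [[]|].
  + move=> l x tx [j0 xj0].
    have jl j : 1 < N (x j) -> (`|j|%N <= l)%N.
      by move=> aj; rewrite leqNgt; apply/negP => /tx; rewrite leNgt aj.
    have pk : exists k : nat, 1 < N (x (k%:Z - l%:Z)).
      by have [k _ jE] := int_window (jl _ xj0); exists k; rewrite -jE.
    case: (ex_minnP pk) => k xk kmin; exists (k%:Z - l%:Z) => // j jk.
    rewrite leNgt; apply/negP => xj.
    have [k' _ jE] := int_window (jl _ xj).
    by move: xj; rewrite jE => /kmin; lia.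
  + move=> x y i xy xi h j /h xj; rewrite leNgt; apply/negP => yj.
    by move: xj; rewrite xy ?leNgt ?yj//; right.
- exists last_exceed; split.
  + by move=> l x i _ xi; rewrite anchor2P; split => [[]|].
  + move=> l x tx [j0 xj0].
    have jl j : 1 < N (x j) -> (`|j|%N <= l)%N.
      by move=> aj; rewrite leqNgt; apply/negP => /tx; rewrite leNgt aj.
    have pk : exists k : nat, 1 < N (x (k%:Z - l%:Z)).
      by have [k _ jE] := int_window (jl _ xj0); exists k; rewrite -jE.
    have kb (k : nat) : 1 < N (x (k%:Z - l%:Z)) -> (k <= l + l)%N.
      by move=> /jl; lia.
    case: (ex_maxnP pk kb) => k xk kmax; exists (k%:Z - l%:Z) => // j jk.
    rewrite leNgt; apply/negP => xj.
    have [k' _ jE] := int_window (jl _ xj).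
    by move: xj; rewrite jE => /kmax; lia.
  + move=> x y i xy xi h j /h xj; rewrite leNgt; apply/negP => yj.
    by move: xj; rewrite xy ?leNgt ?yj//; right.
Qed.

Section OneAnchor.
Variable A : (int -> 'rV[R]_d) -> \bar R.
Hypothesis hA : is_anchor N A.

Lemma anchor_ex l x : tame l x -> (exists j, 1 < N (x j)) ->
  exists2 i, 1 < N (x i) & A x = (i%:~R)%:E.
Proof.
have [pk [h1 h2 _]] := anchor_peak hA => tx /(h2 _ _ tx) [i xi pi].
by exists i => //; apply/(h1 _ _ _ tx xi).
Qed.

Lemma anchor_local l l' x y i : tame l x -> tame l' y ->
  (forall j, 1 < N (x j) \/ 1 < N (y j) -> x j = y j) ->
  1 < N (x i) -> (A x == (i%:~R)%:E) = (A y == (i%:~R)%:E).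
Proof.
have [pk [h1 _ h3]] := anchor_peak hA => tx ty xy xi.
have yi : 1 < N (y i) by rewrite -xy//; left.
apply/eqP/eqP => [/(h1 _ _ _ tx xi) h|/(h1 _ _ _ ty yi) h].
  by apply/(h1 _ _ _ ty yi); exact: h3 h.
apply/(h1 _ _ _ tx xi); apply: h3 h => // j jxy.
by rewrite xy//; case: jxy; [right|left].
Qed.

Lemma sup_on_shift J k x :
  sup_on N J (shift k x) = sup_on N [set j | J (j - k)] x.
Proof.
congr ereal_sup; apply/seteqP; split => _ [j Jj <-].
  by exists (j + k) => //=; rewrite addrK.
by exists (j - k) => //; rewrite /shift subrK.
Qed.

Lemma anchor_shift k x (i : int) :
  (A (shift k x) == (i%:~R)%:E) = (A x == ((i + k)%:~R)%:E).
Proof.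
have NshiftE j : N (shift k x j) = N (x (j + k)) by [].
have supE m : sup_on N [set j | j <= m] (shift k x) =
    sup_on N [set j | j <= m + k] x.
  by rewrite sup_on_shift; congr sup_on; apply/seteqP; split => j /=; lia.
have seqE : seq_norm N (shift k x) = seq_norm N x by exact: sup_on_shift.
case: hA => ->; apply/eqP/eqP.
- move=> /anchor0P; rewrite seqE !supE => -[h1 h2]; apply/anchor0P.
  by split => //; rewrite addrAC.
- move=> /anchor0P [h1 h2]; apply/anchor0P; rewrite seqE !supE.
  by split => //; rewrite addrAC.
- rewrite !anchor1P; move=> [h1 h2]; split => // j jk.
  by have := h2 (j - k); rewrite NshiftE subrK; apply; lia.
- rewrite !anchor1P; move=> [h1 h2]; split => // j jk.
  by rewrite NshiftE; apply: h2; lia.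
- rewrite !anchor2P; move=> [h1 h2]; split => // j jk.
  by have := h2 (j - k); rewrite NshiftE subrK; apply; lia.
- rewrite !anchor2P; move=> [h1 h2]; split => // j jk.
  by rewrite NshiftE; apply: h2; lia.
Qed.

Lemma measurable_anchor (i : int) :
  measurable_fun setT (fun x : S => A x == (i%:~R)%:E).
Proof.
apply: measurable_boolP.
have mx j : measurable_fun setT (fun x : S => N (x j)).
  exact: measurable_norm_coord.
case: hA => ->.
- rewrite (_ : mkset _ = [set x : S | sup_on N [set l | l <= i] x = seq_norm N x]
      `&` ~` [set x : S | sup_on N [set l | l <= i - 1] x = seq_norm N x]).
    by apply: measurableI; [|apply: measurableC];
      rewrite -[X in measurable X]setTI; apply: emeasurable_fun_eq => //;
      exact: measurable_sup_on.
  by apply/seteqP; split => x /= => [/eqP/anchor0P|/anchor0P/eqP].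
- rewrite (_ : mkset _ = [set x : S | 1 < N (x i)] `&`
      [set x | forall j : int, (j < i) ==> (N (x j) <= 1)]).
    apply: measurableI.
      by apply: measurable_setb; exact: measurable_fun_ltr.
    apply: measurable_all_countable => j; case: (j < i) => /=; last first.
      by rewrite [X in measurable X](_ : _ = setT)//; apply/seteqP; split.
    by apply: measurable_setb; exact: measurable_fun_ler.
  apply/seteqP; split => x /= => [/eqP/anchor1P[h1 h2]|[h1 h2]].
    by split=> // j; apply/implyP; exact: h2.
  by apply/eqP/anchor1P; split => // j; apply/implyP.
- rewrite (_ : mkset _ = [set x : S | 1 < N (x i)] `&`
      [set x | forall j : int, (i < j) ==> (N (x j) <= 1)]).
    apply: measurableI.
      by apply: measurable_setb; exact: measurable_fun_ltr.
    apply: measurable_all_countable => j; case: (i < j) => /=; last first.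
      by rewrite [X in measurable X](_ : _ = setT)//; apply/seteqP; split.
    by apply: measurable_setb; exact: measurable_fun_ler.
  apply/seteqP; split => x /= => [/eqP/anchor2P[h1 h2]|[h1 h2]].
    by split=> // j; apply/implyP; exact: h2.
  by apply/eqP/anchor2P; split => // j; apply/implyP.
Qed.

End OneAnchor.
End Anchors.

(** * Continuous functions of finitely many coordinates *)

(** Every bounded function is uniformly close to one with finitely many
    values, through this quantization of the real line. *)
Lemma quantize {R : realType} (M e : R) : 0 < e ->
  exists (n : nat) (q : R -> 'I_n) (a : 'I_n -> R),
  [/\ forall i, measurable (q @^-1` [set i]),
      (forall v, `|v| <= M -> `|v - a (q v)| <= e) &
      (forall i, 0 <= M -> `|a i| <= M)].
Proof.
move=> e0.
pose z v := Num.truncn ((v + M) / e); pose n := Num.truncn ((M + M) / e).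
exists n.+1, (fun v => inord (z v)), (fun i => i%:R * e - M).
have e_ne0 : e != 0 by rewrite gt_eqF.
split.
- move=> i; rewrite (_ : _ @^-1` _ =
    [set v | exists m : nat, inord m = i /\ z v = m]); last first.
    by apply/seteqP; split => v /= => [<-|[m [<- <-]]//]; exists (z v).
  apply: measurable_ex_countable => m.
  have [<-|mi] := eqVneq (inord m) i; last first.
    rewrite [X in measurable X](_ : _ = set0)//; apply/seteqP; split => // v [].
    by move/eqP; rewrite (negbTE mi).
  rewrite [X in measurable X](_ : _ = [set v | z v == m]); last first.
    by apply/seteqP; split => v /= => [[_ ->]//|/eqP].
  have mz (c : R) : measurable_fun setT (fun v : R => c <= (v + M) / e).
    apply: measurable_fun_ler => //; apply: measurable_funM => //.
    exact: measurable_funD.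
  have mz' (c : R) : measurable_fun setT (fun v : R => (v + M) / e < c).
    apply: measurable_fun_ltr => //; apply: measurable_funM => //.
    exact: measurable_funD.
  rewrite (_ : mkset _ =
      [set v | (m == 0)%N || (m%:R <= (v + M) / e)] `&`
      [set v : R | (v + M) / e < m.+1%:R]).
    apply: measurableI; apply: measurable_setb => //.
    by case: m => // m; exact: mz.
  apply/seteqP; split => v /=; rewrite -truncn_le_nat -/(z v) eqn_leq.
    by move=> /andP[-> mz_]; split => //; case: m mz_ => // m; rewrite truncn_gt_nat.
  by move=> [h ->]; case: m h => // m; rewrite -truncn_gt_nat.
- move=> v /ler_normlP [h1 h2].
  have z0 : 0 <= (v + M) / e by rewrite divr_ge0//; lra.
  rewrite inordK; last first.
    by rewrite ltnS; apply: le_truncn; rewrite ler_pM2r ?invr_gt0//; lra.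
  have /andP[] := truncn_itv z0; rewrite -/(z v).
  rewrite ler_pdivlMr// ltr_pdivrMr// mulrSr mulrDl mul1r => h3 h4.
  by rewrite ler_norml; apply/andP; split; lra.
- move=> i M0; have : i%:R * e <= M + M.
    have M2 : 0 <= (M + M) / e by rewrite divr_ge0//; lra.
    have : n%:R <= (M + M) / e by rewrite truncn_le.
    by rewrite -ler_pdivlMr//; apply: le_trans; rewrite ler_nat -ltnS.
  have : 0 <= i%:R * e by rewrite mulr_ge0// ltW.
  by move=> h1 h2; rewrite ler_norml; apply/andP; split; lra.
Qed.

Section LocallyContinuous.
Context {R : realType} {d : nat}.
Notation S := (seq_space R d).
Implicit Types (x y : int -> 'rV[R]_d) (f g : (int -> 'rV[R]_d) -> R).

Definition win_close (l : nat) (del : R) x y : Prop :=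
  forall j c, (`|j| <= l)%N -> `|x j ord0 c - y j ord0 c| < del.

(** [f] depends continuously on the coordinates of index in [-l, l], and on
    these coordinates only. *)
Definition loccont (l : nat) f : Prop :=
  forall x (e : R), 0 < e -> exists2 del : R, 0 < del &
    forall y, win_close l del x y -> `|f x - f y| < e.

(** The test functions that determine the law of a random sequence. *)
Definition lcb f : Prop :=
  (exists l, loccont l f) /\ exists M : R, forall x, `|f x| <= M.

Lemma win_closeW l l' del del' x y : (l' <= l)%N -> del <= del' ->
  win_close l del x y -> win_close l' del' x y.
Proof.
move=> ll dd h j c jl; apply: (lt_le_trans (h j c _)) => //.
exact: leq_trans ll.
Qed.

Lemma loccont_eq l f x y : loccont l f ->
  (forall j, (`|j| <= l)%N -> x j = y j) -> f x = f y.
Proof.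
move=> fl xy; apply/eqP; rewrite -subr_eq0 -normr_le0 leNgt; apply/negP => fxy.
have [del d0 h] := fl x _ fxy.
have : `|f x - f y| < `|f x - f y|.
  by apply: h => j c jl; rewrite xy// subrr normr0.
by rewrite ltxx.
Qed.

Lemma lcb_cst (c : R) : lcb (fun=> c).
Proof.
split; last by exists `|c|.
by exists 0%N => x e e0; exists 1 => // y _; rewrite subrr normr0.
Qed.

Lemma lcbD f g : lcb f -> lcb g -> lcb (fun x => f x + g x).
Proof.
move=> [[l fl] [M fM]] [[l' gl] [M' gM]]; split; last first.
  by exists (M + M') => x; rewrite (le_trans (ler_normD _ _))// lerD.
exists (maxn l l') => x e e0.
have [del d0 hf] := fl x (e / 2) (divr_gt0 e0 (ltr0Sn _ _)).
have [del' d'0 hg] := gl x (e / 2) (divr_gt0 e0 (ltr0Sn _ _)).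
exists (Num.min del del'); first by rewrite lt_min d0.
move=> y xy; rewrite opprD addrACA (le_lt_trans (ler_normD _ _))//.
rewrite (splitr e) ltrD//.
  by apply: hf; apply: win_closeW xy; rewrite ?leq_maxl// ge_min lexx.
by apply: hg; apply: win_closeW xy; rewrite ?leq_maxr// ge_min lexx orbT.
Qed.

(** A Lipschitz function is bounded on bounded sets, so that boundedness is
    preserved. *)
Lemma lcb_lipschitz (phi : R -> R) (L : R) f : 0 <= L ->
  (forall a b, `|phi a - phi b| <= L * `|a - b|) -> lcb f ->
  lcb (fun x => phi (f x)).
Proof.
move=> L0 phiL [[l fl] [M fM]]; split; last first.
  exists (`|phi 0| + L * M) => x; rewrite -(subrK (phi 0) (phi (f x))) addrC.
  rewrite (le_trans (ler_normD _ _))// lerD2l (le_trans (phiL _ _))//.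
  by rewrite ler_wpM2l// subr0.
exists l => x e e0.
have L1 : 0 < L + 1 by lra.
have [del d0 h] := fl x (e / (L + 1)) (divr_gt0 e0 L1).
exists del => // y /h; rewrite ltr_pdivlMr// => hy.
rewrite (le_lt_trans (phiL _ _))//.
have := normr_ge0 (f x - f y); nra.
Qed.

Lemma lcbN f : lcb f -> lcb (fun x => - f x).
Proof.
move=> /(@lcb_lipschitz (fun a => - a) 1 _ ler01); apply => a b.
by rewrite -opprD normrN mul1r.
Qed.

Lemma lcbB f g : lcb f -> lcb g -> lcb (fun x => f x - g x).
Proof. by move=> lf lg; apply: lcbD => //; exact: lcbN. Qed.

Lemma lcbM f g : lcb f -> lcb g -> lcb (fun x => f x * g x).
Proof.
move=> [[l fl] [M fM]] [[l' gl] [M' gM]]; split; last first.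
  by exists (M * M') => x; rewrite normrM ler_pM.
exists (maxn l l') => x e e0.
have M0 : 0 <= M := le_trans (normr_ge0 _) (fM (fun=> 0)).
have M'0 : 0 <= M' := le_trans (normr_ge0 _) (gM (fun=> 0)).
have C0 : 0 < M + M' + 1 by lra.
have [del d0 hf] := fl x (e / (M + M' + 1)) (divr_gt0 e0 C0).
have [del' d'0 hg] := gl x (e / (M + M' + 1)) (divr_gt0 e0 C0).
exists (Num.min del del'); first by rewrite lt_min d0.
move=> y xy.
have {}hf : `|f x - f y| < e / (M + M' + 1).
  by apply: hf; apply: win_closeW xy; rewrite ?leq_maxl// ge_min lexx.
have {}hg : `|g x - g y| < e / (M + M' + 1).
  by apply: hg; apply: win_closeW xy; rewrite ?leq_maxr// ge_min lexx orbT.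
have -> : f x * g x - f y * g y = (f x - f y) * g x + f y * (g x - g y) by ring.
rewrite (le_lt_trans (ler_normD _ _))// !normrM.
move: hf hg; rewrite !ltr_pdivlMr// => hf hg.
have := normr_ge0 (f x - f y); have := normr_ge0 (g x - g y).
have := gM x; have := fM y; have := normr_ge0 (g x); have := normr_ge0 (f y).
move: `|f x - f y| `|g x - g y| `|g x| `|f y| hf hg => a b c h; nra.
Qed.

Lemma lcb_shift k f : lcb f -> lcb (fun x => f (shift k x)).
Proof.
move=> [[l fl] [M fM]]; split; last by exists M => x.
exists (l + `|k|)%N => x e e0.
have [del d0 h] := fl (shift k x) e e0.
exists del => // y xy; apply: h => j c jl; apply: xy; lia.
Qed.

Lemma lcb_scale (a : R) f : lcb f -> lcb (fun x => f (scale a x)).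
Proof.
move=> [[l fl] [M fM]]; split; last by exists M => x.
exists l => x e e0.
have [del d0 h] := fl (scale a x) e e0.
have a0 : 0 < `|a| + 1 by rewrite ltr_wpDl.
exists (del / (`|a| + 1)); first exact: divr_gt0.
move=> y xy; apply: h => j c jl; rewrite /scale !mxE -mulrBr normrM.
have := xy j c jl; rewrite ltr_pdivlMr// mulrDr mulr1 mulrC.
by apply: le_lt_trans; rewrite lerDl.
Qed.

Lemma lcb_phi_norm N (phi : R -> R) (L M : R) (j : int) : is_norm N ->
  0 <= L -> (forall a b, `|phi a - phi b| <= L * `|a - b|) ->
  (forall a, `|phi a| <= M) -> lcb (fun x => phi (N (x j))).
Proof.
move=> hN L0 phiL phiM; split; last by exists M.
have [C C0 NC] := norm_entries hN.
exists `|j|%N => x e e0.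
have LC : 0 < (L + 1) * C by rewrite mulr_gt0//; lra.
exists (e / ((L + 1) * C) / 2); first by rewrite !divr_gt0.
move=> y xy; rewrite (le_lt_trans (phiL _ _))//.
have h := le_trans (norm_lipschitz hN (x j) (y j)) (NC _ _ _ _).
have {}h : `|N (x j) - N (y j)| <= C * (e / ((L + 1) * C) / 2).
  apply: h; last by rewrite !divr_ge0// ltW.
  by move=> c; rewrite !mxE ltW// xy.
apply: (le_lt_trans (ler_wpM2l L0 h)).
have -> : L * (C * (e / ((L + 1) * C) / 2)) = L / (L + 1) * (e / 2).
  by field; rewrite !gt_eqF//; lra.
have : L / (L + 1) <= 1 by rewrite ler_pdivrMr; lra.
move: (L / (L + 1)) => a; nra.
Qed.

(** A section of [window (- l) (l + l).+1], through which a function of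
    finitely many coordinates is a function of a matrix. *)
Definition unwindow (l : nat) (z : 'M[R]_((l + l).+1, d)) : int -> 'rV[R]_d :=
  fun j => if (`|j| <= l)%N then row (inord (absz (j + l%:Z))) z else 0.

Lemma lcb_window f : lcb f -> exists (i : int) (k : nat)
    (F : 'M[R]_(k, d) -> R), [/\ continuous F,
    exists M, forall z, `|F z| <= M & forall x, f x = F (window i k x)].
Proof.
move=> [[l fl] [M fM]]; exists (- l%:Z), (l + l).+1, (f \o @unwindow l).
split; [|by exists M => z; exact: fM|].
  apply/continuous_mxP => z e e0; have [del d0 h] := fl (unwindow z) e e0.
  exists del => // z' zz'; apply: h => j c jl.
  by rewrite /unwindow jl !mxE; exact: zz'.
move=> x /=; apply: (loccont_eq fl) => j jl.
apply/rowP => c; rewrite /unwindow jl !mxE inordK; last by lia.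
by congr (x _ _ _); lia.
Qed.

Lemma lcb_measurable f : lcb f -> measurable_fun setT (f : S -> R).
Proof.
move=> /lcb_window [i [k [F [cF _ fF]]]].
rewrite (_ : f = F \o window i k); last by apply/funext => x; exact: fF.
apply: (measurableT_comp (f := (F : borel R k d -> R))).
  exact: measurable_continuous_mx.
exact: measurable_window.
Qed.

Lemma lcb_bm f : lcb f -> bm (f : S -> R).
Proof. by move=> lf; split; [exact: lcb_measurable|case: lf]. Qed.

End LocallyContinuous.

(** * Laws of random sequences are determined by test functions *)

Section Determining.
Context {R : realType} {d : nat}.
Notation S := (seq_space R d).
Implicit Types (x y : int -> 'rV[R]_d).

Definition ramp (k : nat) (v : R) : R := Num.min 1 (Num.max 0 (k%:R * v)).

Lemma ramp_ge0 k v : 0 <= ramp k v.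
Proof. by rewrite /ramp le_min ler01 le_max lexx. Qed.

Lemma ramp_le1 k v : ramp k v <= 1.
Proof. by rewrite /ramp ge_min lexx. Qed.

Lemma norm_ramp_le1 k v : `|ramp k v| <= 1.
Proof. by rewrite ger0_norm ?ramp_ge0// ramp_le1. Qed.

Lemma ramp_lipschitz k a b : `|ramp k a - ramp k b| <= k%:R * `|a - b|.
Proof.
rewrite -[k%:R in leRHS]ger0_norm// -normrM mulrBr /ramp.
move: (k%:R * a) (k%:R * b) => {}a {}b.
rewrite /Num.min /Num.max ler_norml; case: (ler_normlP _ _) (lexx `|a - b|) => // -[h1 h2] _.
by apply/andP; split; do !case: ifP; lra.
Qed.

Lemma ramp0 k v : v <= 0 -> ramp k v = 0.
Proof.
move=> v0; rewrite /ramp max_l; last by rewrite mulr_ge0_le0.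
by rewrite min_r// ler01.
Qed.

Lemma ramp1 k v : 1 <= k%:R * v -> ramp k v = 1.
Proof.
by move=> v1; rewrite /ramp max_r ?min_l//; apply: le_trans v1.
Qed.

Lemma cvg_ramp v : ramp k v @[k --> \oo] --> ((0 < v)%R%:R : R).
Proof.
case: (ltP 0 v) => v0; last first.
  by under eq_fun do rewrite ramp0//; exact: cvg_cst.
apply: (@cvg_trans _ ((fun=> 1) @ \oo)); last exact: cvg_cst.
apply: near_eq_cvg; near=> k; apply/esym/ramp1.
rewrite -ler_pdivrMr// div1r; near: k; exact: nbhs_infty_ger.
Unshelve. all: by end_near. Qed.

Lemma lcb_ramp k j c (a : R) : lcb (fun x => ramp k (x j ord0 c - a)).
Proof.
split; last by exists 1 => x; exact: norm_ramp_le1.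
exists `|j|%N => x e e0.
have k1 : 0 < k%:R + 1 :> R by rewrite ltr_wpDl.
exists (e / (k%:R + 1)); first exact: divr_gt0.
move=> y xy; rewrite (le_lt_trans (ramp_lipschitz _ _ _))//.
have := xy j c (leqnn _); rewrite ltr_pdivlMr// opprB addrA subrK.
apply: le_lt_trans; rewrite mulrC ler_wpM2l// lerDl//.
Qed.

Definition orthant (s : seq (int * 'I_d * R)) (x : int -> 'rV[R]_d) : bool :=
  all (fun p => p.2 < x p.1.1 ord0 p.1.2) s.

(** A generating class stable under intersection, whose indicators are limits
    of continuous functions of finitely many coordinates. *)
Definition orthants : set (set S) := [set B | exists s, B = [set x | orthant s x]].

Lemma orthantsI : setI_closed orthants.
Proof.
move=> _ _ [s ->] [s' ->]; exists (s ++ s'); apply/seteqP.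
by split => x /=; rewrite /orthant all_cat => /andP.
Qed.

Lemma measurable_orthant s : measurable_fun setT (orthant s : S -> bool).
Proof.
elim: s => [|p s IH] /=; first exact: measurable_cst.
apply: measurable_and => //.
apply: measurable_fun_ltr => //; exact: measurable_entry.
Qed.

Lemma seq_space_orthants : (measurable : set (set S)) = <<s orthants >>.
Proof.
apply/seteqP; split; last first.
  apply: smallest_sub; first exact: sigma_algebra_measurable.
  by move=> _ [s ->]; apply: measurable_setb; exact: measurable_orthant.
have := @measurable_seq_entry R d _ (g_sigma_algebraType orthants) id.
move=> h B mB; rewrite -[B]setTI -[setT `&` B]/(setT `&` id @^-1` B).
apply: h => // j c.
apply: (measurability _ (RGenOInfty.measurableE R)).
move=> _ [_ [a ->] <-]; rewrite setTI; apply: sub_sigma_algebra.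
exists [:: (j, c, a)]; apply/seteqP.
by split => x /=; rewrite /orthant /= in_itv /= !andbT.
Qed.

Definition soft_orthant (s : seq (int * 'I_d * R)) (k : nat) x : R :=
  \prod_(p <- s) ramp k (x p.1.1 ord0 p.1.2 - p.2).

Lemma lcb_soft_orthant s k : lcb (soft_orthant s k).
Proof.
rewrite /soft_orthant; elim: s => [|p s IH].
  by under eq_fun do rewrite big_nil; exact: lcb_cst.
under eq_fun do rewrite big_cons.
by apply: lcbM => //; exact: lcb_ramp.
Qed.

Lemma soft_orthant_le1 s k x : `|soft_orthant s k x| <= 1.
Proof.
rewrite /soft_orthant; elim: s => [|p s IH]; first by rewrite big_nil normr1.
by rewrite big_cons normrM mulr_ile1// norm_ramp_le1.
Qed.

Lemma cvg_soft_orthant s x :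
  soft_orthant s k x @[k --> \oo] --> ((orthant s x)%:R : R).
Proof.
rewrite /soft_orthant; elim: s => [|p s IH] /=.
  by under eq_fun do rewrite big_nil; exact: cvg_cst.
under eq_fun do rewrite big_cons.
rewrite -mulnb natrM; apply: cvgM => //.
by have := @cvg_ramp (x p.1.1 ord0 p.1.2 - p.2); rewrite subr_gt0.
Qed.

Context {d1 d2 : measure_display} {T1 : measurableType d1}
  {T2 : measurableType d2}.
Variables (P1 : probability T1 R) (P2 : probability T2 R).
Variables (Y1 : T1 -> S) (Y2 : T2 -> S) (w1 : T1 -> R) (w2 : T2 -> R).
Hypotheses (mY1 : measurable_fun setT Y1) (mY2 : measurable_fun setT Y2).
Hypotheses (bw1 : bm w1) (bw2 : bm w2).

Lemma bm_comp dT (T : measurableType dT) (Y : T -> S) (g : S -> R) :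
  measurable_fun setT Y -> bm g -> bm (fun t => g (Y t)).
Proof.
move=> mY [mg [M gM]]; split; first exact: measurableT_comp.
by exists M => t.
Qed.

Lemma bm_indic dT (T : measurableType dT) (B : set T) : measurable B ->
  bm (\1_B : T -> R).
Proof.
move=> mB; split; first exact: measurable_indic.
by exists 1 => t; rewrite indicE; case: (_ \in _) => /=; rewrite ?normr1 ?normr0.
Qed.

(** By linearity the identity extends to functions with finitely many values,
    and these are uniformly dense. *)
Lemma indic_determine :
  (forall B : set S, measurable B ->
    Ex P1 (fun t => \1_B (Y1 t) * w1 t) = Ex P2 (fun t => \1_B (Y2 t) * w2 t)) ->
  forall g : S -> R, bm g ->
    Ex P1 (fun t => g (Y1 t) * w1 t) = Ex P2 (fun t => g (Y2 t) * w2 t).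
Proof.
move=> Eset.
move=> g [mg [M gM]]; apply/eqP; rewrite -subr_eq0 -normr_le0.
apply/ler_addgt0Pl => e e0; rewrite addr0.
pose W := Ex P1 (fun t => `|w1 t|) + Ex P2 (fun t => `|w2 t|).
have W0 : 0 <= W by rewrite addr_ge0// Ex_ge0.
have e'0 : 0 < e / (W + 1) by rewrite divr_gt0//; lra.
have [n [q [a [mq qa _]]]] := quantize M e'0.
have mB i : measurable (g @^-1` (q @^-1` [set i])).
  by rewrite -[X in measurable X]setTI; exact: mg.
have approx dT (T : measurableType dT) (P : probability T R) (Y : T -> S)
    (w : T -> R) : measurable_fun setT Y -> bm w ->
    `|Ex P (fun t => g (Y t) * w t) -
      \sum_(i < n) a i * Ex P (fun t => \1_(g @^-1` (q @^-1` [set i])) (Y t) * w t)|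
    <= e / (W + 1) * Ex P (fun t => `|w t|).
  move=> mY bw.
  have bi i : bm (fun t => \1_(g @^-1` (q @^-1` [set i])) (Y t) * w t).
    by apply: bmM => //; exact: (bm_comp mY (bm_indic (mB i))).
  under eq_bigr do rewrite -ExZ//.
  rewrite -Ex_sum; last by move=> i; apply: bmM => //; exact: bm_cst.
  rewrite -ExZ; last exact: bm_norm.
  apply: dist_Ex.
  - by apply: bmM => //; apply: (bm_comp mY); split => //; exists M.
  - by apply: bm_sum => i; apply: bmM => //; exact: bm_cst.
  - by apply: bmM; [exact: bm_cst|exact: bm_norm].
  move=> t; have -> : \sum_(i < n) a i * (\1_(g @^-1` (q @^-1` [set i])) (Y t) * w t)
      = a (q (g (Y t))) * w t.
    rewrite (bigD1 (q (g (Y t))))//= big1 ?addr0.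
      by rewrite indicE mem_set// mul1r.
    move=> i iq; rewrite indicE memNset ?mul0r ?mulr0//= => iE.
    by rewrite -iE eqxx in iq.
  by rewrite -mulrBl normrM ler_wpM2r// qa.
have h1 := approx _ _ P1 Y1 w1 mY1 bw1.
have h2 := approx _ _ P2 Y2 w2 mY2 bw2.
move: h1; under eq_bigr do rewrite Eset//.
move: h2; set s := \sum_(i < n) _ => h2 h1.
rewrite -(subrKA s) (le_trans (ler_normD _ _))//.
rewrite (distrC s) (le_trans (lerD h1 h2))// -mulrDr -/W.
by rewrite -mulrA ger_pMr// mulrC ler_pdivrMr; lra.
Qed.

(** The sets whose indicators satisfy the identity form a lambda-system; it
    contains the orthants, whose indicators are limits of soft orthants, hence
    all measurable sets. *)
Lemma lcb_determine :
  (forall f, lcb f -> Ex P1 (fun t => f (Y1 t) * w1 t) =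
                      Ex P2 (fun t => f (Y2 t) * w2 t)) ->
  forall g : S -> R, bm g ->
    Ex P1 (fun t => g (Y1 t) * w1 t) = Ex P2 (fun t => g (Y2 t) * w2 t).
Proof.
move=> Ylcb.
have lim_ex dT (T : measurableType dT) (P : probability T R) (Y : T -> S)
    (w : T -> R) (f_ : nat -> S -> R) (f : S -> R) : measurable_fun setT Y ->
    bm w -> (forall n, measurable_fun setT (f_ n)) -> measurable_fun setT f ->
    (forall n x, `|f_ n x| <= 1) ->
    (forall x, f_ n x @[n --> \oo] --> f x) ->
    Ex P (fun t => f_ n (Y t) * w t) @[n --> \oo] -->
    Ex P (fun t => f (Y t) * w t).
  move=> mY [mw [M wM]] mf_ mf f1 fcvg.
  apply: (@Ex_bounded_cvg _ _ _ P (fun n t => f_ n (Y t) * w t) _ M).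
  - by move=> n; apply: measurable_funM => //; exact: measurableT_comp.
  - by apply: measurable_funM => //; exact: measurableT_comp.
  - move=> n t; rewrite normrM -[M]mul1r; exact: ler_pM.
  - by apply: aeW => t; apply: cvgMl; exact: fcvg.
apply: indic_determine.
pose H := [set B : set S | measurable B /\
    Ex P1 (fun t => \1_B (Y1 t) * w1 t) = Ex P2 (fun t => \1_B (Y2 t) * w2 t)].
  move=> B mB; suff : H B by case.
  have bI dT (T : measurableType dT) (Y : T -> S) (w : T -> R) (C : set S) :
      measurable_fun setT Y -> bm w -> measurable C ->
      bm (fun t => \1_C (Y t) * w t).
    by move=> mY bw mC; apply: bmM => //; exact: (bm_comp mY (bm_indic mC)).
  have mono_cvg (F : (set S)^nat) x : nondecreasing_seq F ->
      (\1_(F n) x : R) @[n --> \oo] --> (\1_(\bigcup_n F n) x : R).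
    move=> ndF; have [[n _ Fnx]|nFx] := pselect ((\bigcup_n F n) x).
      apply: (@cvg_trans _ ((fun=> 1) @ \oo)).
        apply: near_eq_cvg; near=> m; rewrite indicE mem_set//.
        have nm : (n <= m)%N by near: m; exact: nbhs_infty_ge.
        by have /subsetPset := ndF _ _ nm; apply.
      by rewrite indicE mem_set; [exact: cvg_cst|exists n].
    rewrite indicE memNset//.
    have F0 n : \1_(F n) x = 0 :> R.
      by rewrite indicE memNset// => Fn; apply: nFx; exists n.
    by under eq_fun do rewrite F0; exact: cvg_cst.
  rewrite seq_space_orthants in mB; move: B mB.
  apply: (@lambda_system_subset _ _ orthantsI setT H).
  - split => //.
    + split => //.
      have := Ylcb _ (lcb_cst 1); rewrite indicT.
      exact.
    + move=> A C CA [mA EA] [mC EC]; split; first exact: measurableD.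
      have E (x : S) : \1_(A `\` C) x = \1_A x - \1_C x :> R.
        rewrite !indicE in_setD; have [xC|xC] := boolP (x \in C) => /=.
          by rewrite mem_set ?subrr//; apply: CA; rewrite inE in xC.
        by rewrite andbT subr0.
      under eq_fun do rewrite E mulrBl.
      under [in RHS]eq_fun do rewrite E mulrBl.
      by rewrite !ExB ?EA ?EC//; exact: bI.
    + move=> F ndF HF; split.
        by apply: bigcupT_measurable => n; have [] := HF n.
      have mF n : measurable (F n) by have [] := HF n.
      have mU := bigcupT_measurable _ mF.
      have I1 n (x : S) : `|\1_(F n) x : R| <= 1.
        by rewrite indicE; case: (_ \in _) => /=; rewrite ?normr1 ?normr0.
      have c1 := lim_ex _ _ P1 Y1 w1 (fun n => \1_(F n)) _ mY1 bw1
        (fun n => measurable_indic (mF n)) (measurable_indic mU) I1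
        (fun x => mono_cvg F x ndF).
      have c2 := lim_ex _ _ P2 Y2 w2 (fun n => \1_(F n)) _ mY2 bw2
        (fun n => measurable_indic (mF n)) (measurable_indic mU) I1
        (fun x => mono_cvg F x ndF).
      apply: (cvg_unique _ c1) => //.
      by rewrite (funext (fun n => proj2 (HF n))).
  - move=> _ [s ->]; split.
      by apply: measurable_setb; exact: measurable_orthant.
    have E (x : S) : \1_[set x | orthant s x] x = (orthant s x)%:R :> R.
      by rewrite indicE; congr (nat_of_bool _)%:R; apply/idP/idP; rewrite inE.
    under eq_fun do rewrite E; under [in RHS]eq_fun do rewrite E.
    have mo : measurable_fun setT (fun x : S => (orthant s x)%:R : R).
      by have [] := bm_bool (R := R) (measurable_orthant s).
    have c1 := lim_ex _ _ P1 Y1 w1 (soft_orthant s) _ mY1 bw1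
      (fun n => lcb_measurable (lcb_soft_orthant s n)) mo
      (fun n x => soft_orthant_le1 s n x) (@cvg_soft_orthant s).
    have c2 := lim_ex _ _ P2 Y2 w2 (soft_orthant s) _ mY2 bw2
      (fun n => lcb_measurable (lcb_soft_orthant s n)) mo
      (fun n x => soft_orthant_le1 s n x) (@cvg_soft_orthant s).
    apply: (cvg_unique _ c1) => //.
    by rewrite (funext (fun n => Ylcb _ (lcb_soft_orthant s n))).
  - by [].
Unshelve. all: by end_near. Qed.

End Determining.

(** * The tail of a regularly varying series *)

Lemma continuous_powR {R : realType} (a t : R) : 0 < t ->
  {for t, continuous (fun x => x `^ a)}.
Proof.
move=> t0; apply/differentiable_continuous/derivable1_diffP.
by apply: derivable_powR; rewrite in_itv /= andbT.
Qed.

Lemma powRN_cont {R : realType} (alpha s e : R) : 0 < s -> 0 < e ->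
  exists2 del : R, 0 < del &
  forall y : R, `|s - y| < del -> `|s `^ (- alpha) - y `^ (- alpha)| < e.
Proof.
move=> s0 e0.
have /cvgrPdist_lt/(_ e e0)/nbhs_ballP[del /= dl h] :=
  @continuous_powR _ (- alpha) _ s0.
by exists del => // y sy; exact: h.
Qed.

Section RegularVariation.
Context {R : realType} {d : nat} {dT : measure_display}
  {T : measurableType dT} {P : probability T R}.
Variables (N : 'rV[R]_d -> R) (X : {RV P >-> seq_space R d}).
Hypothesis hN : is_norm N.

Definition tailp (x : R) : R := prob P [set t | x < N (X t 0)].

Lemma measurable_norm_RV j : measurable_fun setT (fun t => N (X t j)).
Proof.
apply: (@measurableT_comp _ _ _ _ _ _
  (fun x : seq_space R d => N ((x : int -> 'rV[R]_d) j)) setT X) => //.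
exact: measurable_norm_coord.
Qed.

Lemma measurable_exceed (x : R) j : measurable_fun setT (fun t => x < N (X t j)).
Proof. by apply: measurable_fun_ltr => //; exact: measurable_norm_RV. Qed.

Lemma tailpE x : tailp x = Ex P (fun t => (x < N (X t 0))%R%:R).
Proof. by rewrite Ex_bool//; exact: measurable_exceed. Qed.

Lemma tailp_ge0 x : 0 <= tailp x.
Proof. by rewrite /tailp /prob fine_ge0. Qed.

Lemma tailp_le x y : x <= y -> tailp y <= tailp x.
Proof.
move=> xy; rewrite !tailpE; apply: le_Ex => [||t].
- by apply: bm_bool; exact: measurable_exceed.
- by apply: bm_bool; exact: measurable_exceed.
- by rewrite ler_nat; case: ltP => // h; rewrite (le_lt_trans xy h).
Qed.

Variables (alpha : R) (alpha_gt0 : 0 < alpha).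
Hypothesis X_rv : regularly_varying N X alpha.
Hypothesis tailp_gt0 : forall x, 0 < tailp x.

Definition trapeze (a b v : R) : R := Num.min 1 (Num.max 0 ((v - a) / (b - a))).

Lemma trapeze_ge0 a b v : 0 <= trapeze a b v.
Proof. by rewrite /trapeze le_min ler01 le_max lexx. Qed.

Lemma trapeze_le1 a b v : trapeze a b v <= 1.
Proof. by rewrite /trapeze ge_min lexx. Qed.

Lemma norm_trapeze_le1 a b v : `|trapeze a b v| <= 1.
Proof. by rewrite ger0_norm ?trapeze_ge0// trapeze_le1. Qed.

Lemma trapeze0 a b v : a < b -> v <= a -> trapeze a b v = 0.
Proof.
move=> ab va; rewrite /trapeze max_l; first by rewrite min_r.
by rewrite pmulr_lle0 ?invr_gt0; lra.
Qed.

Lemma trapeze1 a b v : a < b -> b <= v -> trapeze a b v = 1.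
Proof.
move=> ab va; rewrite /trapeze max_r ?min_l//.
  by rewrite ler_pdivlMr; lra.
by rewrite divr_ge0; lra.
Qed.

Lemma trapeze_lipschitz a b v w : a < b ->
  `|trapeze a b v - trapeze a b w| <= (b - a)^-1 * `|v - w|.
Proof.
move=> ab; have ba0 : 0 < (b - a)^-1 by rewrite invr_gt0; lra.
rewrite -[(b - a)^-1 in leRHS]ger0_norm; last exact: ltW.
rewrite -normrM /trapeze.
have -> : (b - a)^-1 * (v - w) = (v - a) / (b - a) - (w - a) / (b - a).
  by field; rewrite gt_eqF//; lra.
move: ((v - a) / (b - a)) ((w - a) / (b - a)) => {}v {}w.
rewrite /Num.min /Num.max ler_norml; case: (ler_normlP _ _) (lexx `|v - w|) => // -[h1 h2] _.
by apply/andP; split; do !case: ifP; lra.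
Qed.

Lemma lt_trapeze a b v : a < b -> (b < v)%R%:R <= trapeze a b v.
Proof.
move=> ab; case: ltP => bv /=; last exact: trapeze_ge0.
by rewrite trapeze1// ltW.
Qed.

Lemma trapeze_lt a b v : a < b -> trapeze a b v <= (a < v)%R%:R.
Proof.
move=> ab; case: ltP => av /=; first exact: trapeze_le1.
by rewrite trapeze0.
Qed.

Lemma tail_trapeze (a b x : R) : 0 < x -> a < b ->
  let E := Ex P (fun t => trapeze a b (x^-1 * N (X t 0))) in
  tailp (b * x) <= E <= tailp (a * x).
Proof.
move=> x0 ab /=.
have mtr : bm (fun t => trapeze a b (x^-1 * N (X t 0))).
  have h : lcb (fun y : int -> 'rV[R]_d => trapeze a b (N (scale x^-1 y 0))).
    apply: (@lcb_scale _ _ x^-1 (fun y => trapeze a b (N (y 0)))).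
    apply: (lcb_phi_norm 0 hN _ (fun v w => trapeze_lipschitz v w ab)
      (norm_trapeze_le1 a b)).
    by rewrite invr_ge0; lra.
  have := bm_comp (measurable_funPT X) (lcb_bm h).
  congr bm; apply/funext => t; rewrite /scale normZ// gtr0_norm// invr_gt0//.
rewrite !tailpE; apply/andP; split; apply: le_Ex => // [|t].
- by apply: bm_bool; exact: measurable_exceed.
- by rewrite mulrC -ltr_pdivlMl// lt_trapeze.
- by apply: bm_bool; exact: measurable_exceed.
- by rewrite [a * x]mulrC -ltr_pdivlMl// trapeze_lt.
Qed.

(** Regular variation tested on a continuous function that vanishes near 0. By
    homogeneity the complements of the balls of radius [a] and [b] have the
    masses [a `^ (- alpha) * V] and [b `^ (- alpha) * V], and they enclose the
    limit. *)
Lemma rv_trapeze : exists V : R, forall a b : R, 0 < a -> a < b ->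
  exists I : R, [/\ b `^ (- alpha) * V <= I, I <= a `^ (- alpha) * V &
   Ex P (fun t => trapeze a b (x^-1 * N (X t 0))) / tailp x @[x --> +oo] --> I].
Proof.
have [nu [_ _ nufin nuhom nucvg]] := X_rv 0 (ltn0Sn 0).
have cN := is_norm_continuous hN.
have Nopen (a : R) : open [set z : 'M[R]_(1, d) | a < N z].
  by apply: (@open_comp _ _ N [set x | a < x]) => // x _; exact: cN.
have Nopen' (a : R) : open [set z : 'M[R]_(1, d) | N z < a].
  by apply: (@open_comp _ _ N [set x | x < a]) => // x _; exact: cN.
have mG (a : R) : measurable ([set z : 'M[R]_(1, d) | a < N z] : set (borel R 1 d)).
  by apply: sub_sigma_algebra; exact: Nopen.
pose G (a : R) := nu [set z : 'M[R]_(1, d) | a < N z].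
have Gfin (a : R) : 0 < a -> (G a < +oo)%E.
  move=> a0; have N0a : [set z : 'M[R]_(1, d) | N z < a] 0 by rewrite /= norm0.
  apply: le_lt_trans (nufin _ (Nopen' a) N0a).
  apply: le_measure; rewrite ?inE; first exact: mG.
    by apply: measurableC; apply: sub_sigma_algebra; exact: Nopen'.
  by move=> z /= az; apply/negP; rewrite -leNgt ltW.
have GE (t : R) : 0 < t -> G t = ((t `^ (- alpha))%:E * G 1%R)%E.
  move=> t0; rewrite /G -nuhom//; congr (nu _); apply/seteqP; split => z /=.
    move=> tz; exists (t^-1 *: z); last by rewrite scalerA mulfV ?gt_eqF// scale1r.
    by rewrite normZ// gtr0_norm ?invr_gt0// -ltr_pdivrMl ?invr_gt0// invrK mulr1.
  move=> [w w1 <-]; rewrite normZ// gtr0_norm//.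
  by rewrite -[X in X < _]mulr1 ltr_pM2l.
exists (fine (G 1)) => a b a0 ab.
have G1 : G 1 \is a fin_num by rewrite ge0_fin_numE// Gfin.
pose psi (z : 'M[R]_(1, d)) := trapeze a b (N z).
have cpsi : continuous psi.
  have [C C0 NC] := norm_entries hN.
  have ba0 : 0 < (b - a)^-1 by rewrite invr_gt0; lra.
  apply/continuous_mxP => z e e0; exists (e / ((b - a)^-1 * C) / 2).
    by rewrite !divr_gt0// mulr_gt0.
  move=> z' zz'; rewrite /psi (le_lt_trans (trapeze_lipschitz _ _ ab))//.
  have h : N (z - z') <= C * (e / ((b - a)^-1 * C) / 2).
    apply: NC => [c|]; first by rewrite !mxE ltW.
    by rewrite !divr_ge0 ?(mulr_ge0 _ (ltW C0))// ltW.
  have {}h := le_trans (norm_lipschitz hN z z') h.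
  apply: (le_lt_trans (ler_wpM2l (ltW ba0) h)).
  move: ((b - a)^-1) ba0 => c c0.
  have -> : c * (C * (e / (c * C) / 2)) = e / 2 by field; rewrite !gt_eqF.
  lra.
have mpsi : measurable_fun setT (EFin \o psi : borel R 1 d -> _).
  by apply/measurable_EFinP; exact: measurable_continuous_mx.
have GI c : G c = (\int[nu]_z (\1_[set z : borel R 1 d | (c < N z)%R] z)%:E)%E.
  by rewrite integral_indic// setIT.
have I1 : (G b <= \int[nu]_z (psi z)%:E)%E.
  rewrite GI.
  apply: ge0_le_integral => //.
  - by apply/measurable_EFinP; apply: measurable_indic; exact: mG.
  - move=> z _; rewrite lee_fin indicE; have := lt_trapeze (N z) ab.
    by congr (_ <= _); congr (nat_of_bool _)%:R; apply/idP/idP; rewrite inE.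
have I2 : (\int[nu]_z (psi z)%:E <= G a)%E.
  rewrite GI.
  apply: ge0_le_integral => //.
  - by move=> z _; rewrite lee_fin trapeze_ge0.
  - by apply/measurable_EFinP; apply: measurable_indic; exact: mG.
  - move=> z _; rewrite lee_fin indicE; have := trapeze_lt (N z) ab.
    by congr (_ <= _); congr (nat_of_bool _)%:R; apply/idP/idP; rewrite inE.
have b0 : 0 < b by lra.
have Ifin : (\int[nu]_z (psi z)%:E \is a fin_num)%E.
  rewrite ge0_fin_numE; first by rewrite (le_lt_trans I2)// Gfin.
  by apply: integral_ge0 => z _; rewrite lee_fin trapeze_ge0.
exists (\int[nu]_z psi z); rewrite /Rintegral; split.
- by rewrite -lee_fin fineK// EFinM fineK// -GE.
- by rewrite -lee_fin fineK// EFinM fineK// -GE.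
have := nucvg psi cpsi.
have pn : \forall z \near (0 : 'M[R]_(1, d)), psi z = 0.
  have : nbhs (0 : 'M[R]_(1, d)) [set z : 'M[R]_(1, d) | N z < a].
    by apply: open_nbhs_nbhs; split; [exact: Nopen'|rewrite /= norm0].
  by apply: filterS => z /= za; rewrite /psi trapeze0// ltW.
have psib : exists M : R, forall z, `|psi z| <= M.
  by exists 1 => z; exact: norm_trapeze_le1.
move=> /(_ psib pn).
apply: cvg_trans; apply: near_eq_cvg; near=> x.
have x0 : 0 < x by near: x; exact: nbhs_pinfty_gt.
congr (_ / _); rewrite /Ex; congr Rintegral; apply/funext => t.
rewrite /psi; congr trapeze.
rewrite -[x^-1]gtr0_norm ?invr_gt0// -normZ//; congr N.
by apply/rowP => c; rewrite !mxE gtr0_norm ?invr_gt0.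
Unshelve. all: by end_near. Qed.

(** Squeezing [tailp] between two trapezes shows that the limit is [V * t `^
    (- alpha)]; the ratio at [t = 1] forces [V = 1]. *)
Lemma rv_ratio (t : R) : 0 < t ->
  tailp (t * x) / tailp x @[x --> +oo] --> t `^ (- alpha).
Proof.
have [V hV] := rv_trapeze.
have sandwich (a b : R) : 0 < a -> a < b -> forall e, 0 < e ->
    \forall x \near +oo, b `^ (- alpha) * V - e <= tailp (a * x) / tailp x /\
       tailp (b * x) / tailp x <= a `^ (- alpha) * V + e.
  move=> a0 ab e e0; have [I [bI Ia cI]] := hV a b a0 ab.
  have /cvgrPdist_le/(_ e e0) := cI; apply: filter_app; near=> x.
  have x0 : 0 < x by near: x; exact: nbhs_pinfty_gt.
  move=> /ler_normlP[h1 h2].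
  have := tail_trapeze x0 ab => /= /andP[].
  rewrite -(ler_pM2r (_ : 0 < (tailp x)^-1)) ?invr_gt0// => h3.
  rewrite -(ler_pM2r (_ : 0 < (tailp x)^-1)) ?invr_gt0// => h4.
  by split; lra.
have ratio1 x : tailp (1 * x) / tailp x = 1 by rewrite mul1r divff// gt_eqF.
have powV (s e : R) : 0 < s -> 0 < e -> exists2 del : R, 0 < del < s &
    forall y, `|s - y| < del -> `|s `^ (- alpha) * V - y `^ (- alpha) * V| < e.
  move=> s0 e0; have V0 : 0 < `|V| + 1 by rewrite ltr_wpDl.
  have [del d0 h] := powRN_cont alpha s0 (divr_gt0 e0 V0).
  exists (Num.min del (s / 2)).
    by rewrite lt_min d0 divr_gt0// gt_min; apply/orP; right; lra.
  move=> y; rewrite lt_min => /andP[sy _].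
  have := h y sy; rewrite -mulrBl normrM ltr_pdivlMr// mulrDr mulr1.
  by apply: le_lt_trans; rewrite lerDl.
have V1 : V = 1.
  apply/eqP; rewrite -subr_eq0 -normr_le0; apply/ler_addgt0Pl => e e0; rewrite addr0.
  have e2 : 0 < e / 2 by lra.
  have [del /andP[d0 d1] h] := powV 1 (e / 2) ltr01 e2.
  have dl : 1 < 1 + del / 2 by lra.
  have dl' : 1 - del / 2 < 1 by lra.
  have [x [+ _]] := filter_ex (sandwich 1 _ ltr01 dl _ e2).
  have [|x' [_ +]] := filter_ex (sandwich (1 - del / 2) 1 _ dl' _ e2); first by lra.
  rewrite !ratio1.
  have n1 : `|1 - (1 + del / 2)| < del by rewrite ltr_norml; apply/andP; split; lra.
  have n2 : `|1 - (1 - del / 2)| < del by rewrite ltr_norml; apply/andP; split; lra.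
  have /ltr_normlP[h11 h12] := h _ n1.
  have /ltr_normlP[h21 h22] := h _ n2.
  rewrite powR1 mul1r in h11 h12 h21 h22.
  by move=> g1 g2; rewrite ler_norml; apply/andP; split; lra.
move=> t0; apply/cvgrPdist_le => e e0.
have e2 : 0 < e / 2 by lra.
have [del /andP[d0 d1] h] := powV t (e / 2) t0 e2.
have dl : t < t + del / 2 by lra.
have dl' : t - del / 2 < t by lra.
have s1 := sandwich t _ t0 dl _ e2.
have dt0 : 0 < t - del / 2 by lra.
have := sandwich _ t dt0 dl' _ e2.
apply: filter_app; move: s1; apply: filterS => x [g1 _] [_ g2].
have h1 : `|t - (t + del / 2)| < del by rewrite ltr_norml; apply/andP; split; lra.
have h2 : `|t - (t - del / 2)| < del by rewrite ltr_norml; apply/andP; split; lra.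
have /ltr_normlP[h11 h12] := h _ h1.
have /ltr_normlP[h21 h22] := h _ h2.
rewrite V1 !mulr1 in g1 g2 h11 h12 h21 h22.
by rewrite ler_norml; apply/andP; split; lra.
Unshelve. all: by end_near. Qed.

End RegularVariation.

(** * Convergence to the tail process *)

Lemma scaleA_seq {R : realType} {d : nat} (a b : R) (x : int -> 'rV[R]_d) :
  scale a (scale b x) = scale (a * b) x.
Proof. by apply/funext => j; rewrite /scale scalerA. Qed.

Lemma shift_scale {R : realType} {d : nat} k (a : R) (x : int -> 'rV[R]_d) :
  shift k (scale a x) = scale a (shift k x).
Proof. by []. Qed.

Section TailProcess.
Context {R : realType} {d : nat} {d1 d2 : measure_display}
  {T1 : measurableType d1} {T2 : measurableType d2}
  {P : probability T1 R} {PY : probability T2 R}.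
Variables (N : 'rV[R]_d -> R) (X : {RV P >-> seq_space R d})
  (Y : {RV PY >-> seq_space R d}).
Notation S := (seq_space R d).
Implicit Types (f g : (int -> 'rV[R]_d) -> R).
Hypothesis hN : is_norm N.
Hypothesis X_stationary : stationary X.
Local Notation p := (tailp N X).

Lemma bmX f : bm (f : S -> R) -> bm (fun t => f (X t)).
Proof. exact: bm_comp. Qed.

Lemma bmY f : bm (f : S -> R) -> bm (fun t => f (Y t)).
Proof. exact: bm_comp. Qed.

Lemma bm_scale (a : R) f : bm (f : S -> R) -> bm (fun x : S => f (scale a x)).
Proof. by move=> bf; exact: (bm_comp (measurable_scale a) bf). Qed.

Lemma bm_shift k f : bm (f : S -> R) -> bm (fun x : S => f (shift k x)).
Proof. by move=> bf; exact: (bm_comp (measurable_shift k) bf). Qed.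

Lemma bm_exceed (a : R) j : bm (fun x : S => (a < N (x j))%R%:R : R).
Proof.
apply: bm_bool; apply: measurable_fun_ltr => //.
exact: measurable_norm_coord.
Qed.

Lemma Ex_shift k f : bm (f : S -> R) ->
  Ex P (fun t => f (shift k (X t))) = Ex P (fun t => f (X t)).
Proof.
move=> bf.
have mk : measurable_fun setT (fun t => shift k (X t) : S).
  by apply: (measurableT_comp (f := shift k : S -> S)) => //; exact: measurable_shift.
have := @indic_determine _ _ _ _ _ _ P P _ _ (fun=> 1) (fun=> 1) mk
  (measurable_funPT X) (bm_cst 1) (bm_cst 1).
have E1 (h : T1 -> R) : Ex P (fun t => h t * 1) = Ex P h.
  by congr Ex; apply/funext => t; rewrite mulr1.
move=> /(_ _ f bf); rewrite !E1; apply=> B mB; rewrite !E1.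
have E (V : T1 -> S) : measurable_fun setT V ->
    Ex P (fun t => \1_B (V t)) = fine (P [set t | B (V t)]).
  move=> mV; rewrite /Ex /Rintegral.
  rewrite (_ : (fun t => (\1_B (V t))%:E) = (fun t => (\1_(V @^-1` B) t)%:E)).
    rewrite integral_indic ?setIT//.
    by rewrite -[X in measurable X]setTI; exact: mV.
  by apply/funext => t; rewrite !indicE; congr (nat_of_bool _)%:R%:E;
    apply/idP/idP; rewrite !inE.
by rewrite E// E// X_stationary.
Qed.

Lemma prob_exceed_shift (a : R) j :
  Ex P (fun t => (a < N (X t j))%R%:R) = p a.
Proof.
rewrite tailpE// -(@Ex_shift j _ (bm_exceed a 0)).
by congr Ex; apply/funext => t; rewrite /shift add0r.
Qed.

(** Conditional expectation given an exceedance of [x] at time 0. *)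
Definition condE (x : R) f : R :=
  Ex P (fun t => f (scale x^-1 (X t)) * (x < N (X t 0))%R%:R) / p x.

Hypothesis Y_tail : is_tail_process N X Y.
Hypothesis tailp_gt0 : forall x, 0 < p x.

Lemma tail_lcb f : lcb f -> condE x f @[x --> +oo] --> Ex PY (fun t => f (Y t)).
Proof.
move=> /lcb_window [i [k [F [cF bF fF]]]].
rewrite (_ : (fun t => f (Y t)) = (fun t => F (window i k (Y t)))); last first.
  by apply/funext => t; exact: fF.
have := @Y_tail i k F cF bF; rewrite -/(Ex PY _).
suff -> : condE^~ f = (fun x => (\int[P]_(t in [set t | x < N (X t 0)])
  F (window i k (scale x^-1 (X t)))) / prob P [set t | x < N (X t 0)]) by [].
apply/funext => x; rewrite /condE; congr (_ / _).
rewrite Rintegral_mkcond; congr Rintegral; apply/funext => t.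
rewrite patchE -fF; case: ifPn; rewrite ?inE ?notin_setE /= => h.
  by rewrite h mulr1.
by rewrite (negbTE (introN idP h)) mulr0.
Qed.

Lemma condE_dist x f g h : bm (f : S -> R) -> bm (g : S -> R) ->
  bm (h : S -> R) ->
  (forall y, `|f y - g y| <= h y) -> `|condE x f - condE x g| <= condE x h.
Proof.
move=> bf bg bh fgh; rewrite /condE -mulrBl normrM.
rewrite (@ger0_norm _ (p x)^-1) ?invr_ge0 ?tailp_ge0// ler_pM2r ?invr_gt0//.
apply: dist_Ex => [|||t].
- by apply: bmM; [exact: (bmX (bm_scale _ bf))|exact: (bmX (bm_exceed _ _))].
- by apply: bmM; [exact: (bmX (bm_scale _ bg))|exact: (bmX (bm_exceed _ _))].
- by apply: bmM; [exact: (bmX (bm_scale _ bh))|exact: (bmX (bm_exceed _ _))].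
- by rewrite -mulrBl normrM (@ger0_norm _ (_)%:R)// ler_wpM2r.
Qed.

(** Functions sandwiched by test functions up to small means for the tail
    process; in substance, the functions continuous outside a null set of its
    law. In this form they are stable under products. *)
Definition good f : Prop := bm (f : S -> R) /\ forall e : R, 0 < e ->
  exists h b : (int -> 'rV[R]_d) -> R, [/\ lcb h, lcb b,
    (forall x, `|f x - h x| <= b x) & Ex PY (fun t => b (Y t)) <= e].

Lemma good_lcb f : lcb f -> good f.
Proof.
move=> lf; split; first exact: lcb_bm.
move=> e e0; exists f, (fun=> 0); split => //; first exact: lcb_cst.
  by move=> x; rewrite subrr normr0.
by rewrite Ex_cst ltW.
Qed.

Lemma goodM f g : good f -> good g -> good (fun x => f x * g x).
Proof.
move=> [bf af] [bg ag]; split; first exact: bmM.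
move=> e e0.
have [_ [M fM]] := bf.
have M0 : 0 < `|M| + 1 by rewrite ltr_wpDl.
have e1 : 0 < e / 2 / (`|M| + 1) by rewrite !divr_gt0.
have [g' [b' [lg' lb' gg' Eb']]] := ag _ e1.
have [_ [M' gM']] := lg'.
have M'0 : 0 < `|M'| + 1 by rewrite ltr_wpDl.
have e2 : 0 < e / 2 / (`|M'| + 1) by rewrite !divr_gt0.
have [f' [b [lf' lb ff' Eb]]] := af _ e2.
exists (fun x => f' x * g' x), (fun x => (`|M| + 1) * b' x + (`|M'| + 1) * b x).
split.
- exact: lcbM.
- by apply: lcbD; apply: lcbM => //; exact: lcb_cst.
- move=> x; have -> : f x * g x - f' x * g' x =
    f x * (g x - g' x) + g' x * (f x - f' x) by ring.
  rewrite (le_trans (ler_normD _ _))// !normrM lerD// ler_pM//.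
    by rewrite (le_trans (fM x))// (le_trans (ler_norm _))// lerDl.
  by rewrite (le_trans (gM' x))// (le_trans (ler_norm _))// lerDl.
have bbY (b0 : (int -> 'rV[R]_d) -> R) : lcb b0 -> bm (fun t => b0 (Y t)).
  by move=> /lcb_bm/bmY.
rewrite ExD; try by apply: bmM; [exact: bm_cst|exact: bbY].
rewrite !ExZ; try exact: bbY.
move: Eb Eb'; rewrite !ler_pdivlMr// => Eb Eb'.
by rewrite (splitr e) !(mulrC (_ + 1)) lerD//; lra.
Qed.

(** The continuous mapping theorem for the convergence to the tail process. *)
Lemma good_cvg f : good f ->
  condE x f @[x --> +oo] --> Ex PY (fun t => f (Y t)).
Proof.
move=> [bf af]; apply/cvgrPdist_le => e e0.
have e4 : 0 < e / 4 by lra.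
have [h [b [lh lb fh Eb]]] := af _ e4.
have /cvgrPdist_le/(_ _ e4) Hh := tail_lcb lh.
have /cvgrPdist_le/(_ _ e4) := tail_lcb lb.
apply: filter_app; apply: filterS Hh => x /ler_normlP[h1 h2] /ler_normlP[b1 b2].
have := condE_dist x bf (lcb_bm lh) (lcb_bm lb) fh.
have := @dist_Ex _ _ _ PY _ _ _ (bmY bf) (bmY (lcb_bm lh)) (bmY (lcb_bm lb))
  (fun t => fh (Y t)).
move=> /ler_normlP[c1 c2] /ler_normlP[d1' d2'].
by rewrite ler_norml; apply/andP; split; lra.
Qed.

Lemma lcb_ramp_norm k j (a : R) : lcb (fun x => ramp k (N (x j) - a)).
Proof.
apply: (lcb_phi_norm (phi := fun v => ramp k (v - a)) (L := k%:R) (M := 1)) => //.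
- by move=> v w; rewrite (le_trans (ramp_lipschitz _ _ _))// opprB addrA subrK.
- by move=> v; exact: norm_ramp_le1.
Qed.

Lemma bm_eqnorm (a : R) j : bm (fun x : S => (N (x j) == a)%:R : R).
Proof.
apply: bm_bool; apply: measurable_fun_eqr => //.
exact: measurable_norm_coord.
Qed.

(** The indicator is discontinuous only where the norm equals [a]; two shifted
    ramps enclose it. *)
Lemma good_exceed j (a : R) : Ex PY (fun t => (N (Y t j) == a)%:R) = 0 ->
  good (fun x => (a < N (x j))%R%:R).
Proof.
move=> atom0; split; first exact: bm_exceed.
move=> e e0.
pose b k (x : int -> 'rV[R]_d) :=
  ramp k (N (x j) - (a - k%:R^-1)) - ramp k (N (x j) - (a + k%:R^-1)).
have lb k : lcb (b k) by apply: lcbB; exact: lcb_ramp_norm.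
have bcvg v : ramp k (v - (a - k%:R^-1)) - ramp k (v - (a + k%:R^-1))
    @[k --> \oo] --> ((v == a)%:R : R).
  have -> : (v == a)%:R = (a <= v)%R%:R - (a < v)%R%:R :> R.
    by case: ltgtP => _; rewrite /= ?subrr ?subr0.
  apply: cvgB.
    case: leP => av.
      apply: (@cvg_trans _ ((fun=> 1) @ \oo)); last exact: cvg_cst.
      apply: near_eq_cvg; near=> k; apply/esym/ramp1.
      have k0 : 0 < k%:R :> R by rewrite ltr0n; near: k; exists 1%N.
      rewrite opprB addrCA mulrDr mulfV ?gt_eqF// lerDl mulr_ge0 ?subr_ge0 //.
    apply: (@cvg_trans _ ((fun=> 0 : R) @ \oo)); last exact: cvg_cst.
    apply: near_eq_cvg; near=> k; apply/esym/ramp0.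
    have k0 : 0 < k%:R :> R by rewrite ltr0n; near: k; exists 1%N.
    have kav : (a - v)^-1 <= k%:R by near: k; exact: nbhs_infty_ger.
    have : k%:R^-1 <= a - v.
      by rewrite -[leRHS]invrK lef_pV2 ?posrE ?invr_gt0 ?subr_gt0.
    by move: (k%:R^-1) => c; lra.
  case: ltP => av; last first.
    apply: (@cvg_trans _ ((fun=> 0 : R) @ \oo)); last exact: cvg_cst.
    apply: near_eq_cvg; near=> k; apply/esym/ramp0.
    by rewrite subr_le0 (le_trans av)// lerDl.
  apply: (@cvg_trans _ ((fun=> 1) @ \oo)); last exact: cvg_cst.
  apply: near_eq_cvg; near=> k; apply/esym/ramp1.
  have k0 : 0 < k%:R :> R by rewrite ltr0n; near: k; exists 1%N.
  have kav : 2 / (v - a) <= k%:R by near: k; exact: nbhs_infty_ger.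
  rewrite opprD addrA mulrBr mulfV ?gt_eqF//.
  by move: kav; rewrite ler_pdivrMr ?subr_gt0//; lra.
have : Ex PY (fun t => b k (Y t)) @[k --> \oo] --> (0 : R).
  rewrite -atom0.
  apply: (@Ex_bounded_cvg _ _ _ PY (fun k t => b k (Y t)) _ 2).
  - by move=> k; have [] := bmY (lcb_bm (lb k)).
  - by have [] := bmY (bm_eqnorm a j).
  - move=> k t; rewrite (le_trans (ler_normB _ _))// -[2]/(1 + 1) lerD//;
      exact: norm_ramp_le1.
  - by apply: aeW => t; exact: bcvg.
move=> /cvgrPdist_le/(_ _ e0) [k0 _ /(_ (maxn k0 1) (leq_maxl _ _))] /=.
set k := maxn k0 1; have k_gt0 : 0 < k%:R :> R by rewrite ltr0n leq_maxr.
rewrite sub0r normrN => Eb.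
exists (fun x => ramp k (N (x j) - a)), (b k); split => //.
- exact: lcb_ramp_norm.
- move=> x; rewrite /b; move: (N (x j)) => v.
  have mono u w : u <= w -> ramp k u <= ramp k w.
    move=> uw; have kuw : k%:R * u <= k%:R * w by apply: ler_wpM2l => //; exact: ltW.
    rewrite /ramp; move: (k%:R * u) (k%:R * w) kuw {uw} => {}u {}w kuw.
    by rewrite /Num.min /Num.max; do !case: ifP; lra.
  have ik : 0 < k%:R^-1 :> R by rewrite invr_gt0.
  have m1 : ramp k (v - (a + k%:R^-1)) <= ramp k (v - a) by apply: mono; lra.
  have m2 : ramp k (v - a) <= ramp k (v - (a - k%:R^-1)) by apply: mono; lra.
  case: (ltP a v) => av /=.
    have -> : ramp k (v - (a - k%:R^-1)) = 1.
      apply: ramp1; rewrite opprB addrCA mulrDr mulfV ?gt_eqF// lerDl.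
      by rewrite mulr_ge0 ?subr_ge0// ltW.
    by rewrite ger0_norm ?subr_ge0 ?ramp_le1// lerB.
  have -> : ramp k (v - a) = 0 by apply: ramp0; lra.
  rewrite subrr normr0.
  have -> : ramp k (v - (a + k%:R^-1)) = 0 by apply: ramp0; lra.
  by rewrite subr0 ramp_ge0.
- by rewrite (le_trans (ler_norm _)).
Unshelve. all: by end_near. Qed.

End TailProcess.

(** * Scaling and time change of the tail process *)

Section TailLaw.
Context {R : realType} {d : nat} {d1 d2 : measure_display}
  {T1 : measurableType d1} {T2 : measurableType d2}
  {P : probability T1 R} {PY : probability T2 R}.
Variables (N : 'rV[R]_d -> R) (X : {RV P >-> seq_space R d})
  (Y : {RV PY >-> seq_space R d}).
Notation S := (seq_space R d).
Implicit Types (f g : (int -> 'rV[R]_d) -> R).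
Hypothesis hN : is_norm N.
Hypothesis X_stationary : stationary X.
Local Notation p := (tailp N X).
Hypothesis Y_tail : is_tail_process N X Y.
Hypothesis tailp_gt0 : forall x, 0 < p x.
Variables (alpha : R) (alpha_gt0 : 0 < alpha).
Hypothesis ratio : forall t : R, 0 < t ->
  p (t * x) / p x @[x --> +oo] --> t `^ (- alpha).
Local Notation EY f := (Ex PY (fun t => f (Y t))).
Local Notation exceed j a := (fun x : int -> 'rV[R]_d => (a < N (x j))%R%:R : R).

Lemma bmY_exceed (a : R) j : bm (fun t => (a < N (Y t j))%R%:R : R).
Proof. exact: (bmY Y (bm_exceed hN a j)). Qed.

Lemma tail_process_ge1 (a b : R) : 1 <= a -> a < b ->
  b `^ (- alpha) <= EY (fun x => trapeze a b (N (x 0))) <= a `^ (- alpha).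
Proof.
move=> a1 ab.
have lf : lcb (fun x : int -> 'rV[R]_d => trapeze a b (N (x 0))).
  apply: (lcb_phi_norm 0 hN _ (fun v w => trapeze_lipschitz v w ab)
    (norm_trapeze_le1 a b)).
  by rewrite invr_ge0; lra.
have cf := tail_lcb Y_tail lf.
have E : \forall x \near +oo,
    p (b * x) / p x <= condE N X x (fun x => trapeze a b (N (x 0))) <=
    p (a * x) / p x.
  near=> x; have x0 : 0 < x by near: x; exact: nbhs_pinfty_gt.
  have := tail_trapeze X hN x0 ab; rewrite /condE.
  rewrite !ler_pM2r ?invr_gt0//.
  rewrite [in X in _ -> X](_ : (fun t => _ * _) =
    (fun t => trapeze a b (x^-1 * N (X t 0)))) //.
  apply/funext => t; rewrite /scale normZ// gtr0_norm ?invr_gt0//.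
  case: ltP => h /=; first by rewrite mulr1.
  rewrite mulr0 trapeze0// (le_trans _ a1)//.
  by rewrite mulrC ler_pdivrMr ?mul1r.
have a0 : 0 < a by lra.
have b0 : 0 < b by lra.
apply/andP; split.
  apply: ler_cvg_to (ratio b0) cf _.
  by apply: filterS E => x /andP[].
apply: ler_cvg_to cf (ratio a0) _.
by apply: filterS E => x /andP[].
Unshelve. all: by end_near. Qed.

(** Both bounds come from trapezes, whose means are controlled by the ratio of
    tails. For [t = 1] the upper bound is trivial. *)
Lemma tail_process_pareto (t : R) : 1 <= t ->
  EY (exceed 0 t) = t `^ (- alpha).
Proof.
move=> t1; have t0 : 0 < t by lra.
have bt a b : a < b -> bm (fun t => trapeze a b (N (Y t 0))).
  move=> ab; apply: (bmY Y (f := fun x => trapeze a b (N (x 0)))); apply: lcb_bm.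
  apply: (lcb_phi_norm 0 hN _ (fun v w => trapeze_lipschitz v w ab)
    (norm_trapeze_le1 a b)).
  by rewrite invr_ge0; lra.
apply/eqP; rewrite eq_le; apply/andP; split; apply/ler_addgt0Pr => e e0; last first.
  have [del d0 h] := powRN_cont alpha t0 e0.
  have tb : t < t + del / 2 by lra.
  have /andP[h1 _] := tail_process_ge1 t1 tb.
  have : `|t - (t + del / 2)| < del by rewrite ltr_norml; apply/andP; split; lra.
  move=> /h/ltr_normlP[h2 h3].
  have : EY (fun x => trapeze t (t + del / 2) (N (x 0))) <= EY (exceed 0 t).
    by apply: le_Ex; [exact: bt|exact: bmY_exceed|move=> s; exact: trapeze_lt].
  lra.
have [t1'|t1'] := eqVneq t 1.
  rewrite {2}t1' powR1; apply: (@le_trans _ _ 1); last by lra.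
  rewrite -[leRHS](Ex_cst PY 1); apply: le_Ex; first exact: bmY_exceed.
    exact: bm_cst.
  by move=> s; case: ltP.
have {}t1 : 1 < t by rewrite lt_neqAle eq_sym t1'.
have [del d0 h] := powRN_cont alpha t0 e0.
pose a := Num.max 1 (t - del / 2).
have a1 : 1 <= a by rewrite /a le_max lexx.
have at_ : a < t by rewrite /a gt_max t1; lra.
have /andP[_ h1] := tail_process_ge1 a1 at_.
have : `|t - a| < del.
  have : t - del / 2 <= a by rewrite /a le_max lexx orbT.
  by move=> g; rewrite ltr_norml; apply/andP; split; lra.
move=> /h/ltr_normlP[h2 h3].
have : EY (exceed 0 t) <= EY (fun x => trapeze a t (N (x 0))).
  by apply: le_Ex; [exact: bmY_exceed|exact: bt|move=> s; exact: lt_trapeze].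
lra.
Qed.

Lemma bmY_eqnorm (a : R) j : bm (fun t => (N (Y t j) == a)%:R : R).
Proof. exact: (bmY Y (bm_eqnorm hN a j)). Qed.

Lemma tail_process_noatom0 (t : R) : 1 <= t ->
  EY (fun x => (N (x 0) == t)%:R) = 0.
Proof.
move=> t1; apply/eqP; rewrite eq_le; apply/andP; split; last exact: Ex_ge0.
apply/ler_addgt0Pr => e e0; rewrite add0r.
have [t1'|t1'] := eqVneq t 1.
  have : EY (fun x => (N (x 0) == t)%:R) + EY (exceed 0 t) <= 1.
    rewrite -ExD; [|exact: bmY_eqnorm|exact: bmY_exceed].
    rewrite -[leRHS](Ex_cst PY 1); apply: le_Ex; last 1 first.
    - by move=> s; case: ltgtP; rewrite ?addr0 ?add0r.
    - by apply: bmD; [exact: bmY_eqnorm|exact: bmY_exceed].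
    - exact: bm_cst.
  rewrite tail_process_pareto//.
  have -> : t `^ (- alpha) = 1 by rewrite t1' powR1.
  by rewrite /=; lra.
have {}t1 : 1 < t by rewrite lt_neqAle eq_sym t1'.
have t0 : 0 < t by lra.
have [del d0 h] := powRN_cont alpha t0 e0.
pose a := Num.max 1 (t - del / 2).
have a1 : 1 <= a by rewrite /a le_max lexx.
have at_ : a < t by rewrite /a gt_max t1; lra.
have : `|t - a| < del.
  have : t - del / 2 <= a by rewrite /a le_max lexx orbT.
  by move=> g; rewrite ltr_norml; apply/andP; split; lra.
move=> /h/ltr_normlP[h2 h3].
have : EY (fun x => (N (x 0) == t)%:R) + EY (exceed 0 t) <= EY (exceed 0 a).
  rewrite -ExD; [|exact: bmY_eqnorm|exact: bmY_exceed].
  apply: le_Ex; last 1 first.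
  - move=> s; case: (ltgtP (N (Y s 0)) t) => [_|ht|->] /=; first by rewrite addr0.
      by rewrite add0r (lt_trans at_ ht).
    by rewrite at_ addr0.
  - by apply: bmD; [exact: bmY_eqnorm|exact: bmY_exceed].
  - exact: bmY_exceed.
rewrite !tail_process_pareto//; last exact: ltW.
lra.
Qed.

(** Conditioning on an exceedance of [t * x] rather than of [x] multiplies the
    tail process by [t] and the probability by the ratio of tails. *)
Lemma tail_process_scale g (t : R) : bm (g : S -> R) -> 1 <= t ->
  EY (fun x => g x * exceed 0 t x) = t `^ (- alpha) * EY (fun x => g (scale t x)).
Proof.
move=> bg t1; have t0 : 0 < t by lra.
have mtY : measurable_fun setT (fun s => scale t (Y s) : S).
  by apply: (measurableT_comp (f := scale t : S -> S)) => //; exact: measurable_scale.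
have := @lcb_determine _ _ _ _ _ _ PY PY _ _ _ (fun=> t `^ (- alpha))
  (measurable_funPT Y) mtY (bmY_exceed t 0) (bm_cst _).
move=> /(_ _ g bg) ->; last first.
  move=> f lf.
  have c1 : condE N X x (fun y => f y * exceed 0 t y) @[x --> +oo] -->
      EY (fun x => f x * exceed 0 t x).
    apply: (good_cvg hN Y_tail tailp_gt0); apply: (goodM (Y := Y)).
      exact: good_lcb.
    by apply: good_exceed => //; exact: tail_process_noatom0.
  have c2 : condE N X (t * x) (fun y => f (scale t y)) * (p (t * x) / p x)
      @[x --> +oo] --> EY (fun x => f (scale t x)) * t `^ (- alpha).
    apply: cvgM; last exact: ratio.
    have := tail_lcb Y_tail (lcb_scale t lf).
    by apply: cvg_comp; apply: gt0_cvgMry => //; exact: cvg_id.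
  rewrite -[RHS]/(Ex PY (fun s => f (scale t (Y s)) * t `^ (- alpha))).
  have -> : Ex PY (fun s => f (scale t (Y s)) * t `^ (- alpha)) =
      EY (fun x => f (scale t x)) * t `^ (- alpha).
    rewrite mulrC -ExZ; last exact: (bmY Y (bm_scale t (lcb_bm lf))).
    by congr Ex; apply/funext => s; rewrite mulrC.
  apply: (cvg_unique _ c1) => //; apply: cvg_trans c2; apply: near_eq_cvg.
  near=> x; have x0 : 0 < x by near: x; exact: nbhs_pinfty_gt.
  rewrite /condE mulrA divfK ?gt_eqF//; congr (Ex _ _ / _); apply/funext => s.
  rewrite scaleA_seq invfM mulrA mulfV ?gt_eqF// mul1r -mulrA; congr (_ * _).
  rewrite /scale normZ// gtr0_norm ?invr_gt0//.
  have -> : (t < x^-1 * N (X s 0)) = (t * x < N (X s 0)).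
    by rewrite mulrC ltr_pdivlMr.
  case: (ltP (t * x)) => h /=; last by rewrite mul0r.
  by rewrite mul1r (le_lt_trans _ h)// ler_peMl// ltW.
rewrite -ExZ; last exact: (bmY Y (bm_scale t bg)).
by congr Ex; apply/funext => s; rewrite mulrC.
Unshelve. all: by end_near. Qed.

(** If [N (Y j)] had an atom at 1, then by scaling it would have an atom at
    each point of [1, 2], all of comparable masses. *)
Lemma tail_process_noatom j : EY (fun x => (N (x j) == 1)%:R) = 0.
Proof.
pose q (t : R) := EY (fun x => (N (x j) == t)%:R).
have q0 t : 0 <= q t by exact: Ex_ge0.
have qt (t : R) : 1 <= t -> t `^ (- alpha) * q 1 <= q t.
  move=> t1; have t0 : 0 < t by lra.
  have := tail_process_scale (bm_eqnorm hN t j) t1.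
  rewrite /q (_ : (fun s => (N (scale t (Y s) j) == t)%:R) =
     (fun s => (N (Y s j) == 1)%:R)) => [<-|].
    apply: le_Ex; last 1 first.
    - by move=> s; case: (_ == _); case: (_ < _); rewrite /= ?mulr1 ?mulr0 ?mul0r.
    - by apply: bmM; [exact: bmY_eqnorm|exact: bmY_exceed].
    - exact: bmY_eqnorm.
  apply/funext => s; rewrite /scale normZ// gtr0_norm//; congr (nat_of_bool _)%:R.
  by rewrite -{2}[t]mulr1; apply/eqP/eqP => [|->//]; apply: mulfI; rewrite gt_eqF.
apply/eqP; rewrite eq_le q0 andbT leNgt; apply/negP => q1.
pose c := 2 `^ (- alpha) * q 1.
have c0 : 0 < c by rewrite mulr_gt0// powR_gt0.
(* infinitely many distinct levels in [1, 2], each of mass at least c *)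
pose t (k : nat) : R := 1 + k.+1%:R^-1.
have t1 k : 1 <= t k by rewrite lerDl invr_ge0.
have t2 k : t k <= 2 by rewrite -[2]/(1 + 1) lerD2l invf_le1// ler1n.
have ct k : c <= q (t k).
  apply: le_trans (qt _ (t1 k)); rewrite ler_pM2r// !powRN lef_pV2 ?posrE.
  - apply: ge0_ler_powR; rewrite ?nnegrE//; first exact: ltW.
    exact: le_trans (t1 k).
  - exact: powR_gt0.
  - by apply: powR_gt0; exact: lt_le_trans (t1 k).
have tinj k k' : t k = t k' -> k = k'.
  by move=> /addrI/invr_inj/eqP; rewrite eqr_nat => /eqP[].
have sum1 n : \sum_(k < n) q (t k) <= 1.
  rewrite -Ex_sum; last by move=> k; exact: bmY_eqnorm.
  rewrite -[leRHS](Ex_cst PY 1); apply: le_Ex; last 1 first.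
  - move=> s; have [/existsP[k /eqP sk]|/existsPn h] :=
      boolP [exists k : 'I_n, N (Y s j) == t k].
      rewrite (bigD1 k)//= big1 ?addr0; first by rewrite sk eqxx.
      move=> k' k'k; rewrite sk; case: eqP => // /tinj/val_inj kk.
      by rewrite kk eqxx in k'k.
    by rewrite big1// => k _; rewrite (negbTE (h k)).
  - by apply: bm_sum => k; exact: bmY_eqnorm.
  - exact: bm_cst.
have [n nc] : exists n : nat, c^-1 < n%:R.
  by exists (Num.truncn c^-1).+1; exact: truncnS_gt.
have : n%:R * c <= 1.
  apply: le_trans (sum1 n); rewrite mulr_natl -[X in _ *+ X]card_ord -sumr_const.
  by apply: ler_sum => k _; exact: ct.
rewrite leNgt => /negP; apply.
by rewrite -(ltr_pM2r c0) mulVf ?gt_eqF// in nc.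
Qed.

(** By stationarity, an exceedance at 0 and one at [h] play symmetric roles:
    shifting by [- h] exchanges them before the limit. *)
Lemma tail_process_time_change g h : bm (g : S -> R) ->
  EY (fun x => g x * exceed h 1 x) =
  EY (fun x => g (shift (- h) x) * exceed (- h) 1 x).
Proof.
move=> bg.
have mtY : measurable_fun setT (fun s => shift (- h) (Y s) : S).
  by apply: (measurableT_comp (f := shift (- h) : S -> S)) => //;
    exact: measurable_shift.
have := @lcb_determine _ _ _ _ _ _ PY PY _ _ _ _
  (measurable_funPT Y) mtY (bmY_exceed 1 h) (bmY_exceed 1 (- h)).
move=> /(_ _ g bg); apply=> f lf.
have ge j (f' : (int -> 'rV[R]_d) -> R) : lcb f' ->
    good Y (fun x => f' x * exceed j 1 x).
  move=> lf'; apply: goodM; first exact: good_lcb.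
  by apply: good_exceed => //; exact: tail_process_noatom.
have c1 := good_cvg hN Y_tail tailp_gt0 (ge h f lf).
have c2 := good_cvg hN Y_tail tailp_gt0 (ge (- h) _ (lcb_shift (- h) lf)).
apply: (cvg_unique _ c1) => //; apply: cvg_trans c2; apply: near_eq_cvg.
near=> x; have x0 : 0 < x by near: x; exact: nbhs_pinfty_gt.
rewrite /condE; congr (_ / _).
have xE j y : (1 < N (scale x^-1 y j)) = (x < N (y j)).
  by rewrite /scale normZ// gtr0_norm ?invr_gt0// -ltr_pdivrMl ?invr_gt0// invrK mulr1.
pose F (y : int -> 'rV[R]_d) :=
  f (scale x^-1 y) * exceed h x y * exceed 0 x y.
have bF : bm (F : S -> R).
  apply: bmM; last exact: bm_exceed.
  by apply: bmM; [apply: bm_scale; exact: lcb_bm|exact: bm_exceed].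
transitivity (Ex P (fun t => F (X t))); last first.
  by congr Ex; apply/funext => t; rewrite /F xE.
rewrite -(Ex_shift X_stationary (- h) bF); congr Ex; apply/funext => t.
rewrite /F shift_scale xE -!mulrA; congr (_ * _).
by rewrite /shift addrN add0r mulrC.
Unshelve. all: by end_near. Qed.

End TailLaw.

(** * The tail process vanishes at infinity *)

Lemma double_limit0P {R : realType} (v : nat -> nat -> R) : double_limit0 v ->
  forall e : R, 0 < e -> \forall m \near \oo, \forall n \near \oo, v m n <= e.
Proof.
move=> v0 e e0.
have e0' : (0 < e%:E)%E by rewrite lte_fin.
have : \forall m \near \oo, (limn_esup (fun n => (v m n)%:E) < e%:E)%E.
  exact: (v0 [set x | (x < e%:E)%E] (open_ereal_lt' e0')).
apply: filterS => m; rewrite /limn_esup /limf_esup => /ereal_inf_lt[_ [V V_ <-]] Ve.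
apply: filterS V_ => n Vn; rewrite -lee_fin ltW// (le_lt_trans _ Ve)//.
by apply: ereal_sup_ubound; exists n.
Qed.

Lemma sum_nat_shift {V : zmodType} (m M : nat) (F : nat -> V) :
  \sum_(m <= j < m + M) F j = \sum_(0 <= k < M) F (m + k)%N.
Proof.
rewrite -{1}[m]add0n big_addn addKn.
by apply: eq_bigr => k _; rewrite addnC.
Qed.

Section Summability.
Context {R : realType} {d : nat} {d1 d2 : measure_display}
  {T1 : measurableType d1} {T2 : measurableType d2}
  {P : probability T1 R} {PY : probability T2 R}.
Variables (N : 'rV[R]_d -> R) (X : {RV P >-> seq_space R d})
  (Y : {RV PY >-> seq_space R d}).
Notation S := (seq_space R d).
Implicit Types (f g : (int -> 'rV[R]_d) -> R).
Hypothesis hN : is_norm N.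
Hypothesis X_stationary : stationary X.
Local Notation p := (tailp N X).
Hypothesis tailp_gt0 : forall x, 0 < p x.
Variables (r : nat -> nat) (u : nat -> R).
Hypothesis u_gt0 : forall n, 0 < u n.
Hypothesis hS : summability N X r u.
Local Notation w n := (p (u n)).
Local Notation exceed j a := (fun x : int -> 'rV[R]_d => (a < N (x j))%R%:R : R).

Definition pairp (n : nat) (eta : R) (i j : int) : R :=
  Ex P (fun t => exceed i (eta * u n) (X t) * exceed j (eta * u n) (X t)).

Lemma bm_pair (a : R) i j : bm (fun x : S => exceed i a x * exceed j a x).
Proof. by apply: bmM; exact: bm_exceed. Qed.

Lemma pairp_ge0 n eta i j : 0 <= pairp n eta i j.
Proof. by apply: Ex_ge0 => t; rewrite mulr_ge0. Qed.

Lemma pairpC n eta i j : pairp n eta i j = pairp n eta j i.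
Proof. by congr Ex; apply/funext => t; rewrite mulrC. Qed.

Lemma pairp_shift n eta k i j : pairp n eta (i + k) (j + k) = pairp n eta i j.
Proof. by rewrite /pairp -(Ex_shift X_stationary k (bm_pair _ i j)). Qed.

Lemma pairp0 n eta i j : pairp n eta i j = pairp n eta 0 `|i - j|%N%:Z.
Proof.
have [ij|ij] := leP i j.
  by rewrite -(pairp_shift n eta (- i)) subrr; congr pairp; lia.
rewrite pairpC -(pairp_shift n eta (- j)) subrr; congr pairp; lia.
Qed.

Lemma summabilityP (eta e : R) : 0 < eta -> 0 < e ->
  \forall m \near \oo, \forall n \near \oo,
    \sum_(m <= j < (r n).+1) pairp n eta 0 j%:Z <= e * w n.
Proof.
move=> eta0 e0; have := double_limit0P (hS eta0 eta0) e0.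
apply: filterS => m; apply: filterS => n.
rewrite -/(p (u n)) mulrC ler_pdivrMr//; congr (_ <= _).
apply: eq_bigr => j _.
rewrite /pairp [eta * _]mulrC.
under [in RHS]eq_fun do rewrite -natrM mulnb.
rewrite Ex_bool; last first.
  by apply: measurable_and; exact: measurable_exceed.
by congr prob; apply/seteqP; split => t /= => [[-> ->]|/andP].
Qed.

Hypothesis Y_tail : is_tail_process N X Y.
Hypothesis u_infty : u n @[n --> \oo] --> +oo.
Hypothesis r_infty : r n @[n --> \oo] --> \oo.
Local Notation EY f := (Ex PY (fun t => f (Y t))).

(** A continuous function fits between the indicators of the levels [eta / 2]
    and [eta], hence the loss of a factor 2 in the level. *)
Lemma tail_exceed_le (eta : R) (j : int) : 0 < eta -> eta <= 1 -> forall e, 0 < e ->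
  \forall n \near \oo,
  EY (exceed j eta) <= pairp n (eta / 2) 0 j / w n + e.
Proof.
move=> eta0 eta1 e e0; have eta2 : eta / 2 < eta by lra.
have lf : lcb (fun x : int -> 'rV[R]_d => trapeze (eta / 2) eta (N (x j))).
  apply: (lcb_phi_norm j hN _ (fun v w => trapeze_lipschitz v w eta2)
    (norm_trapeze_le1 (eta / 2) eta)).
  by rewrite invr_ge0; lra.
have /cvgrPdist_le/(_ e e0) hx := tail_lcb Y_tail lf.
have hn : \forall n \near \oo, `|EY (fun x => trapeze (eta / 2) eta (N (x j))) -
    condE N X (u n) (fun x => trapeze (eta / 2) eta (N (x j)))| <= e.
  exact: (u_infty hx).
apply: filterS hn => n /ler_normlP[_ h].
have h1 : EY (exceed j eta) <= EY (fun x => trapeze (eta / 2) eta (N (x j))).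
  apply: le_Ex; [exact: (bmY Y (bm_exceed hN _ _))|exact: (bmY Y (lcb_bm lf))|].
  by move=> t; exact: lt_trapeze.
suff h2 : condE N X (u n) (fun x => trapeze (eta / 2) eta (N (x j))) <=
  pairp n (eta / 2) 0 j / w n by lra.
rewrite /condE ler_pM2r ?invr_gt0//; apply: le_Ex => [||t].
- by apply: bmM; [exact: (bmX X (bm_scale _ (lcb_bm lf)))|exact: (bmX X (bm_exceed hN _ _))].
- exact: (bmX X (bm_pair _ _ _)).
- rewrite mulrC; apply: ler_pM => //; first exact: trapeze_ge0.
    rewrite ler_nat; case: ltP => // h'; rewrite (lt_le_trans _ (ltW h'))//.
    by rewrite gtr_pMl//; lra.
  rewrite /scale normZ// gtr0_norm ?invr_gt0//.
  apply: (le_trans (trapeze_lt _ eta2)).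
  by rewrite ltr_pdivlMl// mulrC.
Qed.

(** Summability passes to the limit in [n] over any finite range of lags. *)
Lemma tail_exceed_sum (eta e : R) : 0 < eta -> eta <= 1 -> 0 < e ->
  exists m : nat, forall M : nat,
  \sum_(m <= j < M) (EY (exceed j%:Z eta) + EY (exceed (- j%:Z) eta)) <= e.
Proof.
move=> eta0 eta1 e0.
have e4 : 0 < e / 4 by lra.
have eta2 : 0 < eta / 2 by lra.
have [m _ /(_ m (leqnn m)) /= hm] := summabilityP eta2 e4.
exists m => M.
have M0 : 0 < M%:R + 1 :> R by rewrite ltr_wpDl.
have e' : 0 < e / 4 / (M%:R + 1) by rewrite divr_gt0.
have near_all (k : nat) : \forall n \near \oo, forall j : nat, (j < k)%N ->
    EY (exceed j%:Z eta) + EY (exceed (- j%:Z) eta) <=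
    2 * (pairp n (eta / 2) 0 j%:Z / w n + e / 4 / (M%:R + 1)).
  elim: k => [|k]; first by apply: nearW.
  have h1 := tail_exceed_le k%:Z eta0 eta1 e'.
  have h2 := tail_exceed_le (- k%:Z) eta0 eta1 e'.
  apply: filter_app; apply: filter_app h1; apply: filterS h2 => n h2 h1 IH j.
  rewrite ltnS leq_eqVlt => /predU1P[->|]; last exact: IH.
  move: h2; rewrite [pairp n _ 0 (- _)]pairp0 sub0r opprK absz_nat => h2.
  lra.
have rM : \forall n \near \oo, (M <= r n)%N by exact: (r_infty (nbhs_infty_ge M)).
near \oo => n.
have h1 : forall j : nat, (j < M)%N ->
    EY (exceed j%:Z eta) + EY (exceed (- j%:Z) eta) <=
    2 * (pairp n (eta / 2) 0 j%:Z / w n + e / 4 / (M%:R + 1)).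
  by near: n; exact: near_all.
have h2 : \sum_(m <= j < (r n).+1) pairp n (eta / 2) 0 j%:Z <= e / 4 * w n.
  by near: n.
have h3 : (M <= r n)%N by near: n.
apply: (@le_trans _ _ (\sum_(m <= j < M)
    2 * (pairp n (eta / 2) 0 j%:Z / w n + e / 4 / (M%:R + 1)))).
  by rewrite !big_nat; apply: ler_sum => j /andP[_ jM]; exact: h1.
rewrite -mulr_sumr big_split /= -mulr_suml.
have s1 : \sum_(m <= j < M) pairp n (eta / 2) 0 j%:Z / w n <= e / 4.
  rewrite -mulr_suml ler_pdivrMr//; apply: le_trans h2.
  have [mM|Mm] := leqP m M; last first.
    by rewrite big_geq ?(ltnW Mm)//; apply: sumr_ge0 => j _; exact: pairp_ge0.
  have Mr : (M <= (r n).+1)%N by exact: leqW.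
  rewrite (@big_cat_nat _ _ _ M m (r n).+1)//= lerDl sumr_ge0// => j _.
  exact: pairp_ge0.
have s2 : \sum_(m <= j < M) (e / 4 / (M%:R + 1)) <= e / 4.
  rewrite sumr_const_nat -[leLHS]mulr_natr -mulrA ler_piMr//; first exact: ltW.
  rewrite mulrC ler_pdivrMr// mul1r ler_wpDr// ler_nat leq_subr//.
rewrite mulr_suml; lra.
Unshelve. all: by end_near. Qed.

(** Borel-Cantelli, from the summability of the probabilities of exceedance. *)
Lemma tail_vanish : {ae PY, forall t, forall eta : R, 0 < eta ->
  exists m : nat, forall j : int, (m <= `|j|)%N -> N (Y t j) <= eta}.
Proof.
have mE (a : R) j : measurable [set t | a < N (Y t j)].
  by apply: measurable_setb; exact: measurable_exceed.
have key (eta : R) : 0 < eta -> eta <= 1 -> {ae PY, forall t,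
    exists m : nat, forall j : int, (m <= `|j|)%N -> N (Y t j) <= eta}.
  move=> eta0 eta1.
  pose C k := [set t | eta < N (Y t k%:Z)] `|` [set t | eta < N (Y t (- k%:Z))].
  have mC k : measurable (C k) by exact: measurableU.
  pose B m := \bigcup_k C (m + k)%N.
  have mB m : measurable (B m) by exact: bigcupT_measurable.
  exists (\bigcap_m B m); split; first exact: bigcapT_measurable.
    apply/eqP; rewrite eq_le measure_ge0 andbT; apply/lee_addgt0Pr => e e0.
    rewrite add0e; have [m hm] := tail_exceed_sum eta0 eta1 e0.
    apply: (@le_trans _ _ (PY (B m))).
      apply: le_measure; rewrite ?inE//; first exact: bigcapT_measurable.
      exact: bigcap_inf.
    have Boole := @generalized_Boole_inequality _ _ _ PY (fun k => C (m + k)%N)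
      (fun k => mC _) (mB m).
    apply: (le_trans Boole).
    apply: lime_le; first exact: is_cvg_nneseries.
    apply: nearW => M; have := hm (m + M)%N; rewrite -lee_fin; apply: le_trans.
    rewrite sum_nat_shift -sumEFin; apply: lee_sum => k _.
    rewrite EFinD (le_trans (measureU2 _ _ _))// leeD//.
      rewrite Ex_bool /prob ?fineK//; last exact: measurable_exceed.
      by apply: fin_num_measure; exact: mE.
    rewrite Ex_bool /prob ?fineK//; last exact: measurable_exceed.
    by apply: fin_num_measure; exact: mE.
  move=> t /= nh m _; apply: contrapT => nB; apply: nh; exists m => j mj.
  rewrite leNgt; apply/negP => hj; apply: nB; exists (`|j| - m)%N => //.
  rewrite subnKC// /C /=.
  have [jE|jE] : j = `|j|%N%:Z \/ j = - `|j|%N%:Z by lia.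
    by left; rewrite -jE.
  by right; rewrite -jE.
have keys : {ae PY, forall t, forall k : nat, exists m : nat, forall j : int,
    (m <= `|j|)%N -> N (Y t j) <= k.+1%:R^-1}.
  apply/ae_foralln => k; apply: key; first by rewrite invr_gt0.
  by rewrite invf_le1// ler1n.
apply: filterS keys => t ht eta eta0.
have [k _ /(_ k (leqnn k)) /= hk] := near_infty_natSinv_lt (PosNum eta0).
have [m hm] := ht k; exists m => j mj; rewrite (le_trans (hm j mj))//.
exact: ltW.
Qed.

End Summability.

(** * Lipschitz envelopes of functionals *)

Section Envelopes.
Context {R : realType} {d : nat}.
Variable N : 'rV[R]_d -> R.
Hypothesis hN : is_norm N.
Implicit Types (x y z : int -> 'rV[R]_d) (H : (int -> 'rV[R]_d) -> R).

Definition near_seq x y (a : R) : Prop := forall j, N (x j - y j) <= a.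

Lemma near_seqC x y a : near_seq x y a -> near_seq y x a.
Proof. by move=> xy j; rewrite norm_distC. Qed.

Lemma near_seq_trans x y z a b :
  near_seq x y a -> near_seq y z b -> near_seq x z (a + b).
Proof.
move=> xy yz j; rewrite -(subrKA (y j)) (le_trans (norm_triangle hN _ _))//.
exact: lerD.
Qed.

Lemma near_seqxx x : near_seq x x 0.
Proof. by move=> j; rewrite subrr norm0. Qed.

(** Lower Lipschitz envelope of slope [k] (Pasch-Hausdorff regularization) for
    the uniform distance. Points at infinite distance do not compete, since
    only the [a] with [near_seq x y a] enter. *)
Definition lower (k : R) H x : R :=
  inf [set v | exists y a, near_seq x y a /\ v = H y + k * a].

Definition upper (k : R) H x : R := - lower k (fun y => - H y) x.

Section Bounded.
Variables (H : (int -> 'rV[R]_d) -> R) (M : R) (k : R).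
Hypothesis HM : forall x, `|H x| <= M.
Hypothesis k0 : 0 <= k.

Lemma near_seq_ge0 x y a : near_seq x y a -> 0 <= a.
Proof. by move=> /(_ 0); apply: le_trans; exact: norm_ge0. Qed.

Lemma lower_lb x :
  lbound [set v | exists y a, near_seq x y a /\ v = H y + k * a] (- M).
Proof.
move=> _ [y [a [xy ->]]]; have /ler_normlP[h1 h2] := HM y.
have : 0 <= k * a by rewrite mulr_ge0// (near_seq_ge0 xy).
by lra.
Qed.

Lemma lower_le_at x y a : near_seq x y a -> lower k H x <= H y + k * a.
Proof.
move=> xy; apply: ge_inf; first by exists (- M); exact: lower_lb.
by exists y, a.
Qed.

Lemma lower_le x : lower k H x <= H x.
Proof. by have := lower_le_at (near_seqxx x); rewrite mulr0 addr0. Qed.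

Lemma le_lower x (c : R) :
  (forall y a, near_seq x y a -> c <= H y + k * a) -> c <= lower k H x.
Proof.
move=> h; apply: lb_le_inf => [|_ [y [a [xy ->]]]]; last exact: h.
by exists (H x + k * 0), x, 0; split => //; exact: near_seqxx.
Qed.

Lemma lower_ge x : - M <= lower k H x.
Proof. by apply: le_lower => y a xy; apply: (@lower_lb x); exists y, a. Qed.

Lemma norm_lower x : `|lower k H x| <= M.
Proof.
have /ler_normlP[h1 h2] := HM x; have := lower_ge x; have := lower_le x.
by move=> h3 h4; rewrite ler_norml; apply/andP; split; lra.
Qed.

Lemma lower_lipschitz x y a : near_seq x y a ->
  lower k H x <= lower k H y + k * a.
Proof.
move=> xy; rewrite -lerBlDr; apply: le_lower => z b yz.
rewrite lerBlDr -addrA -mulrDr addrC addrC [b + a]addrC.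
by apply: lower_le_at; exact: near_seq_trans yz.
Qed.

Lemma near_uniform_dist x y a : near_seq x y a -> (uniform_dist N x y <= a%:E)%E.
Proof. by move=> xy; apply: sup_on_le => j _; rewrite lee_fin; exact: xy. Qed.

End Bounded.

(** At a point of continuity the competitors are either close, where [H] is
    close to [H x], or far, where the slope exceeds the oscillation of [H]. *)
Lemma lower_cvg H M x : (forall y, `|H y| <= M) -> uniform_continuous_at N H x ->
  lower n%:R H x @[n --> \oo] --> H x.
Proof.
move=> HM Hx; apply/cvgrPdist_le => e e0; have [del d0 h] := Hx e e0.
near=> n.
have n0 : 0 <= n%:R :> R by [].
rewrite ger0_norm ?subr_ge0; last exact: (lower_le HM n0).
rewrite lerBlDr addrC -lerBlDr; apply: le_lower => y a xy.
have [ad|da] := ltP a del.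
  have /ltr_normlP[_ h1] : `|H x - H y| < e.
    by apply: h; apply: le_lt_trans (near_uniform_dist xy) _; rewrite lte_fin.
  have : 0 <= n%:R * a by rewrite mulr_ge0// (near_seq_ge0 xy).
  lra.
have : M + M <= n%:R * a.
  apply: (@le_trans _ _ (n%:R * del)); last by rewrite ler_wpM2l.
  rewrite -ler_pdivrMr//; near: n; exact: nbhs_infty_ger.
have /ler_normlP[_ h1] := HM x; have /ler_normlP[h2 _] := HM y.
lra.
Unshelve. all: by end_near. Qed.

(** It tends to 0 at the points of continuity of [H], and bounds the error
    when [H] is replaced by its envelope nearby. *)
Definition gap (k : R) H x : R := upper k H x - lower k H x.

Definition trim (l : nat) x := block (- l%:Z) l%:Z x.

Lemma trimE l x j : trim l x j = if (`|j| <= l)%N then x j else 0.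
Proof. by rewrite /trim /block; have -> : (- l%:Z <= j) && (j <= l%:Z) = (`|j| <= l)%N by lia. Qed.

Lemma near_trim l x a : 0 <= a -> (forall j, (l < `|j|)%N -> N (x j) <= a) ->
  near_seq x (trim l x) a.
Proof.
move=> a0 xa j; rewrite trimE; case: leqP => jl; first by rewrite subrr norm0.
by rewrite subr0; exact: xa.
Qed.

Lemma win_close_trim l : exists2 C : R, 0 < C & forall x y del, 0 <= del ->
  win_close l del x y -> near_seq (trim l x) (trim l y) (C * del).
Proof.
have [C C0 NC] := norm_entries hN; exists C => // x y del d0 xy j.
rewrite !trimE; case: leqP => jl.
  by apply: NC => // c; rewrite !mxE ltW// xy.
by rewrite subrr norm0// mulr_ge0// ltW.
Qed.

Section Gap.
Variables (H : (int -> 'rV[R]_d) -> R) (M : R) (k : R).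
Hypothesis HM : forall x, `|H x| <= M.
Hypothesis k0 : 0 <= k.

Let HMN x : `|- H x| <= M. Proof. by rewrite normrN. Qed.

Lemma gap_ge0 x : 0 <= gap k H x.
Proof.
rewrite /gap /upper; have := lower_le HM k0 x; have := lower_le HMN k0 x; lra.
Qed.

Lemma gap_le x : gap k H x <= M + M.
Proof.
rewrite /gap /upper; have := lower_ge HM k0 x; have := lower_ge HMN k0 x; lra.
Qed.

(** Both [H x] and the envelope at [z] lie between the two envelopes, up to
    the slope times the distance. *)
Lemma lower_approx x z a : near_seq x z a ->
  `|H x - lower k H z| <= gap k H z + k * a.
Proof.
move=> xz; have zx := near_seqC xz.
have h1 := lower_le_at HM k0 zx; have h2 := lower_le_at HMN k0 zx.
have h3 := gap_ge0 z; have := near_seq_ge0 xz => a0.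
have := mulr_ge0 k0 a0; rewrite /gap /upper in h3 * => h4.
by rewrite ler_norml; apply/andP; split; lra.
Qed.

End Gap.

Lemma lcb_lower H M k l : (forall x, `|H x| <= M) -> 0 <= k ->
  lcb (fun x => lower k H (trim l x)).
Proof.
move=> HM k0; split; last by exists M => x; exact: norm_lower.
have [C C0 xyC] := win_close_trim l.
exists l => x e e0; have kC : 0 < (k + 1) * C by rewrite mulr_gt0//; lra.
exists (e / ((k + 1) * C) / 2); first by rewrite !divr_gt0.
move=> y xy; have h := xyC x y _ (ltW _) xy.
have {h} : near_seq (trim l x) (trim l y) (C * (e / ((k + 1) * C) / 2)).
  by apply: h; rewrite !divr_gt0.
have -> : C * (e / ((k + 1) * C) / 2) = e / (k + 1) / 2.
  by field; rewrite !gt_eqF//; lra.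
move=> h; have h1 := lower_lipschitz HM k0 h.
have h2 := lower_lipschitz HM k0 (near_seqC h).
have : k * (e / (k + 1) / 2) < e.
  have -> : k * (e / (k + 1) / 2) = k / (k + 1) * (e / 2).
    by field; rewrite gt_eqF//; lra.
  have : k / (k + 1) <= 1 by rewrite ler_pdivrMr; lra.
  by move: (k / (k + 1)) => c; nra.
by move=> h3; rewrite ltr_norml; apply/andP; split; lra.
Qed.

Lemma lcb_gap H M k l : (forall x, `|H x| <= M) -> 0 <= k ->
  lcb (fun x => gap k H (trim l x)).
Proof.
move=> HM k0; rewrite /gap /upper; apply: lcbB; last exact: lcb_lower.
by apply: lcbN; apply: (lcb_lower (M := M)) => // x; rewrite normrN.
Qed.

End Envelopes.

(** * Functionals of class L on blocks *)

(** Bounded convergence applied twice. Off a null set [b k] is a limit of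
    measurable functions, so it is measurable after multiplication by an
    indicator. *)
Lemma Ex_iterated_cvg {R : realType} {dT} {T : measurableType dT}
    (P : probability T R) (a : nat -> nat -> T -> R) (b : nat -> T -> R) (M : R) :
  (forall k l, measurable_fun setT (a k l)) -> (forall k l t, `|a k l t| <= M) ->
  {ae P, forall t, (forall k, a k l t @[l --> \oo] --> b k t) /\
                   b k t @[k --> \oo] --> 0} ->
  forall e : R, 0 < e -> \forall k \near \oo, \forall l \near \oo,
    `|Ex P (a k l)| <= e.
Proof.
move=> ma aM [B [mB PB0 Bsub]] e e0.
have ct t : ~ B t -> (forall k, a k l t @[l --> \oo] --> b k t) /\
    b k t @[k --> \oo] --> 0.
  by move=> Bt; apply: contrapT => /Bsub.
pose b' k t := b k t * \1_(~` B) t.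
have a'cvg k t : a k l t * \1_(~` B) t @[l --> \oo] --> b' k t.
  have [Bt|Bt] := pselect (B t).
    have E0 : \1_(~` B) t = 0 :> R by rewrite indicE memNset//=.
    rewrite /b' E0 mulr0; under eq_fun do rewrite mulr0; exact: cvg_cst.
  by apply: cvgMl; have [] := ct t Bt.
have mC : measurable (~` B) by exact: measurableC.
have mb' k : measurable_fun setT (b' k).
  apply: (@measurable_fun_cvg _ _ _ setT (fun l t => a k l t * \1_(~` B) t)).
    by move=> l; apply: measurable_funM => //; exact: measurable_indic.
  by move=> t _; exact: a'cvg.
have b'M k t : `|b' k t| <= M.
  apply: ler_cvg_to (cvg_norm (a'cvg k t)) (cvg_cst M) _.
  apply: nearW => l /=; rewrite normrM indicE.
  by case: (_ \in _); rewrite /= ?normr1 ?mulr1// normr0 mulr0 (le_trans _ (aM k l t)).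
have ae_nB : {ae P, forall t, ~ B t}.
  by exists B; split => // t /= /contrapT.
have cb : Ex P (b' k) @[k --> \oo] --> (0 : R).
  rewrite -(Ex_cst P 0); apply: (@Ex_bounded_cvg _ _ _ P b' (fun=> 0) M) => //.
  apply: filterS ae_nB => t Bt; have [_ h] := ct t Bt.
  by rewrite /b' indicE mem_set//; under eq_fun do rewrite mulr1.
have ca k : Ex P (a k l) @[l --> \oo] --> Ex P (b' k).
  apply: (@Ex_bounded_cvg _ _ _ P (a k) (b' k) M) => //.
  apply: filterS ae_nB => t Bt; have [h _] := ct t Bt.
  by rewrite /b' indicE mem_set// mulr1.
have e2 : 0 < e / 2 by lra.
have /cvgrPdist_le/(_ _ e2) := cb; apply: filterS => k.
rewrite sub0r normrN => hk.
have /cvgrPdist_le/(_ _ e2) := ca k; apply: filterS => l hl.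
rewrite -(subrK (Ex P (b' k)) (Ex P (a k l))) (le_trans (ler_normD _ _))//.
by rewrite distrC (splitr e) lerD.
Qed.

Section ClassL.
Context {R : realType} {d : nat} {d2 : measure_display}
  {T2 : measurableType d2} {PY : probability T2 R}.
Variables (N : 'rV[R]_d -> R) (Y : {RV PY >-> seq_space R d}).
Notation S := (seq_space R d).
Implicit Types (H K : (int -> 'rV[R]_d) -> R).
Hypothesis hN : is_norm N.

Lemma class_L_bounded H : class_L N Y H ->
  exists2 M : R, 1 <= M & forall x, `|H x| <= M.
Proof.
move=> [_ [M HM] _]; exists (Num.max M 1); first by rewrite le_max lexx orbT.
by move=> x; rewrite (le_trans (HM x))// le_max lexx.
Qed.

Lemma class_L_bm H : class_L N Y H -> bm (H : S -> R).
Proof. by move=> [mH HM _]. Qed.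

(** A Lipschitz functional is continuous everywhere. *)
Lemma class_L_cont H : class_L N Y H ->
  {ae PY, forall t, uniform_continuous_at N H (Y t)}.
Proof.
move=> [_ _ [[K K0 HK]|//]]; apply: aeW => t e e0.
exists (e / K); first exact: divr_gt0.
move=> y yd; rewrite -lte_fin (le_lt_trans (HK _ _))//.
have : (0 <= uniform_dist N (Y t) y)%E.
  apply: le_trans (le_sup_on N _ (_ : setT 0)) => //.
  by rewrite lee_fin norm_ge0.
move: yd; case: (uniform_dist N (Y t) y) => [v| |] //=.
rewrite !lte_fin ltr_pdivlMr// => h _.
by rewrite mulrC.
Qed.

Lemma class_L_cst (c : R) : class_L N Y (fun=> c).
Proof.
split; first exact: measurable_cst.
  by exists `|c|.
left; exists 1 => // x y; rewrite subrr normr0 mul1e.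
apply: le_trans (le_sup_on N _ (_ : setT 0)) => //.
by rewrite lee_fin norm_ge0.
Qed.

Lemma class_LM H K : class_L N Y H -> class_L N Y K ->
  class_L N Y (fun x => H x * K x).
Proof.
move=> LH LK; have [M M1 HM] := class_L_bounded LH.
have [M' M'1 KM] := class_L_bounded LK.
have [mHK bHK] := bmM (class_L_bm LH) (class_L_bm LK).
split => //; right.
apply: filterS2 (class_L_cont LH) (class_L_cont LK) => t Ht Kt e e0.
have e1 : 0 < e / (M + M') by rewrite divr_gt0//; lra.
have [del d0 h1] := Ht _ e1; have [del' d'0 h2] := Kt _ e1.
exists (Num.min del del'); first by rewrite lt_min d0.
move=> y yd.
have {}h1 : `|H (Y t) - H y| < e / (M + M').
  by apply: h1; apply: lt_le_trans yd _; rewrite lee_fin ge_min lexx.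
have {}h2 : `|K (Y t) - K y| < e / (M + M').
  by apply: h2; apply: lt_le_trans yd _; rewrite lee_fin ge_min lexx orbT.
have -> : H (Y t) * K (Y t) - H y * K y =
  H (Y t) * (K (Y t) - K y) + K y * (H (Y t) - H y) by ring.
rewrite (le_lt_trans (ler_normD _ _))// !normrM.
have -> : e = M * (e / (M + M')) + M' * (e / (M + M')).
  by field; rewrite gt_eqF//; lra.
have a1 : `|H (Y t)| * `|K (Y t) - K y| <= M * `|K (Y t) - K y|.
  by rewrite ler_wpM2r.
have a2 : `|K y| * `|H (Y t) - H y| <= M' * `|H (Y t) - H y|.
  by rewrite ler_wpM2r.
have M0 : 0 < M by lra.
have M'0 : 0 < M' by lra.
by apply: (le_lt_trans (lerD a1 a2)); rewrite ltrD// ltr_pM2l.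
Qed.

End ClassL.

Section Clumps.
Context {R : realType} {d : nat} {d1 d2 : measure_display}
  {T1 : measurableType d1} {T2 : measurableType d2}
  {P : probability T1 R} {PY : probability T2 R}.
Variables (N : 'rV[R]_d -> R) (X : {RV P >-> seq_space R d})
  (Y : {RV PY >-> seq_space R d}).
Notation S := (seq_space R d).
Implicit Types (f g : (int -> 'rV[R]_d) -> R).
Hypothesis hN : is_norm N.
Hypothesis X_stationary : stationary X.
Local Notation p := (tailp N X).
Hypothesis tailp_gt0 : forall x, 0 < p x.
Variables (r : nat -> nat) (u : nat -> R).
Hypothesis u_gt0 : forall n, 0 < u n.
Hypothesis hS : summability N X r u.
Hypothesis Y_tail : is_tail_process N X Y.
Hypothesis u_infty : u n @[n --> \oo] --> +oo.
Hypothesis r_infty : r n @[n --> \oo] --> \oo.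
Local Notation w n := (p (u n)).
Local Notation exceed j a := (fun x : int -> 'rV[R]_d => (a < N (x j))%R%:R : R).
Local Notation EX f := (Ex P (fun t => f (X t))).
Local Notation EY f := (Ex PY (fun t => f (Y t))).

(** It bounds the indicator that a cluster around [h] is not confined to [h -
    l, h + l]. *)
Definition clump (n : nat) (eta : R) (l : nat) (h : int) (x : int -> 'rV[R]_d) : R :=
  \sum_(l.+1 <= j < (r n).+1)
    (exceed h (eta * u n) x * exceed (h + j%:Z) (eta * u n) x +
     exceed h (eta * u n) x * exceed (h - j%:Z) (eta * u n) x).

Lemma clump_ge0 n eta l h x : 0 <= clump n eta l h x.
Proof. by apply: sumr_ge0 => j _; rewrite addr_ge0// mulr_ge0. Qed.

Lemma clump_ge1 n eta l h i x : (l < `|i - h|)%N -> (`|i - h| <= r n)%N ->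
  eta * u n < N (x h) -> eta * u n < N (x i) -> 1 <= clump n eta l h x.
Proof.
move=> li ir xh xi; rewrite /clump.
rewrite (@big_cat_nat _ _ _ `|i - h|%N)//=; last exact: leqW.
rewrite [X in _ + X]big_ltn; last by rewrite ltnS.
set s1 := \sum_(_ <= _ < _) _; set s2 := \sum_(_ <= _ < _) _.
have s10 : 0 <= s1 by apply: sumr_ge0 => j _; rewrite addr_ge0// mulr_ge0.
have s20 : 0 <= s2 by apply: sumr_ge0 => j _; rewrite addr_ge0// mulr_ge0.
suff : 1 <= exceed h (eta * u n) x * exceed (h + `|i - h|%N%:Z) (eta * u n) x +
     exceed h (eta * u n) x * exceed (h - `|i - h|%N%:Z) (eta * u n) x :> R by lra.
have [iE|iE] : h + `|i - h|%N%:Z = i \/ h - `|i - h|%N%:Z = i by lia.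
  by rewrite iE xh xi mulr1 lerDl mulr_ge0.
by rewrite iE xh xi mulr1 lerDr mulr_ge0.
Qed.

Lemma bm_clump n eta l h : bm (clump n eta l h : S -> R).
Proof. by apply: bm_sum => j; apply: bmD; exact: bm_pair. Qed.

Lemma Ex_clump n eta l h : EX (clump n eta l h) =
  2 * \sum_(l.+1 <= j < (r n).+1) pairp N X u n eta 0 j%:Z.
Proof.
rewrite (Ex_sum P _ _ (f := fun j t =>
  exceed h (eta * u n) (X t) * exceed (h + j%:Z) (eta * u n) (X t) +
     exceed h (eta * u n) (X t) * exceed (h - j%:Z) (eta * u n) (X t))); last first.
  by move=> j; apply: bmD; exact: (bmX X (bm_pair hN _ _ _)).
rewrite mulr_sumr; apply: eq_bigr => j _.
rewrite ExD; try exact: (bmX X (bm_pair hN _ _ _)).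
rewrite -/(pairp N X u n eta h (h + j%:Z)) -/(pairp N X u n eta h (h - j%:Z)).
rewrite !(pairp0 hN X_stationary u n eta h).
by rewrite mulr_natl mulr2n; congr (_ + _); congr pairp; lia.
Qed.

Lemma clump_small (eta e : R) : 0 < eta -> 0 < e ->
  \forall l \near \oo, \forall n \near \oo, forall h : int,
    EX (clump n eta l h) <= e * w n.
Proof.
move=> eta0 e0; have e2 : 0 < e / 2 by lra.
have [m0 _ hm] := summabilityP hN tailp_gt0 hS eta0 e2.
exists m0 => // l /= ml.
have := hm l.+1 (leqW ml); apply: filterS => n h i.
rewrite Ex_clump; lra.
Qed.

Definition blk (n : nat) (h : int) (x : int -> 'rV[R]_d) : int -> 'rV[R]_d :=
  scale (u n)^-1 (block (h - (r n)%:Z) (h + (r n)%:Z) x).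

Lemma blkE n h x j : blk n h x j =
  if (`|j - h| <= r n)%N then (u n)^-1 *: x j else 0.
Proof.
rewrite /blk /scale /block.
have -> : (h - (r n)%:Z <= j) && (j <= h + (r n)%:Z) = (`|j - h| <= r n)%N by lia.
by case: ifP => //; rewrite scaler0.
Qed.

Lemma blk_shift n h k x : blk n h (shift k x) = shift k (blk n (h + k) x).
Proof.
apply/funext => j; rewrite /shift !blkE.
by have -> : j + k - (h + k) = j - h by lia.
Qed.

Lemma measurable_blk n h : measurable_fun setT (blk n h : S -> S).
Proof.
apply: (measurableT_comp (f := scale (u n)^-1 : S -> S)).
  exact: measurable_scale.
exact: measurable_block.
Qed.

Lemma bm_blk n h f : bm (f : S -> R) -> bm (fun x : S => f (blk n h x)).
Proof. by move=> bf; exact: (bm_comp (measurable_blk n h) bf). Qed.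

Lemma norm_scale_u n (v : 'rV[R]_d) : N ((u n)^-1 *: v) = (u n)^-1 * N v.
Proof. by rewrite normZ// gtr0_norm ?invr_gt0. Qed.

Lemma scale_u_le n (v : 'rV[R]_d) (a : R) : (N ((u n)^-1 *: v) <= a) = (N v <= a * u n).
Proof. by rewrite norm_scale_u ler_pdivrMl// mulrC. Qed.

Lemma scale_u_lt n (v : 'rV[R]_d) (a : R) : (a < N ((u n)^-1 *: v)) = (a * u n < N v).
Proof. by rewrite norm_scale_u ltr_pdivlMl// mulrC. Qed.

(** Off the event counted by [clump], all values at distance more than [l] are
    small, and zeros replace them at a small uniform distance. *)
Lemma blk_near_trim n eta l h x : 0 <= eta -> eta <= 1 -> (l + `|h| <= r n)%N ->
  u n < N (x 0) -> u n < N (x h) ->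
  clump n eta l 0 x + clump n eta l h x < 1 ->
  near_seq N (blk n h x) (trim l (scale (u n)^-1 x)) eta.
Proof.
move=> eta0 eta1 lr x0 xh cl j.
have eu : eta * u n <= u n by rewrite ger_pMl.
have c0 := clump_ge0 n eta l 0 x; have ch := clump_ge0 n eta l h x.
rewrite blkE trimE /scale; case: (leqP `|j - h| (r n)) => jh; last first.
  by rewrite sub0r normN//; case: leqP => jl; [lia|rewrite norm0].
case: leqP => jl; first by rewrite subrr norm0.
rewrite subr0 scale_u_le leNgt; apply/negP => xj.
have [jr|jr] := leqP `|j| (r n).
  have : 1 <= clump n eta l 0 x.
    by apply: (@clump_ge1 _ _ _ _ j); rewrite ?subr0//; exact: le_lt_trans x0.
  by lra.
have : 1 <= clump n eta l h x.
  apply: (@clump_ge1 _ _ _ _ j) => //; last exact: le_lt_trans xh.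
  lia.
by lra.
Qed.

(** A functional of class L is approximated by its Lipschitz envelope on a
    trimmed sequence, a continuous function of finitely many coordinates. The
    error on the tail process is small by continuity of [H] and because the
    tail process vanishes at infinity; on the blocks it is bounded by the gap
    at the trimmed sequence, whose conditional mean converges, plus the effect
    of distant exceedances. The lag [h] is fixed, so the exceedance at [h]
    only confines the block around [h]. *)
Lemma class_L_approx H (e : R) : class_L N Y H -> 0 < e ->
  exists f, [/\ lcb f, EY (fun x => `|H x - f x|) <= e &
    forall h : int, \forall n \near \oo,
      EX (fun x => `|H (blk n h x) - f (scale (u n)^-1 x)| *
        (exceed 0 (u n) x * exceed h (u n) x)) <= e * w n].
Proof.
move=> LH e0; have [M M1 HM] := class_L_bounded LH.
have bH := class_L_bm LH; have Hcont := class_L_cont hN LH.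
have gap0 (k : nat) x : 0 <= gap N k%:R H x.
  exact: (gap_ge0 hN HM (ler0n R k)).
pose a k l t := `|H (Y t) - lower N k%:R H (trim l (Y t))| +
   gap N k%:R H (trim l (Y t)).
pose b k t := `|H (Y t) - lower N k%:R H (Y t)| + gap N k%:R H (Y t).
have blow k l : lcb (fun x => lower N k%:R H (trim l x)) by exact: lcb_lower.
have bgap k l : lcb (fun x => gap N k%:R H (trim l x)) by exact: lcb_gap.
have ma k l : bm (a k l).
  apply: bmD; last exact: (bmY Y (lcb_bm (bgap k l))).
  by apply: bm_norm; apply: bmB; [exact: bmY|exact: (bmY Y (lcb_bm (blow k l)))].
have e8 : 0 < e / 8 by lra.
have abig : \forall k \near \oo, \forall l \near \oo, `|Ex PY (a k l)| <= e / 8.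
  apply: (@Ex_iterated_cvg _ _ _ PY a b (4 * M)) => //.
  - by move=> k l; have [] := ma k l.
  - move=> k l t; rewrite ger0_norm; last by rewrite addr_ge0// gap0.
    have h1 := ler_normB (H (Y t)) (lower N k%:R H (trim l (Y t))).
    have h2 := HM (Y t).
    have h3 := norm_lower hN HM (ler0n R k) (trim l (Y t)).
    have h4 := gap_le hN HM (ler0n R k) (trim l (Y t)).
    rewrite /a; lra.
  have tv := tail_vanish hN X_stationary tailp_gt0 u_gt0 hS Y_tail u_infty r_infty.
  apply: filterS2 Hcont tv => t Ht vt; split=> [k|].
    have kk : 0 < k%:R + 1 :> R by rewrite ltr_wpDl.
    have trimn (e' : R) : 0 < e' -> \forall l \near \oo,
        near_seq N (Y t) (trim l (Y t)) (e' / (k%:R + 1)).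
      move=> e'0; have e'k : 0 < e' / (k%:R + 1) by rewrite divr_gt0.
      have [m hm] := vt _ e'k.
      exists m => // l /= ml; apply: near_trim => // [|j lj]; first exact: ltW.
      by apply: hm; rewrite (leq_trans ml)// ltnW.
    have kle (e' : R) : 0 < e' -> k%:R * (e' / (k%:R + 1)) <= e'.
      move=> e'0; rewrite mulrCA ger_pMr// ler_pdivrMr//; lra.
    have clow H' : (forall x, `|H' x| <= M) ->
        lower N k%:R H' (trim l (Y t)) @[l --> \oo] --> lower N k%:R H' (Y t).
      move=> HM'; apply/cvgrPdist_le => e' e'0.
      apply: filterS (trimn e' e'0) => l nl.
      have h1 := lower_lipschitz hN HM' (ler0n R k) nl.
      have h2 := lower_lipschitz hN HM' (ler0n R k) (near_seqC hN nl).
      have := kle _ e'0 => h3.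
      by rewrite ler_norml; apply/andP; split; lra.
    apply: cvgD; first by apply: cvg_norm; apply: cvgB; [exact: cvg_cst|exact: clow].
    by apply: cvgB; [apply: cvgN; apply: clow => x; rewrite normrN|exact: clow].
  have c1 := lower_cvg hN HM Ht.
  have c2 : lower N n%:R (fun y => - H y) (Y t) @[n --> \oo] --> - H (Y t).
    apply: (lower_cvg hN (H := fun y => - H y) (M := M)); first by move=> y; rewrite normrN.
    move=> e' /Ht [del d0 h]; exists del => // y /h.
    by rewrite -opprD normrN.
  have -> : (0 : R) = `|H (Y t) - H (Y t)| + (- - H (Y t) - H (Y t)).
    by rewrite opprK subrr normr0 addr0.
  apply: cvgD; first by apply: cvg_norm; apply: cvgB => //; exact: cvg_cst.
  by apply: cvgB => //; exact: cvgN.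
have [k hk] : exists k, \forall l \near \oo, `|Ex PY (a k l)| <= e / 8.
  by move: abig => [k0 _ /(_ k0 (leqnn _))]; exists k0.
have k1 : 0 < k%:R + 1 :> R by rewrite ltr_wpDl.
(* values up to eta cost the slope k of the envelope times eta *)
pose eta := Num.min 1 (e / 8 / (k%:R + 1)).
have eta0 : 0 < eta by rewrite lt_min ltr01 !divr_gt0.
have eta1 : eta <= 1 by rewrite ge_min lexx.
have keta : k%:R * eta <= e / 8.
  apply: (@le_trans _ _ ((k%:R + 1) * eta)); first by rewrite ler_pM2r//; lra.
  by rewrite mulrC -ler_pdivlMr// ge_min lexx orbT.
have eM : 0 < e / 8 / (4 * M) by rewrite !divr_gt0//; lra.
near \oo => l.
have hkl : `|Ex PY (a k l)| <= e / 8 by near: l.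
have hcl : \forall n \near \oo, forall h : int,
    EX (clump n eta l h) <= e / 8 / (4 * M) * w n.
  by near: l; exact: clump_small.
have Egap0 : EY (fun x => gap N k%:R H (trim l x)) <= e / 8.
  apply: le_trans hkl; apply: le_trans (ler_norm _).
  apply: le_Ex => //; first exact: (bmY Y (lcb_bm (bgap k l))).
  by move=> t; rewrite /a lerDr.
exists (fun x => lower N k%:R H (trim l x)); split => //.
  apply: (@le_trans _ _ (e / 8)); last by lra.
  apply: le_trans hkl; apply: le_trans (ler_norm _).
  apply: le_Ex => // [|t].
    by apply: bm_norm; apply: bmB; [exact: bmY|exact: (bmY Y (lcb_bm (blow k l)))].
  by rewrite /a lerDl; exact: gap0.
move=> h.
have cg := tail_lcb Y_tail (bgap k l).
have hg : \forall n \near \oo, condE N X (u n) (fun x => gap N k%:R H (trim l x)) <= e / 4.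
  have /cvgrPdist_le/(_ _ e8) cg' := cg.
  have : \forall n \near \oo, `|EY (fun x => gap N k%:R H (trim l x)) -
      condE N X (u n) (fun x => gap N k%:R H (trim l x))| <= e / 8.
    exact: (u_infty cg').
  by apply: filterS => n /ler_normlP[h1 h2]; lra.
have rl : \forall n \near \oo, (l + `|h| <= r n)%N.
  exact: (r_infty (nbhs_infty_ge (l + `|h|)%N)).
near=> n.
have hgn : condE N X (u n) (fun x => gap N k%:R H (trim l x)) <= e / 4 by near: n.
have rln : (l + `|h| <= r n)%N by near: n.
have hcln : forall h : int, EX (clump n eta l h) <= e / 8 / (4 * M) * w n by near: n.
pose G1 x := gap N k%:R H (trim l (scale (u n)^-1 x)) * exceed 0 (u n) x.
pose G2 x := k%:R * eta * exceed 0 (u n) x.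
pose G3 x := 2 * M * (clump n eta l 0 x + clump n eta l h x).
have bI j : bm (exceed j (u n) : S -> R) by exact: bm_exceed.
have bG1 : bm (G1 : S -> R).
  by apply: bmM => //; apply: (bm_scale (u n)^-1 (lcb_bm (bgap k l))).
have bG2 : bm (G2 : S -> R) by apply: bmM => //; exact: bm_cst.
have bG3 : bm (G3 : S -> R).
  apply: bmM; first exact: bm_cst.
  by apply: bmD; exact: bm_clump.
have bLHS : bm (fun x : S => `|H (blk n h x) - lower N k%:R H (trim l (scale (u n)^-1 x))| *
        (exceed 0 (u n) x * exceed h (u n) x)).
  apply: bmM; last exact: bmM.
  apply: bm_norm; apply: bmB; first exact: bm_blk.
  exact: (bm_scale (u n)^-1 (lcb_bm (blow k l))).
apply: (@le_trans _ _ (EX (fun x => G1 x + G2 x + G3 x))).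
  apply: le_Ex.
  - exact: (bmX X bLHS).
  - by apply: bmD; [apply: bmD|]; [exact: (bmX X bG1)|exact: (bmX X bG2)|exact: (bmX X bG3)].
  move=> t; move: (X t) => x.
  have G10 : 0 <= G1 x by rewrite mulr_ge0// gap0.
  have G20 : 0 <= G2 x by rewrite !mulr_ge0// ltW.
  have G30 : 0 <= G3 x.
    by rewrite !mulr_ge0 ?addr_ge0 ?clump_ge0//; lra.
  case: (ltP (u n) (N (x 0))) => x0; last by rewrite mul0r mulr0 !addr_ge0.
  case: (ltP (u n) (N (x h))) => xh; last by rewrite !mulr0 !addr_ge0.
  rewrite !mulr1; have [cl|cl] := ltP (clump n eta l 0 x + clump n eta l h x) 1.
    have ns := blk_near_trim (ltW eta0) eta1 rln x0 xh cl.
    have := lower_approx hN HM (ler0n R k) ns.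
    rewrite /G1 /G2 x0 !mulr1; lra.
  have h1 := ler_normB (H (blk n h x)) (lower N k%:R H (trim l (scale (u n)^-1 x))).
  have h2 := HM (blk n h x).
  have h3 := norm_lower hN HM (ler0n R k) (trim l (scale (u n)^-1 x)).
  have : 2 * M <= G3 x by rewrite /G3 ler_peMr//; lra.
  lra.
have -> : EX (fun x => G1 x + G2 x + G3 x) = EX G1 + EX G2 + EX G3.
  rewrite ExD; [|apply: bmD|]; [|exact: (bmX X bG1)|exact: (bmX X bG2)|exact: (bmX X bG3)].
  by rewrite ExD//; [exact: (bmX X bG1)|exact: (bmX X bG2)].
have E1 : EX G1 <= e / 4 * w n by move: hgn; rewrite /condE ler_pdivrMr.
have E2 : EX G2 <= e / 8 * w n.
  rewrite /G2 (@ExZ _ _ _ _ _ (fun t => exceed 0 (u n) (X t))); last exact: (bmX X (bI 0)).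
  by rewrite -tailpE// ler_pM2r.
have E3 : EX G3 <= e / 8 * w n.
  rewrite /G3 (@ExZ _ _ _ _ _ (fun t => clump n eta l 0 (X t) + clump n eta l h (X t))); last first.
    by apply: bmD; exact: (bmX X (bm_clump _ _ _ _)).
  rewrite ExD; try exact: (bmX X (bm_clump _ _ _ _)).
  have h1 := hcln 0; have h2 := hcln h.
  apply: (@le_trans _ _ (2 * M * (e / 8 / (4 * M) * w n + e / 8 / (4 * M) * w n))).
    by rewrite ler_wpM2l ?lerD//; lra.
  rewrite le_eqVlt; apply/orP; left; apply/eqP; field.
  by rewrite gt_eqF//; lra.
have w0 := tailp_gt0 (u n); nra.
Unshelve. all: by end_near. Qed.

End Clumps.

(** * Covariances under beta-mixing *)

Section Mixing.
Context {R : realType} {d : nat} {d1 : measure_display}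
  {T1 : measurableType d1} {P : probability T1 R}.
Variable X : {RV P >-> seq_space R d}.
Notation S := (seq_space R d).
Implicit Types (f g : (int -> 'rV[R]_d) -> R) (J : set int).
Hypothesis X_stationary : stationary X.
Local Notation EX f := (Ex P (fun t => f (X t))).

Definition restr J (x : int -> 'rV[R]_d) : int -> 'rV[R]_d :=
  fun j => if `[< J j >] then x j else 0.

Definition depends_on J f : Prop := forall x, f x = f (restr J x).

Lemma coord_sigma_restr J (B : set S) : measurable B ->
  coord_sigma X J [set t | B (restr J (X t))].
Proof.
move=> mB.
have sX : sigma_algebra setT (coord_sigma X J).
  exact: smallest_sigma_algebra.
have [sX0 sXC sXU] := sX.
pose G : set (set S) := [set B | coord_sigma X J [set t | B (restr J (X t))]].
suff : <<s coord_sigma (fun x : int -> 'rV[R]_d => x) setT >> `<=` G by apply.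
have sG : sigma_algebra setT G.
  split; rewrite /G /=.
  - exact: sX0.
  - by move=> C GC; exact: (sXC _ GC).
  - by move=> F GF; exact: (sXU (fun i => [set t | F i (restr J (X t))]) GF).
apply: smallest_sub => //; apply: smallest_sub => //.
move=> _ [j _ [C mC <-]]; rewrite /G /=.
rewrite [X in coord_sigma _ _ X](_ : _ = [set t | C (restr J (X t) j)]); last first.
  by apply/seteqP; split => t //= [].
have [Jj|Jj] := pselect (J j).
  apply: sub_sigma_algebra; exists j => //; exists C => //.
  rewrite setTI; apply/seteqP; split => t /=; rewrite /restr asboolT//.
have E t : restr J (X t) j = 0 by rewrite /restr asboolF.
have [C0|C0] := pselect (C 0).
  rewrite (_ : mkset _ = setT); last by apply/seteqP; split => t //= _; rewrite E.
  by have := sXC _ sX0; rewrite setTD setC0.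
by rewrite (_ : mkset _ = set0)//; apply/seteqP; split => t //=; rewrite E.
Qed.

Definition cov_of f g : R := EX (fun x => f x * g x) - EX f * EX g.

Lemma beta_coef_ge (F G : set (set T1)) (p q : nat) (A : 'I_p -> set T1)
    (B : 'I_q -> set T1) :
  finite_partition F A -> finite_partition G B ->
  ((\sum_(i < p) \sum_(j < q)
     `|prob P (A i `&` B j) - prob P (A i) * prob P (B j)|)%:E <=
   2%:E * beta_coef P F G)%E.
Proof.
move=> FA GB; rewrite /beta_coef muleA -EFinM mulfV// mul1e.
by apply: ereal_sup_ubound; exists p, q, A, B.
Qed.

Lemma beta_coef_ge0 (F G : set (set T1)) : F setT -> G setT -> (0 <= beta_coef P F G)%E.
Proof.
move=> FT GT; have part (K : set (set T1)) : K setT ->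
    finite_partition K (fun _ : 'I_1 => setT : set T1).
  move=> KT; split => //; first by move=> i j _ _ _; rewrite !ord1.
  by apply/seteqP; split => // t _; exists ord0.
have := beta_coef_ge (part F FT) (part G GT).
rewrite /beta_coef => h; apply: mule_ge0; first by rewrite lee_fin.
have := h; rewrite muleA -EFinM mulfV// mul1e.
by apply: le_trans; rewrite lee_fin; apply: sumr_ge0 => i _; apply: sumr_ge0.
Qed.

Lemma beta_mixing_ge0 n : (0 <= beta_mixing X n)%E.
Proof.
have cT J : coord_sigma X J setT.
  have [s0 sC _] : sigma_algebra setT (coord_sigma X J).
    exact: smallest_sigma_algebra.
  by have := sC _ s0; rewrite setD0.
by apply: beta_coef_ge0; exact: cT.
Qed.

(** For functions with finitely many values this is the definition of the
    mixing coefficient, the level sets being finite partitions; the general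
    case follows by quantization. *)
Lemma cov_beta_le f g (M : R) (n : nat) : bm (f : S -> R) -> bm (g : S -> R) ->
  1 <= M -> (forall x, `|f x| <= M) -> (forall x, `|g x| <= M) ->
  depends_on [set j | j <= 0] f -> depends_on [set j | n%:Z <= j] g ->
  (`|cov_of f g|%:E <= (2 * M ^+ 2)%:E * beta_mixing X n)%E.
Proof.
move=> bf bg M1 fM gM fJ gJ.
have M0 : 0 <= M by lra.
apply/lee_addgt0Pr => e e0.
have e4 : 0 < e / (4 * M) by rewrite divr_gt0//; lra.
have [k [q [a [mq qa aM]]]] := quantize M e4.
pose A (h : (int -> 'rV[R]_d) -> R) i := [set t : T1 | q (h (X t)) = i].
have part h J : bm (h : S -> R) -> depends_on J h ->
    finite_partition (coord_sigma X J) (A h).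
  move=> bh hJ; split.
  - move=> i; rewrite /A (_ : mkset _ =
      [set t | (h @^-1` (q @^-1` [set i])) (restr J (X t))]).
      apply: coord_sigma_restr; rewrite -[X in measurable X]setTI.
      by have [mh _] := bh; exact: mh.
    by apply/seteqP; split => t /=; rewrite -hJ.
  - by move=> i j _ _ [t [<- <-]].
  - by apply/seteqP; split => // t _; exists (q (h (X t))).
have := beta_coef_ge (part f _ bf fJ) (part g _ bg gJ).
rewrite -/(beta_mixing X n); set s := \sum_(i < k) _ => sb.
have mA h i : bm (h : S -> R) -> measurable (A h i).
  move=> [mh _]; rewrite /A -[X in measurable X]setTI.
  have mhX : measurable_fun setT (fun t => h (X t)) by exact: measurableT_comp.
  exact: (mhX measurableT _ (mq i)).
have bI h i : bm (h : S -> R) -> bm (\1_(A h i) : T1 -> R).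
  by move=> bh; apply: bm_indic; exact: mA.
have EI (B : set T1) : measurable B -> Ex P (\1_B) = prob P B.
  by move=> mB; rewrite /Ex /Rintegral integral_indic// setIT.
have step h t : bm (h : S -> R) -> \sum_(i < k) a i * \1_(A h i) t = a (q (h (X t))).
  move=> bh; rewrite (bigD1 (q (h (X t))))//= big1 ?addr0.
    by rewrite indicE mem_set ?mulr1.
  move=> i iq; rewrite indicE memNset ?mulr0//= => iE.
  by rewrite -iE eqxx in iq.
pose fq t := \sum_(i < k) a i * \1_(A f i) t.
pose gq t := \sum_(i < k) a i * \1_(A g i) t.
have bq h : bm (h : S -> R) -> bm (fun t => \sum_(i < k) a i * \1_(A h i) t : R).
  by move=> bh; apply: bm_sum => i; apply: bmM; [exact: bm_cst|exact: bI].
have bfq : bm fq by exact: bq.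
have bgq : bm gq by exact: bq.
have Eq h : bm (h : S -> R) -> Ex P (fun t => \sum_(i < k) a i * \1_(A h i) t) =
    \sum_(i < k) a i * prob P (A h i).
  move=> bh; rewrite (Ex_sum P _ _ (f := fun i t => a i * \1_(A h i) t)).
    by apply: eq_bigr => i _; rewrite ExZ ?EI//; [exact: mA|exact: bI].
  by move=> i; apply: bmM; [exact: bm_cst|exact: bI].
have covq : `|Ex P (fun t => fq t * gq t) - Ex P fq * Ex P gq| <= M ^+ 2 * s.
  have -> : Ex P (fun t => fq t * gq t) =
      \sum_(i < k) \sum_(j < k) a i * a j * prob P (A f i `&` A g j).
    rewrite (_ : (fun t => fq t * gq t) = (fun t =>
       \sum_(i < k) \sum_(j < k) a i * a j * \1_(A f i `&` A g j) t)).
      rewrite (Ex_sum P _ _ (f := fun i t =>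
        \sum_(j < k) a i * a j * \1_(A f i `&` A g j) t)).
        apply: eq_bigr => i _.
        rewrite (Ex_sum P _ _ (f := fun j t => a i * a j * \1_(A f i `&` A g j) t)).
          apply: eq_bigr => j _; rewrite ExZ ?EI//.
            by apply: measurableI; exact: mA.
          by apply: bm_indic; apply: measurableI; exact: mA.
        move=> j; apply: bmM; first exact: bm_cst.
        by apply: bm_indic; apply: measurableI; exact: mA.
      move=> i; apply: bm_sum => j; apply: bmM; first exact: bm_cst.
      by apply: bm_indic; apply: measurableI; exact: mA.
    apply/funext => t; rewrite /fq /gq mulr_suml; apply: eq_bigr => i _.
    rewrite mulr_sumr; apply: eq_bigr => j _.
    by rewrite indicI /= mulrACA.
  rewrite !Eq// mulr_suml -sumrB mulr_sumr (le_trans (ler_norm_sum _ _ _))//.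
  apply: ler_sum => i _.
  rewrite mulr_sumr -sumrB mulr_sumr (le_trans (ler_norm_sum _ _ _))//.
  apply: ler_sum => j _.
  rewrite mulrACA -mulrBr normrM ler_wpM2r// normrM expr2.
  by apply: ler_pM => //; exact: aM.
have fqM t : `|fq t| <= M by rewrite /fq step//; exact: aM.
have gqM t : `|gq t| <= M by rewrite /gq step//; exact: aM.
have ffq t : `|f (X t) - fq t| <= e / (4 * M) by rewrite /fq step//; exact: qa.
have ggq t : `|g (X t) - gq t| <= e / (4 * M) by rewrite /gq step//; exact: qa.
have bfX := bmX X bf; have bgX := bmX X bg.
have h1 : `|EX (fun x => f x * g x) - Ex P (fun t => fq t * gq t)| <= e / 2.
  rewrite -[e / 2](Ex_cst P); apply: dist_Ex => [|||t].
  - exact: bmM.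
  - exact: bmM.
  - exact: bm_cst.
  have -> : f (X t) * g (X t) - fq t * gq t =
    f (X t) * (g (X t) - gq t) + gq t * (f (X t) - fq t) by ring.
  rewrite (le_trans (ler_normD _ _))// !normrM.
  have -> : e / 2 = M * (e / (4 * M)) + M * (e / (4 * M)).
    by field; rewrite gt_eqF//; lra.
  by apply: lerD; apply: ler_pM.
have h2 : `|EX f * EX g - Ex P fq * Ex P gq| <= e / 2.
  have -> : EX f * EX g - Ex P fq * Ex P gq =
    EX f * (EX g - Ex P gq) + Ex P gq * (EX f - Ex P fq) by ring.
  rewrite (le_trans (ler_normD _ _))// !normrM.
  have -> : e / 2 = M * (e / (4 * M)) + M * (e / (4 * M)).
    by field; rewrite gt_eqF//; lra.
  apply: lerD; apply: ler_pM => //.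
  - by apply: norm_Ex_le.
  - rewrite -[leRHS](Ex_cst P); apply: dist_Ex => //; exact: bm_cst.
  - by apply: norm_Ex_le.
  - rewrite -[leRHS](Ex_cst P); apply: dist_Ex => //; exact: bm_cst.
have : `|cov_of f g| <= M ^+ 2 * s + e.
  move: covq h1 h2 => /ler_normlP[c1 c2] /ler_normlP[c3 c4] /ler_normlP[c5 c6].
  by rewrite /cov_of ler_norml; apply/andP; split; lra.
rewrite -lee_fin => /le_trans; apply; rewrite EFinD leeD2r// EFinM.
have -> : ((2 * M ^+ 2)%:E * beta_mixing X n =
    (M ^+ 2)%:E * (2%:E * beta_mixing X n))%E.
  by move: (beta_mixing X n) => B; rewrite muleA -EFinM (mulrC 2).
by apply: lee_wpmul2l => //; rewrite lee_fin exprn_ge0.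
Qed.

Lemma cov_ofC f g : cov_of f g = cov_of g f.
Proof.
by rewrite /cov_of mulrC; congr (Ex _ _ - _); apply/funext => t; rewrite mulrC.
Qed.

Lemma cov_of_shift k f g : bm (f : S -> R) -> bm (g : S -> R) ->
  cov_of (fun x => f (shift k x)) (fun x => g (shift k x)) = cov_of f g.
Proof.
move=> bf bg; rewrite /cov_of (Ex_shift X_stationary k bf) (Ex_shift X_stationary k bg).
by rewrite (Ex_shift X_stationary k (bmM bf bg)).
Qed.

End Mixing.

(** * Sums over a square *)

Lemma sum_nat_lt_le {R : numDomainType} (F : nat -> R) (m n K : nat) :
  (forall i, 0 <= F i) ->
  \sum_(m <= i < n | (i < K)%N) F i <= \sum_(m <= i < K) F i.
Proof.
move=> F0; pose L := maxn n K.
rewrite (@big_nat_widen _ _ _ m n L) ?leq_maxl//.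
rewrite (@big_nat_widen _ _ _ m K L) ?leq_maxr//=.
rewrite [leRHS]big_mkcond [leLHS]big_mkcond; apply: ler_sum => i _.
by case: (i < K)%N; case: (i < n)%N.
Qed.

Lemma sum_nat_gt_le {R : numDomainType} (F : nat -> R) (m n K : nat) :
  (forall i, 0 <= F i) ->
  \sum_(m <= i < n | (K <= i)%N) F i <= \sum_(K <= i < n) F i.
Proof.
move=> F0; rewrite (@big_nat_widenl _ _ _ m 0)// (@big_nat_widenl _ _ _ K 0)//=.
rewrite [leRHS]big_mkcond [leLHS]big_mkcond; apply: ler_sum => i _.
by case: (K <= i)%N; case: (m <= i)%N.
Qed.

(** By induction on the side of the square: the new row and the new column
    contribute the two signs of the lags. *)
Lemma sum_square_diff {V : zmodType} (c : int -> V) (n : nat) :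
  \sum_(1 <= i < n.+1) \sum_(1 <= k < n.+1) c (k%:Z - i%:Z) =
  \sum_(0 <= k < n) (c 0 + \sum_(1 <= h < k.+1) (c h%:Z + c (- h%:Z))).
Proof.
elim: n => [|n IH]; first by rewrite !big_nil.
have row : \sum_(1 <= i < n.+1) c (n.+1%:Z - i%:Z) = \sum_(1 <= h < n.+1) c h%:Z.
  rewrite big_nat_rev /= !big_nat; apply: eq_bigr => k /andP[k1 kn].
  by congr c; lia.
have col : \sum_(1 <= k < n.+1) c (k%:Z - n.+1%:Z) =
    \sum_(1 <= h < n.+1) c (- h%:Z).
  rewrite big_nat_rev /= !big_nat; apply: eq_bigr => k /andP[k1 kn].
  by congr c; lia.
rewrite [RHS]big_nat_recr//= -IH big_nat_recr//=.
rewrite [X in _ + X = _]big_nat_recr//= subrr col.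
under eq_bigr do rewrite big_nat_recr//=.
by rewrite !big_split /= row -addrA; congr (_ + _); rewrite addrA addrC.
Qed.

(** The terms with [k < m] are few and miss lags up to [m]; the others have
    only lags beyond [m] in excess. *)
Lemma cesaro_partial_sums {R : realFieldType} (c0 : R) (D E : nat -> R) (m n : nat) :
  (m < n)%N -> (forall h, `|D h| <= E h) ->
  `|(\sum_(0 <= k < n) (c0 + \sum_(1 <= h < k.+1) D h)) / n%:R -
    (c0 + \sum_(1 <= h < m.+1) D h)| <=
  \sum_(m.+1 <= h < n) E h + m%:R / n%:R * \sum_(1 <= h < m.+1) E h.
Proof.
move=> mn DE; have n0 : 0 < n%:R :> R by rewrite ltr0n (leq_ltn_trans _ mn).
have E0 h : 0 <= E h := le_trans (normr_ge0 _) (DE h).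
set am := c0 + \sum_(1 <= h < m.+1) D h.
have -> : am = (\sum_(0 <= k < n) am) / n%:R.
  by rewrite sumr_const_nat subn0 -[am *+ n]mulr_natr mulfK// gt_eqF.
rewrite -mulrBl -sumrB normrM (@ger0_norm _ n%:R^-1); last by rewrite invr_ge0 ltW.
rewrite ler_pdivrMr//.
apply: (le_trans (ler_norm_sum _ _ _)).
set T := \sum_(m.+1 <= h < n) E h; set U := \sum_(1 <= h < m.+1) E h.
have T0 : 0 <= T by exact: sumr_ge0.
have U0 : 0 <= U by exact: sumr_ge0.
have normD (a b : nat) : `|\sum_(a <= h < b) D h| <= \sum_(a <= h < b) E h.
  by apply: (le_trans (ler_norm_sum _ _ _)); apply: ler_sum.
rewrite (@big_cat_nat _ _ _ m)//=; last exact: ltnW.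
have -> : (T + m%:R / n%:R * U) * n%:R = m%:R * U + n%:R * T.
  by field; rewrite gt_eqF.
apply: lerD.
  apply: (@le_trans _ _ (\sum_(0 <= k < m) U)); last first.
    by rewrite sumr_const_nat subn0 mulr_natl.
  rewrite !big_nat; apply: ler_sum => k /andP[_ km].
  rewrite /am opprD addrACA subrr add0r distrC.
  rewrite (@big_cat_nat _ _ _ k.+1 1 m.+1)//=; last by rewrite ltnS ltnW.
  rewrite addrAC subrr add0r (le_trans (normD _ _))//.
  by rewrite /U (@big_cat_nat _ _ _ k.+1 1 m.+1)//= ?lerDr ?sumr_ge0// ltnS ltnW.
apply: (@le_trans _ _ (\sum_(m <= k < n) T)); last first.
  rewrite sumr_const_nat -[leLHS]mulr_natl ler_wpM2r// ler_nat.
  exact: leq_subr.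
rewrite !big_nat; apply: ler_sum => k /andP[mk kn].
rewrite /am opprD addrACA subrr add0r.
rewrite (@big_cat_nat _ _ _ m.+1 1 k.+1)//= addrAC subrr add0r.
rewrite (le_trans (normD _ _))// /T (@big_cat_nat _ _ _ k.+1 m.+1 n)//=.
by rewrite lerDl sumr_ge0.
Qed.

(** * Covariances at a given lag *)

Section RunsCovariance.
Context {R : realType} {d : nat} {d1 : measure_display}
  {T1 : measurableType d1} {P : probability T1 R}.
Variables (N : 'rV[R]_d -> R) (X : {RV P >-> seq_space R d}).
Notation S := (seq_space R d).
Implicit Types (f : (int -> 'rV[R]_d) -> R).
Hypothesis hN : is_norm N.
Hypothesis X_stationary : stationary X.
Local Notation p := (tailp N X).
Hypothesis tailp_gt0 : forall x, 0 < p x.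
Variables (r : nat -> nat) (u : nat -> R).
Hypothesis u_gt0 : forall n, 0 < u n.
Hypothesis r_gt0 : forall n, (0 < r n)%N.
Hypothesis hS : summability N X r u.
Local Notation w n := (p (u n)).
Hypothesis rw_0 : (r n)%:R * w n @[n --> \oo] --> (0 : R).
Hypothesis hbeta : ((w n)^-1%:E * \sum_((r n).+1 <= i <oo) beta_mixing X i)%E
   @[n --> \oo] --> (0 : \bar R).
Local Notation exceed j a := (fun x : int -> 'rV[R]_d => (a < N (x j))%R%:R : R).
Local Notation EX f := (Ex P (fun t => f (X t))).

Lemma w_small (e : R) : 0 < e -> \forall n \near \oo, w n <= e.
Proof.
move=> e0; have /cvgrPdist_le/(_ e e0) := rw_0; apply: filterS => n.
rewrite sub0r normrN ger0_norm; last by rewrite mulr_ge0// tailp_ge0.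
by apply: le_trans; rewrite ler_peMl ?tailp_ge0// ler1n.
Qed.

Definition rbeta (i : nat) : R := fine (beta_mixing X i).

Lemma rbeta_ge0 i : 0 <= rbeta i.
Proof. by rewrite fine_ge0// beta_mixing_ge0. Qed.

(** Beyond [r n] the coefficients are finite, which [fine] requires. *)
Lemma beta_small (e : R) : 0 < e -> \forall n \near \oo,
  (forall i, (r n < i)%N -> beta_mixing X i = (rbeta i)%:E) /\
  (forall a K, (r n < a)%N -> \sum_(a <= i < K) rbeta i <= e * w n).
Proof.
move=> e0; have e0' : (0 < e%:E)%E by rewrite lte_fin.
have : \forall n \near \oo, ((w n)^-1%:E *
    \sum_((r n).+1 <= i <oo) beta_mixing X i < e%:E)%E.
  exact: (hbeta (open_ereal_lt' e0')).
apply: filterS => n; set B := (\sum_(_ <= _ <oo) _)%E => hB.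
have w0 := tailp_gt0 (u n).
have Be : (B <= (e * w n)%:E)%E.
  have : ((w n)%:E * ((w n)^-1%:E * B) <= (w n)%:E * e%:E)%E.
    by apply: lee_wpmul2l; [rewrite lee_fin ltW|exact: ltW].
  by rewrite muleA -EFinM mulfV ?gt_eqF// mul1e -EFinM mulrC.
have partial a K : (r n < a)%N -> (\sum_(a <= i < K) beta_mixing X i <= (e * w n)%:E)%E.
  move=> ra; apply: le_trans Be.
  apply: (@le_trans _ _ (\sum_((r n).+1 <= i < K) beta_mixing X i)%E); last first.
    by apply: nneseries_lim_ge => i _ _; exact: beta_mixing_ge0.
  have [aK|Ka] := leqP a K; last first.
    by rewrite big_geq ?(ltnW Ka)//; apply: sume_ge0 => i _; exact: beta_mixing_ge0.
  rewrite [leRHS](@big_cat_nat _ _ _ a)//= leeDr//.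
  by apply: sume_ge0 => i _; exact: beta_mixing_ge0.
have fin i : (r n < i)%N -> beta_mixing X i = (rbeta i)%:E.
  move=> ri; rewrite /rbeta fineK// ge0_fin_numE; last exact: beta_mixing_ge0.
  have := partial i i.+1 ri; rewrite big_nat1 => /le_lt_trans; apply.
  exact: ltry.
split=> // a K ra; rewrite -lee_fin (le_trans _ (partial a K ra))//.
rewrite -sumEFin le_eqVlt; apply/orP; left; apply/eqP.
rewrite !big_nat; apply: eq_bigr => i /andP[ai _].
by rewrite fin// (leq_trans ra).
Qed.

Variables (M : R) (g g' : nat -> (int -> 'rV[R]_d) -> R).
Hypothesis M1 : 1 <= M.

(** What the estimates of covariances use of an anchored functional. *)
Definition block_functional (h : nat -> (int -> 'rV[R]_d) -> R) : Prop :=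
  [/\ forall n, bm (h n : S -> R),
      forall n x, `|h n x| <= M * exceed 0 (u n) x &
      forall n x y, (forall j, (`|j| <= r n)%N -> x j = y j) -> h n x = h n y].

Hypotheses (hg : block_functional g) (hg' : block_functional g').

Local Notation pairx n j := (pairp N X u n 1 0 j).

Lemma pairp_le_w n j : pairx n j <= w n.
Proof.
rewrite tailpE//; apply: le_Ex => [||t].
- exact: (bmX X (bm_pair hN _ _ _)).
- exact: (bmX X (bm_exceed hN _ _)).
- by rewrite mul1r ler_piMr//; case: (_ < _).
Qed.

Section OneOrder.
Variables (f f' : nat -> (int -> 'rV[R]_d) -> R).
Hypotheses (hf : block_functional f) (hf' : block_functional f').

Lemma block_functional_mean n : `|EX (f n)| <= M * w n.
Proof.
have [bf fM _] := hf; apply: (le_trans (le_norm_Ex P (bmX X (bf n)))).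
rewrite tailpE// -ExZ; last exact: (bmX X (bm_exceed hN _ _)).
apply: le_Ex => [||t]; last exact: fM.
- exact/bm_norm/(bmX X (bf n)).
- by apply: bmM; [exact: bm_cst|exact: (bmX X (bm_exceed hN _ _))].
Qed.

Lemma cross_moment_le n (h : int) :
  `|EX (fun x => f n x * f' n (shift h x))| <= M ^+ 2 * pairx n h.
Proof.
have [bf fM _] := hf; have [bf' f'M _] := hf'.
have bff : bm (fun x : S => f n x * f' n (shift h x)).
  by apply: bmM => //; exact: (bm_shift h (bf' n)).
apply: (le_trans (le_norm_Ex P (bmX X bff))).
rewrite /(pairx _ _) -ExZ; last exact: (bmX X (bm_pair hN _ _ _)).
apply: le_Ex => [||t].
- exact/bm_norm/(bmX X bff).
- by apply: bmM; [exact: bm_cst|exact: (bmX X (bm_pair hN _ _ _))].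
- rewrite normrM mul1r expr2 mulrACA; apply: ler_pM => //.
  by have := f'M n (shift h (X t)); rewrite /shift add0r.
Qed.

Definition lag_cov n (h : int) : R := cov_of X (f n) (fun x => f' n (shift h x)).

Lemma mean_shift n (h : int) : EX (fun x => f' n (shift h x)) = EX (f' n).
Proof. by have [bf' _ _] := hf'; exact: (Ex_shift X_stationary h (bf' n)). Qed.

End OneOrder.

Lemma lag_cov_le n h : `|lag_cov g g' n h| <= M ^+ 2 * (pairx n h + w n ^+ 2).
Proof.
rewrite /lag_cov /cov_of (mean_shift hg') mulrDr (le_trans (ler_normB _ _))//.
apply: lerD; first exact: cross_moment_le.
rewrite normrM [w n ^+ 2]expr2 expr2 mulrACA.
by apply: ler_pM => //; exact: block_functional_mean.
Qed.

Lemma bound_gt0 : 0 < M. Proof. exact: lt_le_trans ltr01 M1. Qed.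

Lemma bound_ge0 : 0 <= M. Proof. exact: ltW bound_gt0. Qed.

Lemma shift_shift k l (x : int -> 'rV[R]_d) : shift k (shift l x) = shift (k + l) x.
Proof. by apply/funext => j; rewrite /shift addrA. Qed.

(** After a shift by [- r n], the first block lies in the past of 0 and the
    second one starts at [h - 2 * r n]. *)
Lemma lag_cov_far n (h : nat) (f f' : nat -> (int -> 'rV[R]_d) -> R) :
  block_functional f -> block_functional f' ->
  (r n + r n <= h)%N ->
  (`|lag_cov f f' n h%:Z|%:E <= (2 * M ^+ 2)%:E * beta_mixing X (h - (r n + r n)))%E.
Proof.
move=> [bf fM fw] [bf' f'M f'w] rh; rewrite /lag_cov.
have boundM (k : nat -> (int -> 'rV[R]_d) -> R) :
    (forall n x, `|k n x| <= M * exceed 0 (u n) x) -> forall n x, `|k n x| <= M.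
  move=> kM m x; apply: le_trans (kM m x) _.
  by rewrite ler_piMr ?bound_ge0//; case: (_ < _).
have b1 := bf n; have b2 := bm_shift h%:Z (bf' n).
rewrite -(cov_of_shift X_stationary (- (r n)%:Z) b1 b2).
apply: cov_beta_le => //.
- exact: (bm_shift _ b1).
- exact: (bm_shift _ b2).
- by move=> x; exact: boundM.
- by move=> x; exact: boundM.
- move=> x; apply: fw => j jr; rewrite /shift /restr asboolT//=; lia.
- move=> x; rewrite !shift_shift; apply: f'w => j jr.
  by rewrite /shift /restr asboolT//=; lia.
Qed.

Lemma lag_covN n h : lag_cov g g' n (- h) = lag_cov g' g n h.
Proof.
have [bg _ _] := hg; have [bg' _ _] := hg'.
rewrite /lag_cov -(cov_of_shift X_stationary h (bg n) (bm_shift (- h) (bg' n))).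
rewrite cov_ofC; congr (cov_of X _ _); apply/funext => x.
rewrite shift_shift addNr; congr (g' n _).
by apply/funext => j; rewrite /shift addr0.
Qed.

(** The covariance inequality for the indicators of the two exceedances, each
    of probability [w n]. *)
Lemma pairp_beta n (j : nat) :
  ((pairx n j%:Z)%:E <= (w n ^+ 2)%:E + 2%:E * beta_mixing X j)%E.
Proof.
have := @cov_beta_le _ _ _ _ _ X (exceed 0 (u n)) (exceed j%:Z (u n)) 1 j
  (bm_exceed hN _ _) (bm_exceed hN _ _) (lexx _).
rewrite expr1n mulr1.
have E1 (i : int) (x : int -> 'rV[R]_d) : `|exceed i (u n) x| <= 1.
  by case: (_ < _); rewrite /= ?normr1 ?normr0.
move=> /(_ (E1 0) (E1 j)); rewrite /cov_of (prob_exceed_shift hN X_stationary).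
rewrite (prob_exceed_shift hN X_stationary).
have -> : EX (fun x => exceed 0 (u n) x * exceed j%:Z (u n) x) = pairx n j%:Z.
  by congr Ex; apply/funext => t; rewrite mul1r.
move=> h; have {}h := h _ _.
have : ((pairx n j%:Z - w n * w n)%:E <= 2%:E * beta_mixing X j)%E.
  apply: le_trans (h _ _).
  - by rewrite lee_fin ler_norm.
  - by move=> x; rewrite /restr asboolT.
  - by move=> x; rewrite /restr asboolT //=; exact: lexx.
by rewrite EFinB leeBlDl// expr2.
Qed.

Definition lag_cov2 n (h : nat) : R :=
  `|lag_cov g g' n h%:Z| + `|lag_cov g g' n (- h%:Z)|.

Lemma pairpN n h : pairx n (- h) = pairx n h.
Proof.
by rewrite (pairp0 hN X_stationary) [RHS](pairp0 hN X_stationary); congr (pairp _ _ _ _ _ _ _); lia.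
Qed.

(** Short lags are controlled by the joint exceedances, long ones by mixing
    between the blocks, and the lags between [r n] and [3 r n], whose blocks
    are not separated by [r n], by mixing between the exceedances alone. *)
Lemma lag_cov2_le n (h : nat) :
  (forall i, (r n < i)%N -> beta_mixing X i = (rbeta i)%:E) ->
  lag_cov2 n h <= 2 * M ^+ 2 * (
    (if (h < (r n).+1)%N then pairx n h%:Z else 0) +
    (if (h < (3 * r n).+1)%N then 2 * w n ^+ 2 else 0) +
    (if (r n < h)%N then 2 * rbeta h else 0) +
    (if (3 * r n < h)%N then 2 * rbeta (h - 2 * r n)%N else 0)).
Proof.
move=> bfin.
have p0 : 0 <= pairx n h%:Z by exact: pairp_ge0.
have M20 : 0 <= M ^+ 2 by rewrite exprn_ge0// bound_ge0.
have MM0 : 0 <= 2 * M ^+ 2 by exact: mulr_ge0.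
have w20 : 0 <= w n ^+ 2 by rewrite exprn_ge0// tailp_ge0.
have b0 i : 0 <= rbeta i by exact: rbeta_ge0.
have short : lag_cov2 n h <= 2 * M ^+ 2 * (pairx n h%:Z + w n ^+ 2).
  have := lag_cov_le n h%:Z; have := lag_cov_le n (- h%:Z).
  by rewrite pairpN /lag_cov2; lra.
have [h1|h1] := ltnP h (r n).+1.
  apply: (le_trans short); apply: ler_wpM2l => //.
  have -> : (h < (3 * r n).+1)%N by lia.
  by case: ifP => _; have := b0 h; have := b0 (h - 2 * r n)%N; lra.
rewrite ?h1 add0r.
have [h2|h2] := ltnP h (3 * r n).+1.
  apply: (le_trans short); apply: ler_wpM2l => //.
  have := pairp_beta n h; rewrite bfin// -EFinM -EFinD lee_fin => h3.
  by lra.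
rewrite ?h2 add0r.
have h3 : (r n + r n <= h)%N by lia.
have := lag_cov_far hg hg' h3; have := lag_cov_far hg' hg h3.
have -> : (h - (r n + r n) = h - 2 * r n)%N by lia.
rewrite bfin; last by lia.
rewrite -EFinM !lee_fin -lag_covN /lag_cov2 => f1 f2.
have := mulr_ge0 M20 (b0 h); lra.
Qed.

(** The four terms of [lag_cov2_le] are summed by summability, by [r n * w n
    -> 0], and twice by the mixing condition. *)
Lemma lag_cov2_tail (e : R) : 0 < e ->
  \forall m \near \oo, \forall n \near \oo, forall K,
    \sum_(m <= h < K) lag_cov2 n h <= e * w n.
Proof.
move=> e0.
have M20 : 0 < M ^+ 2 by rewrite exprn_gt0// bound_gt0.
(* 13 = 1 + 4 * 2 + 2 + 2 counts the units e' * w n used by the four sums *)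
pose e' := e / (2 * M ^+ 2) / 13.
have e'0 : 0 < e' by rewrite !divr_gt0// mulr_gt0.
have near_beta := beta_small e'0.
have near_rw : \forall n \near \oo, (r n)%:R * w n <= e'.
  have /cvgrPdist_le/(_ e' e'0) := rw_0; apply: filterS => n.
  by rewrite sub0r normrN ger0_norm// mulr_ge0// tailp_ge0.
have := summabilityP hN tailp_gt0 hS ltr01 e'0.
apply: filterS => m near_S; near=> n => K.
have [bfin bsum] : (forall i, (r n < i)%N -> beta_mixing X i = (rbeta i)%:E) /\
  (forall a K, (r n < a)%N -> \sum_(a <= i < K) rbeta i <= e' * w n) by near: n.
have rw : (r n)%:R * w n <= e' by near: n.
have sp : \sum_(m <= j < (r n).+1) pairx n j%:Z <= e' * w n by near: n.
apply: (@le_trans _ _ (\sum_(m <= h < K) 2 * M ^+ 2 * (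
    (if (h < (r n).+1)%N then pairx n h%:Z else 0) +
    (if (h < (3 * r n).+1)%N then 2 * w n ^+ 2 else 0) +
    (if (r n < h)%N then 2 * rbeta h else 0) +
    (if (3 * r n < h)%N then 2 * rbeta (h - 2 * r n)%N else 0)))).
  by apply: ler_sum => h _; exact: lag_cov2_le.
rewrite -mulr_sumr !big_split /= -!big_mkcond /= -!mulr_sumr.
set s1 := \sum_(m <= h < K | (h < _)%N) _.
set s2 := \sum_(m <= h < K | (h < _)%N) _.
set s3 := \sum_(m <= h < K | _) _.
set s4 := \sum_(m <= h < K | _) _.
have w0 := tailp_gt0 (u n).
have s1E : s1 <= e' * w n.
  by apply: le_trans sp; apply: sum_nat_lt_le => i; exact: pairp_ge0.
have s2E : s2 <= 4 * (r n)%:R * w n.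
  apply: (@le_trans _ _ (\sum_(m <= h < (3 * r n).+1) w n)).
    by apply: (@sum_nat_lt_le _ (fun=> w n)) => _; exact: ltW.
  rewrite sumr_const_nat -[leLHS]mulr_natl ler_wpM2r//; first exact: ltW.
  by rewrite -natrM ler_nat; have := r_gt0 n; lia.
have s3E : s3 <= e' * w n.
  apply: (le_trans (@sum_nat_gt_le _ rbeta m K (r n).+1 _)); first exact: rbeta_ge0.
  exact: bsum.
have s4E : s4 <= e' * w n.
  apply: (le_trans (@sum_nat_gt_le _ (fun h => rbeta (h - 2 * r n)%N) m K (3 * r n).+1 _)).
    by move=> i; exact: rbeta_ge0.
  have -> : ((3 * r n).+1 = (r n).+1 + 2 * r n)%N by rewrite addSn -mulSn.
  rewrite big_addn; under eq_bigr do rewrite addnK.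
  exact: bsum.
have {}s2E : w n * s2 <= 4 * (e' * w n).
  apply: (@le_trans _ _ (w n * (4 * (r n)%:R * w n))); first by rewrite ler_pM2l.
  have -> : w n * (4 * (r n)%:R * w n) = 4 * ((r n)%:R * w n * w n) by ring.
  by rewrite ler_wpM2l// ler_pM2r.
have -> : e * w n = 2 * M ^+ 2 * (13 * (e' * w n)).
  by rewrite /e'; field; rewrite gt_eqF// bound_gt0.
rewrite ler_wpM2l//; last by lra.
by rewrite mulr_ge0// ltW.
Unshelve. all: by end_near. Qed.

End RunsCovariance.

(** * The covariance of the runs *)

(** Sum over the integers [h] with [|h| <= m], arranged by opposite pairs as
    in [sum_square_diff]. *)
Definition symsum {V : zmodType} (m : nat) (F : int -> V) : V :=
  F 0 + \sum_(1 <= h < m.+1) (F h%:Z + F (- h%:Z)).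

Lemma symsum_opp {V : zmodType} m (F : int -> V) :
  symsum m (fun h => F (- h)) = symsum m F.
Proof.
rewrite /symsum oppr0; congr (_ + _); apply: eq_bigr => h _.
by rewrite opprK addrC.
Qed.

Lemma symsum_delta {V : zmodType} m (F : int -> V) (i : int) :
  (forall h, h != i -> F h = 0) ->
  symsum m F = if (`|i| <= m)%N then F i else 0.
Proof.
move=> Fi; rewrite /symsum; elim: m => [|m IH].
  rewrite big_nil addr0; case: ifP => [i0|i0].
    by congr F; lia.
  by apply: Fi; apply/eqP => i0'; rewrite -i0' in i0.
rewrite big_nat_recr//= addrA IH; case: (ltngtP `|i|%N m.+1) => im.
- have -> : (`|i| <= m)%N by lia.
  have z1 : F m.+1%:Z = 0 by apply: Fi; lia.
  have z2 : F (- m.+1%:Z) = 0 by apply: Fi; lia.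
  by rewrite z1 z2 !addr0.
- have -> : (`|i| <= m)%N = false by lia.
  have z1 : F m.+1%:Z = 0 by apply: Fi; lia.
  have z2 : F (- m.+1%:Z) = 0 by apply: Fi; lia.
  by rewrite z1 z2 !addr0.
- have -> : (`|i| <= m)%N = false by lia.
  rewrite add0r; have [iE|iE] : i = m.+1%:Z \/ i = - m.+1%:Z by lia.
    have z2 : F (- m.+1%:Z) = 0 by apply: Fi; lia.
    by rewrite z2 addr0 iE.
  have z1 : F m.+1%:Z = 0 by apply: Fi; lia.
  by rewrite z1 add0r iE.
Qed.

Lemma symsum_dist {R : realDomainType} m (F G : int -> R) (e : R) :
  (forall h, (`|h| <= m)%N -> `|F h - G h| <= e) ->
  `|symsum m F - symsum m G| <= (2 * m%:R + 1) * e.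
Proof.
move=> FG; rewrite /symsum opprD addrACA -sumrB (le_trans (ler_normD _ _))//.
rewrite mulrDl mul1r [leRHS]addrC lerD//; first by apply: FG.
apply: (le_trans (ler_norm_sum _ _ _)).
apply: (@le_trans _ _ (\sum_(1 <= h < m.+1) (e + e))).
  rewrite !big_nat; apply: ler_sum => h /andP[_ hm].
  by rewrite opprD addrACA (le_trans (ler_normD _ _))// lerD// FG//; lia.
by rewrite sumr_const_nat subSS subn0 -[leLHS]mulr_natl mulrAC -mulrA; lra.
Qed.

Section CovarianceSum.
Context {R : realType} {d : nat} {d1 : measure_display}
  {T1 : measurableType d1} {P : probability T1 R}.
Variables (N : 'rV[R]_d -> R) (X : {RV P >-> seq_space R d}).
Notation S := (seq_space R d).
Implicit Types (f : (int -> 'rV[R]_d) -> R).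
Hypothesis hN : is_norm N.
Hypothesis X_stationary : stationary X.
Local Notation p := (tailp N X).
Hypothesis tailp_gt0 : forall x, 0 < p x.
Variables (r : nat -> nat) (u : nat -> R).
Hypothesis u_gt0 : forall n, 0 < u n.
Hypothesis r_gt0 : forall n, (0 < r n)%N.
Hypothesis hS : summability N X r u.
Local Notation w n := (p (u n)).
Hypothesis rw_0 : (r n)%:R * w n @[n --> \oo] --> (0 : R).
Hypothesis hbeta : ((w n)^-1%:E * \sum_((r n).+1 <= i <oo) beta_mixing X i)%E
   @[n --> \oo] --> (0 : \bar R).
Local Notation exceed j a := (fun x : int -> 'rV[R]_d => (a < N (x j))%R%:R : R).
Local Notation EX f := (Ex P (fun t => f (X t))).

Section Sum.
Variables (M : R) (g g' : nat -> (int -> 'rV[R]_d) -> R).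
Hypothesis M1 : 1 <= M.
Hypotheses (hg : block_functional N r u M g) (hg' : block_functional N r u M g').

Definition cross (f f' : nat -> (int -> 'rV[R]_d) -> R) (n m : nat) : R :=
  symsum m (fun h => EX (fun x => f n x * f' n (shift h x))).

(** The Cesaro means of the sums of covariances are close to the sum up to lag
    [m], where replacing covariances by cross moments costs [O (m * w n ^ 2)]. *)
Lemma runs_cov_sum (e : R) : 0 < e ->
  \forall m \near \oo, \forall n \near \oo,
   `|(\sum_(1 <= i < n.+1) \sum_(1 <= k < n.+1)
        lag_cov X g g' n (k%:Z - i%:Z)) / n%:R - cross g g' n m| <= e * w n.
Proof.
move=> e0.
have M0 : 0 < M := lt_le_trans ltr01 M1.
have M20 : 0 < M ^+ 2 by rewrite exprn_gt0.
have e3 : 0 < e / 3 by lra.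
have := lag_cov2_tail hN X_stationary tailp_gt0 r_gt0 hS rw_0 hbeta M1 hg hg' e3.
move=> [m0 _ hm]; exists m0 => // m /= m0m.
have {hm} := hm m.+1 (leqW m0m) => /= near_tail.
have em : 0 < e / 3 / ((2 * m%:R + 1) * M ^+ 2).
  by rewrite !divr_gt0// mulr_gt0// ltr_wpDl.
have near_w := w_small r_gt0 rw_0 em.
have near_w1 := w_small r_gt0 rw_0 ltr01.
have near_n : \forall n \near \oo, m%:R * (m%:R * (4 * M ^+ 2)) / (e / 3) <= n%:R.
  exact: nbhs_infty_ger.
near=> n.
have htail : forall K, \sum_(m.+1 <= h < K) lag_cov2 X g g' n h <= e / 3 * w n.
  by near: n.
have wem : w n <= e / 3 / ((2 * m%:R + 1) * M ^+ 2) by near: n.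
have w1 : w n <= 1 by near: n.
have hn : m%:R * (m%:R * (4 * M ^+ 2)) / (e / 3) <= n%:R by near: n.
have mn : (m < n)%N by near: n; exact: nbhs_infty_gt.
have w0 := tailp_gt0 (u n).
have n0 : 0 < n%:R :> R by rewrite ltr0n (leq_ltn_trans _ mn).
rewrite (sum_square_diff (lag_cov X g g' n)).
pose D h := lag_cov X g g' n h%:Z + lag_cov X g g' n (- h%:Z).
have DE h : `|D h| <= lag_cov2 X g g' n h by exact: ler_normD.
have h1 := cesaro_partial_sums (lag_cov X g g' n 0) mn DE.
have h2 : `|lag_cov X g g' n 0 + \sum_(1 <= h < m.+1) D h - cross g g' n m| <=
    e / 3 * w n.
  have lc h : `|lag_cov X g g' n h - EX (fun x => g n x * g' n (shift h x))| <=
      M ^+ 2 * w n ^+ 2.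
    rewrite /lag_cov /cov_of addrAC subrr add0r normrN normrM expr2 [w n ^+ 2]expr2 mulrACA.
    rewrite (mean_shift X_stationary hg').
    by apply: ler_pM => //; [exact: (block_functional_mean X hN hg n)|
      exact: (block_functional_mean X hN hg' n)].
  rewrite /cross /symsum opprD addrACA -sumrB (le_trans (ler_normD _ _))//.
  apply: (@le_trans _ _ (M ^+ 2 * w n ^+ 2 +
      \sum_(1 <= h < m.+1) (M ^+ 2 * w n ^+ 2 + M ^+ 2 * w n ^+ 2))).
    apply: lerD; first exact: lc.
    apply: (le_trans (ler_norm_sum _ _ _)); apply: ler_sum => h _.
    by rewrite opprD addrACA (le_trans (ler_normD _ _))// lerD// lc.
  rewrite sumr_const_nat subSS subn0 -[_ *+ m]mulr_natl.
  have -> : M ^+ 2 * w n ^+ 2 + m%:R * (M ^+ 2 * w n ^+ 2 + M ^+ 2 * w n ^+ 2) =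
    (w n * ((2 * m%:R + 1) * M ^+ 2)) * w n by ring.
  by rewrite ler_pM2r// -ler_pdivlMr// mulr_gt0// ltr_wpDl.
have h3 : m%:R / n%:R * \sum_(1 <= h < m.+1) lag_cov2 X g g' n h <= e / 3 * w n.
  have le1 h : lag_cov2 X g g' n h <= 4 * M ^+ 2 * w n.
    have l1 j : `|lag_cov X g g' n j| <= 2 * M ^+ 2 * w n.
      apply: (le_trans (lag_cov_le hN X_stationary hg hg' n j)).
      have -> : 2 * M ^+ 2 * w n = M ^+ 2 * (2 * w n) by ring.
      rewrite ler_pM2l//; have := pairp_le_w X hN u n j => h4.
      have : w n ^+ 2 <= w n by rewrite expr2 ger_pMl.
      by lra.
    by have := l1 h%:Z; have := l1 (- h%:Z); rewrite /lag_cov2; lra.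
  apply: (@le_trans _ _ (m%:R / n%:R * (m%:R * (4 * M ^+ 2 * w n)))).
    rewrite ler_wpM2l ?divr_ge0//.
    apply: (@le_trans _ _ (\sum_(1 <= h < m.+1) 4 * M ^+ 2 * w n)).
      by apply: ler_sum => h _.
    by rewrite sumr_const_nat subSS subn0 -[leLHS]mulr_natl.
  have -> : m%:R / n%:R * (m%:R * (4 * M ^+ 2 * w n)) =
     m%:R * (m%:R * (4 * M ^+ 2)) / n%:R * w n by field; rewrite gt_eqF.
  by rewrite ler_pM2r// ler_pdivrMr// [e / 3 * _]mulrC -ler_pdivrMr.
have h4 := htail n.
have h5 := le_trans (ler_distD
  (lag_cov X g g' n 0 + \sum_(1 <= h < m.+1) D h) _ _) (lerD h1 h2).
rewrite /D in h5; apply: (le_trans h5); lra.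
Unshelve. all: by end_near. Qed.

End Sum.

Section Anchored.
Implicit Types (H : (int -> 'rV[R]_d) -> R) (A : (int -> 'rV[R]_d) -> \bar R).

Definition block_anchored H A (n : nat) (x : int -> 'rV[R]_d) : R :=
  anchored N H A 0 (blk r u n 0 x).

Lemma block_anchoredE H A n x : block_anchored H A n x =
  H (blk r u n 0 x) * (A (blk r u n 0 x) == (0%:~R)%:E)%:R * exceed 0 (u n) x.
Proof.
rewrite /block_anchored /anchored; congr (_ * (nat_of_bool _)%:R).
by rewrite blkE subrr /= (scale_u_lt hN u_gt0) mul1r.
Qed.

(** Shift-invariance of the functional and equivariance of the anchor turn the
    block around [i] into the block around 0 of the shifted sequence. *)
Lemma block_anchored_shift H A n (i : int) x : is_anchor N A -> shift_invariant H ->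
  block_anchored H A n (shift i x) = anchored N H A i (blk r u n i x).
Proof.
move=> hA Hs; rewrite /block_anchored blk_shift add0r /anchored Hs (anchor_shift hA) add0r.
by rewrite /shift add0r.
Qed.

Lemma block_functional_anchored H A (M : R) : bm (H : seq_space R d -> R) -> is_anchor N A ->
  0 <= M -> (forall x, `|H x| <= M) -> block_functional N r u M (block_anchored H A).
Proof.
move=> bH hA M0 HM; split.
- move=> n; rewrite (funext (block_anchoredE H A n)).
  apply: bmM; last exact: bm_exceed.
  apply: (bm_blk r u n 0 (f := fun x => H x * (A x == (0%:~R)%:E)%:R)).
  by apply: bmM => //; apply: bm_bool; exact: (measurable_anchor hN hA 0).
- move=> n x; rewrite block_anchoredE normrM (@ger0_norm _ (_)%:R)// ler_wpM2r// normrM.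
  rewrite -[leRHS]mulr1; apply: ler_pM => //.
  by case: (_ == _); rewrite /= ?normr1 ?normr0.
- move=> n x y xy; rewrite /block_anchored; congr anchored; apply/funext => j.
  by rewrite !blkE subr0; case: leqP => // jr; rewrite xy.
Qed.

End Anchored.
End CovarianceSum.

(** * Exchange of the anchors over blocks *)

Lemma absz_cases (h : int) (k : nat) : `|h|%N = k -> h = k%:Z \/ h = - k%:Z.
Proof. by lia. Qed.

Section ClusterAnchors.
Context {R : realType} {d : nat} {d1 d2 : measure_display}
  {T1 : measurableType d1} {T2 : measurableType d2}
  {P : probability T1 R} {PY : probability T2 R}.
Variables (N : 'rV[R]_d -> R) (X : {RV P >-> seq_space R d})
  (Y : {RV PY >-> seq_space R d}).
Notation S := (seq_space R d).
Implicit Types (f g : (int -> 'rV[R]_d) -> R).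
Hypothesis hN : is_norm N.
Hypothesis X_stationary : stationary X.
Local Notation p := (tailp N X).
Hypothesis tailp_gt0 : forall x, 0 < p x.
Variables (r : nat -> nat) (u : nat -> R).
Hypothesis u_gt0 : forall n, 0 < u n.
Hypothesis hS : summability N X r u.
Hypothesis Y_tail : is_tail_process N X Y.
Hypothesis u_infty : u n @[n --> \oo] --> +oo.
Hypothesis r_infty : r n @[n --> \oo] --> \oo.
Local Notation w n := (p (u n)).
Local Notation exceed j a := (fun x : int -> 'rV[R]_d => (a < N (x j))%R%:R : R).
Local Notation EX f := (Ex P (fun t => f (X t))).
Local Notation EY f := (Ex PY (fun t => f (Y t))).

Implicit Types (H K : (int -> 'rV[R]_d) -> R) (A : (int -> 'rV[R]_d) -> \bar R).
Local Notation blk := (blk r u).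
Local Notation clump := (clump N r u).
Local Notation Z := (block_anchored N r u).
Local Notation crossx := (cross (P := P) X).

Lemma tame_blk n h x : tame N (r n + `|h|) (blk n h x).
Proof.
move=> j jr; rewrite blkE; case: ifP => jh; first by lia.
by rewrite norm0.
Qed.

Lemma blk_exceed n h j x : 1 < N (blk n h x j) ->
  (`|j - h| <= r n)%N /\ u n < N (x j).
Proof.
rewrite blkE; case: ifP => jh; last by rewrite norm0// ltr10.
by rewrite (scale_u_lt hN u_gt0) mul1r.
Qed.

(** Unless two exceedances are far apart, the blocks around 0 and around a
    fixed [h] contain the same exceedances, hence have the same anchors. *)
Lemma anchor_blk A n l (h : int) x : is_anchor N A -> (l + `|h| <= r n)%N ->
  u n < N (x 0) -> u n < N (x h) ->
  clump n 1 l 0 x + clump n 1 l h x < 1 ->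
  (A (blk n h x) == (h%:~R)%:E) = (A (blk n 0 x) == (h%:~R)%:E).
Proof.
move=> hA lr x0 xh cl.
have c0 := clump_ge0 N r u n 1 l 0 x; have ch := clump_ge0 N r u n 1 l h x.
apply: (anchor_local hA (@tame_blk n h x) (@tame_blk n 0 x)); last first.
  rewrite blkE subrr /= (scale_u_lt hN u_gt0) mul1r//.
move=> j; rewrite !blkE subr0.
case: (leqP `|j - h| (r n)) => jh; case: (leqP `|j| (r n)) => j0 //.
  rewrite norm0// => -[|]; last by rewrite ltr10.
  rewrite (scale_u_lt hN u_gt0) mul1r => xj.
  suff h1 : (1 : R) <= clump n 1 l h x.
    by move: cl; rewrite ltNge => /negP[]; rewrite (le_trans h1)// lerDr.
  by apply: (@clump_ge1 _ _ _ _ _ _ _ _ _ j); rewrite ?mul1r//; lia.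
rewrite norm0// => -[|]; first by rewrite ltr10.
rewrite (scale_u_lt hN u_gt0) mul1r => xj.
suff h1 : (1 : R) <= clump n 1 l 0 x.
  by move: cl; rewrite ltNge => /negP[]; rewrite (le_trans h1)// lerDl.
by apply: (@clump_ge1 _ _ _ _ _ _ _ _ _ j); rewrite ?mul1r ?subr0//; lia.
Qed.

Section Pair.
Variables (H H' : (int -> 'rV[R]_d) -> R) (A A' : (int -> 'rV[R]_d) -> \bar R).
Hypotheses (H_L : class_L N Y H) (H'_L : class_L N Y H').
Hypotheses (H'_shift : shift_invariant H').
Hypotheses (hA : is_anchor N A) (hA' : is_anchor N A').

(** Where both times exceed, the anchor and the value of [H'] on the block
    around [h] are those on the block around 0: the anchors agree by
    [anchor_blk], and both values of [H'] are close to the same test function. *)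
Lemma cross_term (h : int) (e : R) : 0 < e -> \forall n \near \oo,
  `|EX (fun x => Z H A n x * Z H' A' n (shift h x)) -
    EX (fun x => Z H A n x * (H' (blk n 0 x) *
      ((A' (blk n 0 x) == (h%:~R)%:E)%:R * exceed h (u n) x)))| <= e * w n.
Proof.
move=> e0; have [M M1 HM] := class_L_bounded H_L.
have [M' M'1 HM'] := class_L_bounded H'_L.
have M0 : 0 < M by lra.
have M'0 : 0 < M' by lra.
(* half of the error goes to the test function for H', used twice, and half to
   the far exceedances around 0 and around h *)
have e1 : 0 < e / (4 * M) by rewrite divr_gt0//; lra.
have [f [lf _ hf]] := class_L_approx hN X_stationary tailp_gt0 u_gt0 hS Y_tail
  u_infty r_infty H'_L e1.
have e2 : 0 < e / (8 * M * M') by rewrite divr_gt0// !mulr_gt0.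
have [l _ /(_ l (leqnn l)) /= hcl] :=
  clump_small hN X_stationary tailp_gt0 hS ltr01 e2.
have rl : \forall n \near \oo, (l + `|h| <= r n)%N.
  exact: (r_infty (nbhs_infty_ge (l + `|h|)%N)).
have hfh := hf h; have hf0 := hf 0.
near=> n.
have rln : (l + `|h| <= r n)%N by near: n.
have hcl' : forall h : int, EX (clump n 1 l h) <= e / (8 * M * M') * w n by near: n.
have hfh' : EX (fun x => `|H' (blk n h x) - f (scale (u n)^-1 x)| *
        (exceed 0 (u n) x * exceed h (u n) x)) <= e / (4 * M) * w n by near: n.
have hf0' : EX (fun x => `|H' (blk n 0 x) - f (scale (u n)^-1 x)| *
        (exceed 0 (u n) x * exceed 0 (u n) x)) <= e / (4 * M) * w n by near: n.
pose G1 j x := `|H' (blk n j x) - f (scale (u n)^-1 x)| *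
        (exceed 0 (u n) x * exceed j (u n) x).
pose G3 x := clump n 1 l 0 x + clump n 1 l h x.
have bH' := class_L_bm H'_L.
have [bZ _ _] := block_functional_anchored hN r u_gt0 (class_L_bm H_L) hA (ltW M0) HM.
have [bZ' _ _] := block_functional_anchored hN r u_gt0 bH' hA' (ltW M'0) HM'.
have bI j : bm (exceed j (u n) : S -> R) by exact: bm_exceed.
have bG1 j : bm (G1 j : S -> R).
  apply: bmM; last exact: bmM.
  apply: bm_norm; apply: bmB; first exact: (bm_blk r u n j bH').
  exact: (bm_scale (u n)^-1 (lcb_bm lf)).
have bG3 : bm (G3 : S -> R) by apply: bmD; exact: bm_clump.
have bL : bm (fun x : S => Z H A n x * Z H' A' n (shift h x)).
  by apply: bmM => //; exact: (bm_shift h (bZ' n)).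
have bR : bm (fun x : S => Z H A n x * (H' (blk n 0 x) *
      ((A' (blk n 0 x) == (h%:~R)%:E)%:R * exceed h (u n) x))).
  apply: bmM => //; apply: bmM; first exact: (bm_blk r u n 0 bH').
  apply: bmM => //.
  apply: (bm_blk r u n 0 (f := fun x => (A' x == (h%:~R)%:E)%:R)).
  by apply: bm_bool; exact: (measurable_anchor hN hA' h).
apply: (@le_trans _ _ (EX (fun x => M * (G1 h x + G1 0 x) + 2 * M * M' * G3 x))).
  apply: dist_Ex => [|||t].
  - exact: (bmX X bL).
  - exact: (bmX X bR).
  - apply: bmD; first by apply: bmM; [exact: bm_cst|apply: bmD; exact: (bmX X (bG1 _))].
    by apply: bmM; [exact: bm_cst|exact: (bmX X bG3)].
  move: (X t) => x; rewrite block_anchored_shift// -mulrBr normrM.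
  have G1_0 j : 0 <= G1 j x by rewrite !mulr_ge0.
  have G3_0 : 0 <= G3 x by rewrite addr_ge0// clump_ge0.
  have RHS0 : 0 <= M * (G1 h x + G1 0 x) + 2 * M * M' * G3 x.
    by rewrite addr_ge0// !mulr_ge0// ?addr_ge0//; exact: ltW.
  have [x0|x0] := ltP (u n) (N (x 0)); last first.
    rewrite block_anchoredE// [_ < _](_ : _ = false) ?mulr0 ?normr0 ?mul0r//.
    by apply/negbTE; rewrite -leNgt.
  rewrite /anchored blkE subrr /= (scale_u_lt hN u_gt0) mul1r.
  have [xh|xh] := ltP (u n) (N (x h)); last first.
    by rewrite !mulr0 subrr normr0 mulr0.
  rewrite !mulr1.
  have ZM : `|Z H A n x| <= M.
    rewrite block_anchoredE// !normrM x0 normr1 mulr1 -[leRHS]mulr1; apply: ler_pM => //.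
    by case: (_ == _); rewrite /= ?normr1 ?normr0.
  have [cl|cl] := ltP (G3 x) 1.
    rewrite (anchor_blk hA' rln x0 xh cl) -mulrBl.
    apply: (@le_trans _ _ (M * (G1 h x + G1 0 x))); last first.
      by rewrite lerDl !mulr_ge0//; exact: ltW.
    apply: ler_pM => //; rewrite /G1 x0 xh !mulr1 normrM.
    rewrite (distrC (H' (blk n 0 x))).
    apply: (@le_trans _ _ `|H' (blk n h x) - H' (blk n 0 x)|).
      by rewrite -[leRHS]mulr1 ler_wpM2l//; case: (_ == _); rewrite /= ?normr1 ?normr0.
    exact: ler_distD.
  apply: (@le_trans _ _ (M * (2 * M'))).
    apply: ler_pM => //; apply: (le_trans (ler_normB _ _)).
    have bb (b : bool) y : `|H' y * b%:R| <= M'.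
      by rewrite normrM -[leRHS]mulr1; apply: ler_pM => //; case: b;
        rewrite /= ?normr1 ?normr0.
    have -> : 2 * M' = M' + M' by ring.
    by apply: lerD; exact: bb.
  have G10 : 0 <= M * (G1 h x + G1 0 x) by rewrite mulr_ge0 ?addr_ge0// ltW.
  have : M * (2 * M') <= 2 * M * M' * G3 x.
    have -> : 2 * M * M' * G3 x = M * (2 * M') * G3 x by ring.
    by rewrite ler_peMr// !mulr_ge0// ltW.
  by move=> MG3; apply: (le_trans MG3); rewrite lerDr.
rewrite ExD; last 2 first.
- by apply: bmM; [exact: bm_cst|apply: bmD; exact: (bmX X (bG1 _))].
- by apply: bmM; [exact: bm_cst|exact: (bmX X bG3)].
rewrite (@ExZ _ _ _ _ _ (fun t => G1 h (X t) + G1 0 (X t))); last first.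
  by apply: bmD; exact: (bmX X (bG1 _)).
rewrite (@ExZ _ _ _ _ _ (fun t => G3 (X t))); last exact: (bmX X bG3).
rewrite ExD; try exact: (bmX X (bG1 _)).
rewrite /G3 (@ExD _ _ _ _ (fun t => clump n 1 l 0 (X t)));
  try exact: (bmX X (bm_clump hN _ _ _ _ _ _)).
apply: (@le_trans _ _ (M * (e / (4 * M) * w n + e / (4 * M) * w n) +
   2 * M * M' * (e / (8 * M * M') * w n + e / (8 * M * M') * w n))).
  apply: lerD; apply: ler_wpM2l; rewrite ?mulr_ge0//; try exact: ltW.
    exact: (lerD hfh' hf0').
  by apply: lerD; exact: hcl'.
rewrite le_eqVlt; apply/orP; left; apply/eqP.
by field; rewrite !gt_eqF.
Unshelve. all: by end_near. Qed.

(** Summing over the position [h] of the second anchor removes it: a cluster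
    has exactly one anchor, and it lies within [m] of time 0 unless two
    exceedances are far apart. *)
Lemma cross_anchor (e : R) : 0 < e ->
  \forall m \near \oo, \forall n \near \oo,
   `|crossx (Z H A) (Z H' A') n m - EX (Z (fun x => H x * H' x) A n)| <= e * w n.
Proof.
move=> e0; have [M M1 HM] := class_L_bounded H_L.
have [M' M'1 HM'] := class_L_bounded H'_L.
have M0 : 0 < M by lra.
have M'0 : 0 < M' by lra.
have e1 : 0 < e / 2 / (M * M') by rewrite !divr_gt0// mulr_gt0.
have := clump_small hN X_stationary tailp_gt0 hS ltr01 e1.
apply: filterS => m hcl.
have e2 : 0 < e / 2 / (2 * m%:R + 1) by rewrite !divr_gt0// ltr_wpDl.
pose G n (h : int) x := Z H A n x * (H' (blk n 0 x) *
      ((A' (blk n 0 x) == (h%:~R)%:E)%:R * exceed h (u n) x)).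
have near_all (k : nat) : \forall n \near \oo, forall h : int, (`|h| <= k)%N ->
    `|EX (fun x => Z H A n x * Z H' A' n (shift h x)) - EX (G n h)|
      <= e / 2 / (2 * m%:R + 1) * w n.
  elim: k => [|k IH].
    have := cross_term 0 e2; apply: filterS => n h0 h hk.
    by move: hk; rewrite leqn0 absz_eq0 => /eqP ->.
  have h1 := cross_term k.+1%:Z e2; have h2 := cross_term (- k.+1%:Z) e2.
  apply: filter_app IH; apply: filter_app h1; apply: filterS h2 => n h2 h1 IH h.
  rewrite leq_eqVlt => /orP[/eqP hk|]; last by rewrite ltnS; exact: IH.
  by have [->|->] := absz_cases hk.
have na := near_all m.
near=> n.
have hcl' : forall h : int, EX (clump n 1 m h) <= e / 2 / (M * M') * w n by near: n.
have na' : forall h : int, (`|h| <= m)%N ->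
    `|EX (fun x => Z H A n x * Z H' A' n (shift h x)) - EX (G n h)|
      <= e / 2 / (2 * m%:R + 1) * w n by near: n.
have bH' := class_L_bm H'_L; have bH := class_L_bm H_L.
have [bZ _ _] := block_functional_anchored hN r u_gt0 bH hA (ltW M0) HM.
have bG h : bm (G n h : S -> R).
  apply: bmM => //; apply: bmM; first exact: (bm_blk r u n 0 bH').
  apply: bmM; last exact: bm_exceed.
  apply: (bm_blk r u n 0 (f := fun x => (A' x == (h%:~R)%:E)%:R)).
  by apply: bm_bool; exact: (measurable_anchor hN hA' h).
have EG : symsum m (fun h => EX (G n h)) = EX (fun x => symsum m (fun h => G n h x)).
  rewrite /symsum ExD; last 2 first.
  - exact: (bmX X (bG 0)).
  - apply: (@bm_sum _ _ _ _ _ _ (fun h t => G n h%:Z (X t) + G n (- h%:Z) (X t))) => h.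
    by apply: bmD; exact: (bmX X (bG _)).
  congr (_ + _); rewrite (Ex_sum P _ _
    (f := fun h t => G n h%:Z (X t) + G n (- h%:Z) (X t))); last first.
    by move=> h; apply: bmD; exact: (bmX X (bG _)).
  by apply: eq_bigr => h _; rewrite ExD//; exact: (bmX X (bG _)).
have bsG : bm (fun x : S => symsum m (fun h => G n h x)).
  apply: bmD => //.
  apply: (@bm_sum _ _ _ _ _ _ (fun h (x : S) => G n h%:Z x + G n (- h%:Z) x)) => h.
  exact: bmD.
have q1 := symsum_dist na'; rewrite EG in q1.
have bHH : bm ((fun x => H x * H' x) : S -> R) by exact: bmM.
have MM0 : 0 <= M * M' by rewrite mulr_ge0// ltW.
have HHM x : `|H x * H' x| <= M * M' by rewrite normrM ler_pM.
have [bZZ _ _] := block_functional_anchored hN r u_gt0 bHH hA MM0 HHM.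
have q2 : `|EX (fun x => symsum m (fun h => G n h x)) -
    EX (Z (fun x => H x * H' x) A n)| <= e / 2 * w n.
  have -> : e / 2 * w n = M * M' * (e / 2 / (M * M') * w n).
    by field; rewrite !gt_eqF.
  apply: (@le_trans _ _ (M * M' * EX (clump n 1 m 0))); last by rewrite ler_wpM2l.
  rewrite -ExZ; last exact: (bmX X (bm_clump hN _ _ _ _ _ _)).
  apply: dist_Ex => [|||t].
  - exact: (bmX X bsG).
  - exact: (bmX X (bZZ n)).
  - by apply: bmM; [exact: bm_cst|exact: (bmX X (bm_clump hN _ _ _ _ _ _))].
  move: (X t) => x.
  have c0 : 0 <= clump n 1 m 0 x by exact: clump_ge0.
  have RHS0 : 0 <= M * M' * clump n 1 m 0 x by rewrite mulr_ge0.
  have [x0|x0] := ltP (u n) (N (x 0)); last first.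
    have I0 : exceed 0 (u n) x = 0 by rewrite ltNge x0.
    have G0 h : G n h x = 0 by rewrite /G block_anchoredE// I0 mulr0 mul0r.
    rewrite /symsum G0 big1 => [|h _]; last by rewrite !G0 addr0.
    by rewrite block_anchoredE// I0 mulr0 add0r subr0 normr0.
  have ex1 : exists j, 1 < N (blk n 0 x j).
    by exists 0; rewrite blkE subrr /= (scale_u_lt hN u_gt0) mul1r.
  have [i i1 Ai] := anchor_ex hA' (@tame_blk n 0 x) ex1.
  have [ir xi] := blk_exceed i1; rewrite subr0 in ir.
  have Gi h : h != i -> G n h x = 0.
    move=> hi; rewrite /G Ai; case: eqP => [/anchor_inj ih|_]; last by rewrite mul0r !mulr0.
    by rewrite ih eqxx in hi.
  rewrite (symsum_delta m Gi); case: (leqP `|i| m) => im.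
    rewrite /G Ai eqxx xi mulr1 mulr1 !block_anchoredE// x0.
    by rewrite !mulr1 mulrAC subrr normr0.
  rewrite sub0r normrN -[leLHS]mulr1; apply: ler_pM => //.
    rewrite block_anchoredE// x0 mulr1 normrM -[leRHS]mulr1; apply: ler_pM => //.
    by case: (_ == _); rewrite /= ?normr1 ?normr0.
  by apply: (@clump_ge1 _ _ _ _ _ _ _ _ _ i); rewrite ?subr0 ?mul1r.
have q3 := le_trans (ler_distD (EX (fun x => symsum m (fun h => G n h x))) _ _) (lerD q1 q2).
apply: (le_trans q3); rewrite le_eqVlt; apply/orP; left; apply/eqP.
by field; rewrite gt_eqF// ltr_wpDl.
Unshelve. all: by end_near. Qed.

End Pair.

(** Stationarity exchanges the lags [h] and [- h]. *)
Lemma cross_sym H H' A A' n m : class_L N Y H -> class_L N Y H' ->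
  is_anchor N A -> is_anchor N A' ->
  crossx (Z H A) (Z H' A') n m = crossx (Z H' A') (Z H A) n m.
Proof.
move=> LH LH' hA hA'; rewrite /cross -symsum_opp; congr symsum.
have [M M1 HM] := class_L_bounded LH; have [M' M'1 HM'] := class_L_bounded LH'.
have M0 : 0 <= M by lra.
have M'0 : 0 <= M' by lra.
have [bZ _ _] := block_functional_anchored hN r u_gt0 (class_L_bm LH) hA M0 HM.
have [bZ' _ _] := block_functional_anchored hN r u_gt0 (class_L_bm LH') hA' M'0 HM'.
apply/funext => h.
have b : bm (fun x : S => Z H A n x * Z H' A' n (shift (- h) x)).
  by apply: bmM => //; exact: (bm_shift (- h) (bZ' n)).
rewrite -(Ex_shift X_stationary h b); congr Ex; apply/funext => t.
rewrite shift_shift addNr mulrC; congr (Z H' A' n _ * _).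
by apply/funext => j; rewrite /shift addr0.
Qed.

(** Taking [H' = 1] in [cross_anchor] gives the mean for [A], taking [H = 1]
    gives the mean for [A'], and the cross moments are the same by
    [cross_sym]. A direct passage to the limit is blocked for the first
    maximum, because ties make its indicator discontinuous. *)
Lemma anchor_exchange K A A' : class_L N Y K -> shift_invariant K ->
  is_anchor N A -> is_anchor N A' -> forall e : R, 0 < e -> \forall n \near \oo,
  `|EX (Z K A n) - EX (Z K A' n)| <= e * w n.
Proof.
move=> LK Ks hA hA' e e0; have L1 := class_L_cst Y hN 1.
have s1 : shift_invariant (fun _ : int -> 'rV[R]_d => 1 : R) by [].
have e2 : 0 < e / 2 by lra.
have c1 := cross_anchor LK L1 s1 hA hA' e2.
have c2 := cross_anchor L1 LK Ks hA' hA e2.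
near \oo => m.
have h1 : \forall n \near \oo, `|crossx (Z K A) (Z (fun=> 1) A') n m -
    EX (Z (fun x => K x * 1) A n)| <= e / 2 * w n by near: m.
have h2 : \forall n \near \oo, `|crossx (Z (fun=> 1) A') (Z K A) n m -
    EX (Z (fun x => 1 * K x) A' n)| <= e / 2 * w n by near: m.
apply: filterS2 h1 h2 => n.
have -> : (fun x => K x * 1) = K by apply/funext => x; rewrite mulr1.
have -> : (fun x => 1 * K x) = K by apply/funext => x; rewrite mul1r.
rewrite (cross_sym n m L1 LK hA' hA) => h1 h2; rewrite distrC in h1.
have h3 := le_trans (ler_distD (crossx (Z K A) (Z (fun=> 1) A') n m) _ _) (lerD h1 h2).
by apply: (le_trans h3); rewrite -mulrDl -splitr.
Unshelve. all: by end_near. Qed.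

(** * The limit for the first exceedance *)

Variables (alpha : R) (alpha_gt0 : 0 < alpha).
Hypothesis ratio : forall t : R, 0 < t ->
  p (t * x) / p x @[x --> +oo] --> t `^ (- alpha).

Lemma good_compl f : good Y f -> good Y (fun x => 1 - f x).
Proof.
move=> [bf af]; split; first by apply: bmB => //; exact: bm_cst.
move=> e e0; have [h [b [lh lb fh Eb]]] := af _ e0.
exists (fun x => 1 - h x), b; split => //.
  by apply: lcbB => //; exact: lcb_cst.
by move=> x; rewrite opprB addrC addrA subrK distrC.
Qed.

(** On an exceedance at 0, an approximation of the event that it is the first
    one, by a function of finitely many coordinates. *)
Definition quiet (l : nat) (x : int -> 'rV[R]_d) : R :=
  \prod_(k < l) (1 - exceed (- k.+1%:Z) 1 x).

Lemma quiet1 l x : (forall j, j < 0 -> (`|j| <= l)%N -> N (x j) <= 1) ->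
  quiet l x = 1.
Proof.
move=> h; apply: big1 => k _; rewrite ltNge h/= ?subr0//.
Qed.

Lemma quiet0 l j x : j < 0 -> (`|j| <= l)%N -> 1 < N (x j) -> quiet l x = 0.
Proof.
move=> j0 jl xj; have kl : (`|j|.-1 < l)%N by lia.
rewrite /quiet (bigD1 (Ordinal kl))//=.
have -> : - `|j|.-1.+1%:Z = j by lia.
by rewrite xj subrr mul0r.
Qed.

Lemma good_quiet l : good Y (quiet l).
Proof.
elim: l => [|l IH].
  rewrite (_ : quiet 0 = fun=> 1); first by apply: good_lcb; exact: lcb_cst.
  by apply/funext => x; rewrite /quiet big_ord0.
rewrite (_ : quiet l.+1 = fun x => quiet l x * (1 - exceed (- l.+1%:Z) 1 x)).
  apply: goodM => //; apply/good_compl/good_exceed => //.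
  exact: (tail_process_noatom hN Y_tail tailp_gt0 alpha_gt0 ratio).
by apply/funext => x; rewrite /quiet big_ord_recr.
Qed.

Lemma quiet_01 l x : 0 <= quiet l x <= 1.
Proof.
apply/andP; split.
  by apply: prodr_ge0 => k _; case: (_ < _); rewrite /= ?subrr ?subr0.
apply: prodr_ile1 => k _.
by case: (_ < _); rewrite /= ?subrr ?subr0 ?lexx ?ler01.
Qed.

Local Notation first0 := (fun x => (anchor1 N x == ((0 : int)%:~R)%:E)%R%:R : R).

Lemma first0_quiet x : 1 < N (x 0) -> quiet l x @[l --> \oo] --> first0 x.
Proof.
move=> x0; rewrite /=; case: eqP => [/anchor1P[_ h]|h] /=.
  apply: cvg_near_cst; apply: nearW => l; apply: quiet1 => j j0 _.
  exact: h.
have [j [j0 xj]] : exists j, j < 0 /\ 1 < N (x j).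
  apply: contrapT => h'; apply: h; apply/anchor1P; split => // j j0.
  by rewrite leNgt; apply/negP => xj; apply: h'; exists j.
apply: cvg_near_cst; exists `|j|%N => // l /= jl.
exact: (quiet0 j0 jl xj).
Qed.

Lemma first0_blk n l x : (l <= r n)%N -> u n < N (x 0) ->
  `|first0 (blk n 0 x) - quiet l (scale (u n)^-1 x)| <= clump n 1 l 0 x.
Proof.
move=> lr x0.
have bE j : (`|j| <= r n)%N -> blk n 0 x j = scale (u n)^-1 x j.
  by move=> jr; rewrite blkE subr0 jr.
have b0 : 1 < N (blk n 0 x 0) by rewrite bE// (scale_u_lt hN u_gt0) mul1r.
have c0 := clump_ge0 N r u n 1 l 0 x.
have [[j [j0 jl xj]]|h] := pselect (exists j, [/\ j < 0, (`|j| <= l)%N &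
    1 < N (scale (u n)^-1 x j)]).
  rewrite (quiet0 j0 jl xj) (_ : _ == _ = false) ?subrr ?normr0//.
  apply/eqP => /anchor1P[_ /(_ _ j0)]; rewrite bE; last exact: leq_trans lr.
  by rewrite leNgt xj.
rewrite quiet1; last first.
  move=> j j0 jl; rewrite leNgt; apply/negP => xj; apply: h.
  by exists j.
rewrite /=; case: eqP => [_|h']; first by rewrite subrr normr0.
rewrite sub0r normrN normr1.
have [j [j0 xj]] : exists j, j < 0 /\ 1 < N (blk n 0 x j).
  apply: contrapT => h''; apply: h'; apply/anchor1P; split => // j j0.
  by rewrite leNgt; apply/negP => xj; apply: h''; exists j.
have [jr xuj] := blk_exceed xj; rewrite subr0 in jr.
apply: (@clump_ge1 _ _ _ _ _ _ _ _ _ j); rewrite ?subr0 ?mul1r//.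
rewrite ltnNge; apply/negP => jl; apply: h; exists j; split => //.
by rewrite -bE.
Qed.

(** The Pareto tail equals 1 at [t = 1]. *)
Lemma ae_exceed0 : {ae PY, forall t, 1 < N (Y t 0)}.
Proof.
have E1 : EY (exceed 0 1) = 1.
  rewrite (tail_process_pareto hN Y_tail tailp_gt0 ratio)//.
  by rewrite powR1.
have mE : measurable [set t | 1 < N (Y t 0)].
  apply: measurable_setb; exact: measurable_exceed.
exists (~` [set t | 1 < N (Y t 0)]); split => //; first exact: measurableC.
rewrite probability_setC//.
have : prob PY [set t | 1 < N (Y t 0)] = 1.
  rewrite -[RHS]E1 Ex_bool//; apply: measurable_fun_ltr => //.
  exact: (measurableT_comp (measurable_norm_coord hN 0) (measurable_funPT Y)).
rewrite /prob => pE.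
have <- : (fine (PY [set t | 1 < N (Y t 0)]))%:E = PY [set t | 1 < N (Y t 0)].
  by rewrite fineK// fin_num_measure.
by rewrite pE subee.
Qed.

(** Being the first exceedance is approximated by [quiet l], uniformly over
    the blocks because exceedances at distance more than [l] are rare, and
    [quiet l] is continuous off a null set since the norms of the tail process
    have no atom at 1. *)
Lemma anchor1_limit K : class_L N Y K ->
  EX (Z K (anchor1 N) n) / w n @[n --> \oo] --> EY (fun x => K x * first0 x).
Proof.
move=> LK; have [M M1 KM] := class_L_bounded LK.
have bK := class_L_bm LK.
have hA : is_anchor N (anchor1 N) by constructor 2.
have bF : bm (first0 : S -> R).
  by apply: bm_bool; exact: (measurable_anchor hN hA 0).
have F01 x : `|first0 x| <= 1 by case: (_ == _); rewrite /= ?normr1 ?normr0.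
have q1 l x : `|quiet l x| <= 1.
  by have /andP[q0 ?] := quiet_01 l x; rewrite ger0_norm.
have M0 : 0 < M by lra.
have lim1 : EY (fun x => K x * quiet l x) @[l --> \oo] -->
    EY (fun x => K x * first0 x).
  apply: (@Ex_bounded_cvg _ _ _ PY (fun l t => K (Y t) * quiet l (Y t)) _ M).
  - move=> l; have [//] : bm (fun t => K (Y t) * quiet l (Y t)).
    by apply: (bmY Y (f := fun x => K x * quiet l x)); apply: bmM => //; have [] := good_quiet l.
  - have [//] : bm (fun t => K (Y t) * first0 (Y t)).
    by apply: (bmY Y (f := fun x => K x * first0 x)); apply: bmM.
  - by move=> l t; rewrite normrM -[leRHS]mulr1; apply: ler_pM.
  - apply: filterS ae_exceed0 => t t0; apply: cvgM; first exact: cvg_cst.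
    exact: first0_quiet.
apply/cvgrPdist_le => e e0.
have e4 : 0 < e / 5 by lra.
have e4M : 0 < e / 5 / M by rewrite divr_gt0.
have [f [lf Ef /(_ 0) hf]] := class_L_approx hN X_stationary tailp_gt0 u_gt0 hS Y_tail
  u_infty r_infty LK e4.
have hcl := clump_small hN X_stationary tailp_gt0 hS ltr01 e4M.
have /cvgrPdist_le/(_ _ e4) near1 := lim1.
near \oo => l.
have l1 : `|EY (fun x => K x * first0 x) - EY (fun x => K x * quiet l x)| <= e / 5.
  by near: l.
have hcl' : \forall n \near \oo, forall h : int, EX (clump n 1 l h) <= e / 5 / M * w n.
  by near: l.
have gfq : good Y (fun x => f x * quiet l x).
  by apply: goodM; [exact: good_lcb|exact: good_quiet].
have bq : bm (quiet l : S -> R) by have [] := good_quiet l.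
have bf := lcb_bm lf.
have l2 : `|EY (fun x => K x * quiet l x) - EY (fun x => f x * quiet l x)| <= e / 5.
  apply: le_trans Ef; apply: dist_Ex => [|||t].
  - by apply: (bmY Y (f := fun x => K x * quiet l x)); apply: bmM.
  - by apply: (bmY Y (f := fun x => f x * quiet l x)); apply: bmM.
  - by apply: (bmY Y (f := fun x => `|K x - f x|)); apply: bm_norm; apply: bmB.
  - by rewrite -mulrBl normrM -[leRHS]mulr1 ler_wpM2l.
have cv : condE N X (u n) (fun x => f x * quiet l x) @[n --> \oo] -->
    EY (fun x => f x * quiet l x).
  exact: (cvg_comp _ _ u_infty (good_cvg hN Y_tail tailp_gt0 gfq)).
have /cvgrPdist_le/(_ _ e4) near3 := cv.
have lr : \forall n \near \oo, (l <= r n)%N.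
  exact: (r_infty (nbhs_infty_ge l)).
near=> n.
have l3 : `|EY (fun x => f x * quiet l x) -
   condE N X (u n) (fun x => f x * quiet l x)| <= e / 5 by near: n.
have lrn : (l <= r n)%N by near: n.
have hcln : forall h : int, EX (clump n 1 l h) <= e / 5 / M * w n by near: n.
have hfn : EX (fun x => `|K (blk n 0 x) - f (scale (u n)^-1 x)| *
        (exceed 0 (u n) x * exceed 0 (u n) x)) <= e / 5 * w n by near: n.
pose G1 x := `|K (blk n 0 x) - f (scale (u n)^-1 x)| *
        (exceed 0 (u n) x * exceed 0 (u n) x).
have bI : bm (exceed 0 (u n) : S -> R) by exact: bm_exceed.
have bG1 : bm (G1 : S -> R).
  apply: bmM; last exact: bmM.
  apply: bm_norm; apply: bmB; first exact: (bm_blk r u n 0 bK).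
  exact: (bm_scale (u n)^-1 bf).
have bfq : bm (fun x : S => f (scale (u n)^-1 x) * quiet l (scale (u n)^-1 x) *
    exceed 0 (u n) x).
  by apply: bmM => //; exact: (bm_scale (u n)^-1 (bmM bf bq)).
have [bZ _ _] := block_functional_anchored hN r u_gt0 bK hA (ltW M0) KM.
have l4 : `|condE N X (u n) (fun x => f x * quiet l x) -
    EX (Z K (anchor1 N) n) / w n| <= e / 5 + e / 5.
  rewrite /condE -mulrBl normrM [X in _ * X]ger0_norm ?invr_ge0 ?tailp_ge0//.
  rewrite ler_pdivrMr//.
  apply: (@le_trans _ _ (EX (fun x => M * clump n 1 l 0 x + G1 x))).
    rewrite distrC; apply: dist_Ex => [|||t].
    - exact: (bmX X (bZ n)).
    - exact: (bmX X bfq).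
    - apply: bmD; last exact: (bmX X bG1).
      by apply: bmM; [exact: bm_cst|exact: (bmX X (bm_clump hN _ _ _ _ _ _))].
    move: (X t) => x.
    have c0 := clump_ge0 N r u n 1 l 0 x.
    have g0 : 0 <= G1 x by rewrite !mulr_ge0.
    have [x0|x0] := ltP (u n) (N (x 0)); last first.
      have I0 : exceed 0 (u n) x = 0 by rewrite ltNge x0.
      rewrite block_anchoredE// ltNge x0 /= !mulr0 subrr normr0 addr_ge0// mulr_ge0//.
      exact: ltW.
    rewrite block_anchoredE// x0 !mulr1.
    have -> : K (blk n 0 x) * first0 (blk n 0 x) -
       f (scale (u n)^-1 x) * quiet l (scale (u n)^-1 x) =
       K (blk n 0 x) * (first0 (blk n 0 x) - quiet l (scale (u n)^-1 x)) +
       (K (blk n 0 x) - f (scale (u n)^-1 x)) * quiet l (scale (u n)^-1 x) by ring.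
    rewrite (le_trans (ler_normD _ _))// !normrM lerD//.
      by apply: ler_pM => //; exact: first0_blk.
    by rewrite /G1 x0 !mulr1 -[leRHS]mulr1 ler_wpM2l.
  rewrite ExD; last 2 first.
  - by apply: bmM; [exact: bm_cst|exact: (bmX X (bm_clump hN _ _ _ _ _ _))].
  - exact: (bmX X bG1).
  rewrite ExZ; last exact: (bmX X (bm_clump hN _ _ _ _ _ _)).
  rewrite mulrDl lerD//.
  apply: (@le_trans _ _ (M * (e / 5 / M * w n))); first by rewrite ler_wpM2l// ltW.
  rewrite le_eqVlt; apply/orP; left; apply/eqP.
  by field; rewrite gt_eqF.
have s1 := le_trans (ler_distD _ _ _) (lerD l1 l2).
have s2 := le_trans (ler_distD _ _ _) (lerD s1 l3).
have s3 := le_trans (ler_distD _ _ _) (lerD s2 l4).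
by apply: (le_trans s3); rewrite le_eqVlt; apply/orP; left; apply/eqP; field.
Unshelve. all: by end_near. Qed.

(** * Exchange of the anchors over the tail process *)

Local Notation at_ A i := (fun x => (A x == ((i : int)%:~R)%:E)%R%:R : R).

Lemma bm_at A i : is_anchor N A -> bm (at_ A i : S -> R).
Proof. by move=> hA; apply: bm_bool; exact: (measurable_anchor hN hA i). Qed.

(** Almost surely the tail process vanishes at infinity and exceeds 1 at time
    0, so each anchor is attained at exactly one exceedance. *)
Lemma sum_over_anchors K A A' : bm (K : S -> R) -> is_anchor N A -> is_anchor N A' ->
  symsum m (fun h => EY (fun x => K x * at_ A 0 x * at_ A' h x * exceed h 1 x))
    @[m --> \oo] --> EY (fun x => K x * at_ A 0 x).
Proof.
move=> bK hA hA'.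
pose G h x := K x * at_ A 0 x * at_ A' h x * exceed h 1 x.
have bG h : bm (G h : S -> R).
  by do 2 (apply: bmM; last by [exact: bm_at|exact: bm_exceed]); apply: bmM => //; exact: bm_at.
have bs m : bm (fun x : S => symsum m (fun h => G h x)).
  apply: bmD => //.
  apply: (@bm_sum _ _ _ _ _ _ (fun h (x : S) => G h%:Z x + G (- h%:Z) x)) => h.
  exact: bmD.
have EG m : symsum m (fun h => EY (G h)) = EY (fun x => symsum m (fun h => G h x)).
  rewrite /symsum ExD; last 2 first.
  - exact: (bmY Y (bG 0)).
  - apply: (@bm_sum _ _ _ _ _ _ (fun h t => G h%:Z (Y t) + G (- h%:Z) (Y t))) => h.
    by apply: bmD; exact: (bmY Y (bG _)).
  congr (_ + _); rewrite (Ex_sum PY _ _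
    (f := fun h t => G h%:Z (Y t) + G (- h%:Z) (Y t))); last first.
    by move=> h; apply: bmD; exact: (bmY Y (bG _)).
  by apply: eq_bigr => h _; rewrite ExD//; exact: (bmY Y (bG _)).
rewrite (_ : (fun m => _) = (fun m => EY (fun x => symsum m (fun h => G h x)))); last first.
  by apply/funext => m; rewrite -EG.
have [_ [M KM]] := bK.
have M0 : 0 <= M by apply: le_trans (KM (fun=> 0)).
have G0M h x : `|G h x| <= M.
  rewrite /G !normrM -[leRHS]mulr1 -[leRHS]mulr1 -[leRHS]mulr1.
  have b1 (b : bool) : `|b%:R : R| <= 1 by case: b; rewrite /= ?normr1 ?normr0.
  by apply: ler_pM => //; apply: ler_pM => //; apply: ler_pM.
have symG x i : (forall h, h != i -> G h x = 0) -> forall m,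
    symsum m (fun h => G h x) = if (`|i| <= m)%N then G i x else 0.
  by move=> Gi m; rewrite (symsum_delta m Gi).
have uniq_at x h i : A' x = (i%:~R)%:E -> h != i -> G h x = 0.
  move=> Ai hi; rewrite /G /= [A' x == _](_ : _ = false) ?mulr0 ?mul0r//.
  by apply/eqP; rewrite Ai => /anchor_inj ih; rewrite ih eqxx in hi.
apply: (@Ex_bounded_cvg _ _ _ PY (fun m t => symsum m (fun h => G h (Y t))) _ M).
- by move=> m; have [] := bmY Y (bs m).
- by have [] := bmY Y (f := fun x => K x * at_ A 0 x) (bmM bK (bm_at 0 hA)).
- move=> m t; move: (Y t) => x.
  have [[i Ai]|h] := pselect (exists i : int, A' x = (i%:~R)%:E).
    rewrite (symG x i); last by move=> h hi; exact: (uniq_at x h i Ai hi).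
    by case: ifP => // _; rewrite normr0.
  rewrite (symG x 0); last first.
    move=> k _; rewrite /G /= [_ == (k%:~R)%:E](_ : _ = false) ?mulr0 ?mul0r//.
    by apply/eqP => Ak; apply: h; exists k.
  by rewrite leq0n.
have tv := tail_vanish hN X_stationary tailp_gt0 u_gt0 hS Y_tail u_infty r_infty.
have e0 := ae_exceed0.
apply: filterS2 e0 tv => t; move: (Y t) => x x0 /(_ 1 ltr01)[l0 xl].
have tx : tame N l0 x by move=> j jl; apply: xl; exact: ltnW.
have [i xi Ai] := anchor_ex hA' tx (ex_intro _ 0 x0).
apply: cvg_near_cst; exists `|i|%N => // m /= im.
rewrite (symG x i); last by move=> h hi; exact: (uniq_at x h i Ai hi).
by rewrite im /G /= Ai eqxx xi !mulr1.
Qed.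

(** The time change formula turns the term at lag [h] for one pair of anchors
    into the term at lag [- h] for the exchanged pair; then both sums over
    lags are compared. *)
Lemma tail_anchor_exchange K A A' : bm (K : S -> R) -> shift_invariant K ->
  is_anchor N A -> is_anchor N A' ->
  EY (fun x => K x * at_ A 0 x) = EY (fun x => K x * at_ A' 0 x).
Proof.
move=> bK Ks hA hA'.
have l1 := sum_over_anchors bK hA hA'; have l2 := sum_over_anchors bK hA' hA.
apply: (cvg_unique _ l1) => //.
rewrite (_ : (fun m => _) = (fun m => symsum m (fun h =>
  EY (fun x => K x * at_ A' 0 x * at_ A h x * exceed h 1 x)))) //.
apply/funext => m; rewrite -symsum_opp; congr symsum; apply/funext => h.
have bg : bm ((fun x => K x * at_ A 0 x * at_ A' (- h) x) : S -> R).
  by apply: bmM; [apply: bmM => //|]; exact: bm_at.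
rewrite (tail_process_time_change hN X_stationary Y_tail tailp_gt0 alpha_gt0 ratio _ bg).
rewrite opprK; congr Ex; apply/funext => t; move: (Y t) => x /=.
rewrite Ks (anchor_shift hA) (anchor_shift hA') add0r addNr.
by rewrite -!mulrA; congr (_ * _); rewrite mulrCA.
Qed.

End ClusterAnchors.

(** * The Pareto distribution *)

Section ParetoDensity.
Context {R : realType} (alpha : R) (alpha_gt0 : 0 < alpha).
Local Notation mu := (@lebesgue_measure R).

Definition pareto_pdf (x : R) : R :=
  alpha * x `^ (- alpha - 1) * (1 < x)%R%:R.

Definition pareto_tail (x : R) : R := Num.max 1 x `^ (- alpha).

Lemma pareto_pdf_ge0 x : 0 <= pareto_pdf x.
Proof. by rewrite /pareto_pdf !mulr_ge0// ?powR_ge0// ltW. Qed.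

Lemma measurable_pareto_pdf : measurable_fun setT pareto_pdf.
Proof.
apply: measurable_funM.
  by apply: measurable_funM; [exact: measurable_cst|exact: measurable_powR].
have [//] : bm (fun x : R => (1 < x)%R%:R : R).
by apply: bm_bool; exact: measurable_fun_ltr.
Qed.

Lemma powRN_cvg0 : x `^ (- alpha) @[x --> +oo] --> (0 : R).
Proof.
apply/cvgrPdist_le => e e0; near=> x.
have x0 : 0 < x by near: x; exact: nbhs_pinfty_gt.
have xe : (e^-1) `^ (alpha^-1) <= x.
  by near: x; apply: nbhs_pinfty_ge; rewrite num_real.
rewrite sub0r normrN ger0_norm ?powR_ge0// powRN.
rewrite -[leRHS]invrK lef_pV2 ?posrE ?invr_gt0 ?powR_gt0//.
have -> : e^-1 = ((e^-1) `^ (alpha^-1)) `^ alpha.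
  by rewrite -powRrM mulVf ?gt_eqF// powRr1// invr_ge0 ltW.
by rewrite ge0_ler_powR// ?nnegrE ?powR_ge0// ltW.
Unshelve. all: by end_near. Qed.

Lemma integral_powR_tail (t : R) : 0 < t ->
  (\int[mu]_(x in `[t, +oo[) (alpha * x `^ (- alpha - 1))%:E =
   (t `^ (- alpha))%:E)%E.
Proof.
move=> t0.
rewrite (@ge0_continuous_FTC2y _ _ (fun x => - (x `^ (- alpha))) _ 0)//.
- by rewrite EFinN oppeK add0e.
- by move=> x _; rewrite mulr_ge0 ?powR_ge0// ltW.
- apply: continuous_in_subspaceT => x; rewrite inE/= in_itv/= andbT => tx.
  apply: cvgM; first exact: cvg_cst.
  by apply: continuous_powR; exact: lt_le_trans tx.
- by rewrite -oppr0; apply: cvgN; exact: powRN_cvg0.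
- move=> x tx; have x0 := lt_trans t0 tx.
  by apply: derivableN; apply: derivable_powR; rewrite in_itv/= andbT.
- apply: cvgN; apply/cvg_at_right_filter; exact: continuous_powR.
- move=> x; rewrite in_itv/= andbT => tx; have x0 := lt_trans t0 tx.
  rewrite derive1N; last by apply: derivable_powR; rewrite in_itv/= andbT.
  by rewrite powR_derive1 ?in_itv/= ?andbT// mulNr opprK.
Qed.

Lemma integral_pareto_tail (t : R) :
  (\int[mu]_(x in `]t, +oo[) (pareto_pdf x)%:E = (pareto_tail t)%:E)%E.
Proof.
set s := Num.max 1 t.
have s0 : 0 < s by rewrite lt_max ltr01.
rewrite -integral_powR_tail// -integral_itv_obnd_cbnd; last first.
  apply: measurable_funTS; apply/measurable_EFinP; apply: measurable_funM.
    exact: measurable_cst.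
  exact: measurable_powR.
rewrite integral_mkcond [RHS]integral_mkcond; apply: eq_integral => x _.
rewrite !patchE !mem_setE !in_itv/= !andbT /s gt_max /pareto_pdf.
by case: (t < x); case: (1 < x); rewrite /= ?mulr1 ?mulr0.
Qed.

Lemma integrable_pareto : mu.-integrable setT (fun x => (pareto_pdf x)%:E).
Proof.
apply/integrableP; split.
  by apply/measurable_EFinP; exact: measurable_pareto_pdf.
under eq_integral do rewrite gee0_abs ?lee_fin ?pareto_pdf_ge0//.
rewrite (_ : (\int[mu]_x (pareto_pdf x)%:E)%E =
  (\int[mu]_(x in `]1%R, +oo[) (pareto_pdf x)%:E)%E).
  by rewrite integral_pareto_tail ltry.
rewrite [RHS]integral_mkcond; apply: eq_integral => x _.
rewrite patchE mem_setE in_itv/= andbT /pareto_pdf.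
by case: (1 < x); rewrite // mulr0.
Qed.

End ParetoDensity.

(** The right half-lines generate the Borel sets and are stable under
    intersection. *)
Lemma measure_unique_ray {R : realType}
    (m1 m2 : {measure set (measurableTypeR R) -> \bar R}) :
  (forall t : R, m1 `]t, +oo[%classic = m2 `]t, +oo[%classic) ->
  (m1 setT < +oo)%E ->
  forall A : set (measurableTypeR R), measurable A -> m1 A = m2 A.
Proof.
move=> m12 m1oo A mA; apply: (@measure_unique _ R (measurableTypeR R)
  (@RGenOInfty.G R) (fun k => `](- k%:R : R), +oo[%classic)) => //.
- exact: RGenOInfty.measurableE.
- move=> _ _ [x ->] [y ->]; exists (Num.max x y).
  by apply/seteqP; split => z /=; rewrite !in_itv/= !andbT gt_max;
    [case=> -> ->|case/andP].
- by move=> k; exists (- k%:R).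
- apply/seteqP; split => // x _; exists (Num.bound `|x|) => //=.
  rewrite in_itv/= andbT ltrNl.
  by rewrite (le_lt_trans _ (archi_boundP (normr_ge0 x)))// -normrN ler_norm.
- by move=> _ [x ->].
- by move=> k; apply: le_lt_trans m1oo; apply: le_measure; rewrite ?inE.
Qed.

(** * Polar coordinates *)

Section PolarLaw.
Context {R : realType} {dT dS : measure_display} {T : measurableType dT}
  {S : measurableType dS} (P : probability T R).
Variables (alpha : R) (alpha_gt0 : 0 < alpha).
Variables (V : {mfun T >-> measurableTypeR R}) (Th : {mfun T >-> S}).
Hypothesis polar : forall (t : R) (B : set S), measurable B ->
  P (V @^-1` `]t, +oo[%classic `&` Th @^-1` B) =
  ((pareto_tail alpha t)%:E * P (Th @^-1` B))%E.
Local Notation mu := (@lebesgue_measure R).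
Local Open Scope charge_scope.
Local Open Scope ring_scope.
Local Notation law := (distribution P).

Let law_ge0 (E : set (measurableTypeR R)) :
  (0 <= induced_charge (integrable_pareto alpha_gt0) E)%E.
Proof. by apply: integral_ge0 => x _; rewrite lee_fin pareto_pdf_ge0. Qed.

Lemma radial_law (A : set (measurableTypeR R)) : measurable A ->
  (law V A = \int[mu]_(x in A) (pareto_pdf alpha x)%:E)%E.
Proof.
move=> mA; apply: (measure_unique_ray (m1 := law V)
  (m2 := measure_of_charge _ law_ge0)) mA => [t|].
  have := polar t measurableT; rewrite preimage_setT setIT probability_setT mule1.
  by move=> E; rewrite [LHS]E; exact/esym/integral_pareto_tail.
exact: le_lt_trans (probability_le1 (law V) measurableT) (ltry 1).
Qed.

(** For a fixed [B] both sides are finite measures in [A] that agree on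
    half-lines. *)
Lemma polar_indep (A : set (measurableTypeR R)) (B : set S) :
  measurable A -> measurable B ->
  P (V @^-1` A `&` Th @^-1` B) = (law V A * law Th B)%E.
Proof.
move=> mA mB.
have mThB : measurable (Th @^-1` B) by rewrite -[X in measurable X]setTI; exact: measurable_funPT.
pose q : {nonneg R} := NngNum (fine_ge0 (measure_ge0 (law Th) B)).
have qE : (q%:num)%:E = law Th B by rewrite /= fineK// fin_num_measure.
rewrite -qE muleC.
apply: (measure_unique_ray (m1 := pushforward (mrestr P mThB) V)
  (m2 := mscale q (law V))) mA => [t|].
  have := polar t measurableT; rewrite preimage_setT setIT probability_setT mule1 => E.
  by apply: etrans (polar t mB) _; rewrite -E -[P (Th @^-1` B)]qE muleC.
change (P (V @^-1` setT `&` Th @^-1` B) < +oo)%E; rewrite preimage_setT setTI.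
exact: le_lt_trans (probability_le1 P mThB) (ltry 1).
Qed.

Let joint t : measurableTypeR R * S := (V t, Th t).

Let mjoint : measurable_fun setT joint.
Proof. by apply/measurable_fun_pairP; split; exact: measurable_funPT. Qed.

Lemma polar_joint (C : set (measurableTypeR R * S)) : measurable C ->
  (law V \x law Th)%E C = P (joint @^-1` C).
Proof.
move=> mC.
apply: (product_measure_unique (m' := pushforward P joint)) mC => A B mA mB.
exact: (polar_indep mA mB).
Qed.

(** The density is a Radon-Nikodym derivative of the law of the radius, by
    uniqueness almost everywhere. *)
Lemma radial_change (G : R -> R) : measurable_fun setT G ->
  (exists M, forall x, `|G x| <= M) ->
  (\int[law V]_x (G x)%:E = \int[mu]_x (G x * pareto_pdf alpha x)%:E)%E.
Proof.
move=> mG bG.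
have dom : law V `<< mu.
  apply/null_content_dominatesP => A mA A0; rewrite radial_law//.
  by apply: null_set_integral => //; apply: measurable_funTS; apply/measurable_EFinP;
    exact: measurable_pareto_pdf.
have iG : (law V).-integrable setT (EFin \o G) by apply: bm_integrable.
rewrite -(Radon_Nikodym_change_of_variables dom measurableT iG).
have mp : measurable_fun setT (fun x => (pareto_pdf alpha x)%:E).
  by apply/measurable_EFinP; exact: measurable_pareto_pdf.
have iRN : mu.-integrable setT
    ('d (charge_of_finite_measure (law V)) '/d mu).
  exact: Radon_Nikodym_integrable.
have RN : ae_eq mu setT ('d (charge_of_finite_measure (law V)) '/d mu)
    (fun x => (pareto_pdf alpha x)%:E).
  apply: integral_ae_eq => // E _ mE.
  by rewrite -Radon_Nikodym_integral//; exact: radial_law.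
apply: ae_eq_integral => //.
- apply: emeasurable_funM; first exact/measurable_EFinP.
  exact: measurable_int iRN.
- apply/measurable_EFinP; apply: measurable_funM => //.
  exact: measurable_pareto_pdf.
- apply: filterS RN => x + _ => -> //.
Qed.

(** The joint law of radius and angle is a product, so Fubini applies, and the
    law of the radius has the Pareto density. *)
Lemma polar_integral (F : R -> S -> R) :
  bm (fun z : measurableTypeR R * S => F z.1 z.2) ->
  ((Ex P (fun t => F (V t) (Th t)))%:E =
   \int[mu]_(x in `]0%R, +oo[)
     (Ex P (fun t => F x (Th t)) * pareto_pdf alpha x)%:E)%E.
Proof.
move=> bF; have [mF [M FM]] := bF.
have mx x : measurable_fun setT (fun t => F x (Th t)).
  apply: (measurableT_comp mF (f := fun z : measurableTypeR R * S => F z.1 z.2)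
    (g := fun t => (x, Th t))).
  by apply: measurable_fun_pair => //; exact: measurable_funPT.
have bx x : bm (fun t => F x (Th t)).
  by split; [exact: mx|exists M => t; exact: (FM (x, Th t))].
have bFj : bm (fun t => F (V t) (Th t)).
  split; last by exists M => t; exact: (FM (V t, Th t)).
  exact: (measurableT_comp mF (f := fun z : measurableTypeR R * S => F z.1 z.2) mjoint).
pose G x := Ex P (fun t => F x (Th t)).
have GE x : (G x)%:E = (\int[law Th]_y (F x y)%:E)%E.
  rewrite /G ExE//; apply/esym; apply: integral_pushforward => //.
  - apply/measurable_EFinP.
    apply: (measurableT_comp mF (f := fun z : measurableTypeR R * S => F z.1 z.2)
      (g := fun y => (x, y))).
    by apply: measurable_fun_pair.
  - by rewrite preimage_setT; exact: (bm_integrable P measurableT (bx x)).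
have iF : (law V \x law Th)%E.-integrable setT (EFin \o (fun z => F z.1 z.2)).
  exact: bm_integrable.
have mG : measurable_fun setT G.
  apply/measurable_EFinP; rewrite (_ : EFin \o G = fubini_F (law Th) (EFin \o (fun z => F z.1 z.2))).
    exact: (measurable_fubini_F iF).
  by apply/funext => x; exact: GE.
transitivity (\int[law V]_x (G x)%:E)%E.
  transitivity (\int[law V]_x fubini_F (law Th)
      (EFin \o (fun z : measurableTypeR R * S => F z.1 z.2)) x)%E; last first.
    by apply: eq_integral => x _; rewrite GE.
  rewrite integral12_prod_meas1// ExE//.
  rewrite (eq_measure_integral (pushforward P joint)); last first.
    by move=> C mC _; exact: polar_joint.
  apply/esym; apply: integral_pushforward => //.
  - by apply/measurable_EFinP; exact: mF.
  - by rewrite preimage_setT; exact: (bm_integrable P measurableT bFj).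
rewrite radial_change//; last first.
  by exists M => x; apply: norm_Ex_le => // t; exact: (FM (x, Th t)).
rewrite [RHS]integral_mkcond; apply: eq_integral => x _.
rewrite patchE mem_setE in_itv/= andbT; case: ltP => // x0.
by rewrite /pareto_pdf ltNge (le_trans x0)//= !mulr0.
Qed.

End PolarLaw.

(** * The cluster measure *)

Lemma measurable_inv_ge0 {R : realType} dT (T : measurableType dT) (f : T -> R) :
  (forall t, 0 <= f t) -> measurable_fun setT f ->
  measurable_fun setT (fun t => (f t)^-1).
Proof.
move=> f0 mf; rewrite (_ : (fun t => _) = (fun t => f t `^ (- 1))).
  exact: (measurableT_comp (measurable_powR (- 1)) mf).
by apply/funext => t; rewrite powR_inv1.
Qed.

Section ClusterMeasure.
Context {R : realType} {d : nat} {d2 d3 : measure_display}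
  {T2 : measurableType d2} {T3 : measurableType d3}
  {PY : probability T2 R} {PQ : probability T3 R}.
Variables (N : 'rV[R]_d -> R) (Y : {RV PY >-> seq_space R d})
  (Q : {RV PQ >-> seq_space R d}).
Notation S := (seq_space R d).
Hypothesis hN : is_norm N.
Variables (alpha : R) (alpha_gt0 : 0 < alpha).
Local Notation exceed j a := (fun x : int -> 'rV[R]_d => (a < N (x j))%R%:R : R).
Local Notation EY f := (Ex PY (fun t => f (Y t))).
Local Notation first0 := (fun x => (anchor0 N x == ((0 : int)%:~R)%:E)%R%:R : R).
Hypothesis Y_scale : forall (g : (int -> 'rV[R]_d) -> R) (t : R),
  bm (g : S -> R) -> 1 <= t ->
  EY (fun x => g x * exceed 0 t x) = t `^ (- alpha) * EY (fun x => g (scale t x)).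
Hypothesis Y_exceed0 : {ae PY, forall t, 1 < N (Y t 0)}.
Hypothesis Y_vanish : {ae PY, forall t, forall eta : R, 0 < eta ->
    exists m : nat, forall j : int, (m <= `|j|)%N -> N (Y t j) <= eta}.

Definition angle (x : int -> 'rV[R]_d) : int -> 'rV[R]_d := scale (N (x 0))^-1 x.

Let V (t : T2) : R := N (Y t 0).
Let Th (t : T2) : S := angle (Y t).

Lemma measurable_angle : measurable_fun setT (angle : S -> S).
Proof.
apply: measurable_scale2; last exact: measurable_id.
apply: measurable_inv_ge0 => [x|]; first exact: norm_ge0.
exact: measurable_norm_coord.
Qed.

Let mV : measurable_fun setT (V : T2 -> measurableTypeR R).
Proof. exact: (measurableT_comp (measurable_norm_coord hN 0) (measurable_funPT Y)). Qed.

Let mTh : measurable_fun setT Th.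
Proof. exact: (measurableT_comp measurable_angle (measurable_funPT Y)). Qed.

Lemma angle_scale (a : R) x : 0 < a -> angle (scale a x) = angle x.
Proof.
move=> a0; rewrite /angle scaleA_seq [N _](normZ hN) gtr0_norm//.
by rewrite invfM mulrAC mulVf ?gt_eqF// mul1r.
Qed.

(** The angle is unaffected by scaling, so conditioning on a large radius does
    not change its law. Levels below 1 are exceeded almost surely. *)
Lemma tail_polar (t : R) (B : set S) : measurable B ->
  PY (V @^-1` `]t, +oo[%classic `&` Th @^-1` B) =
  ((pareto_tail alpha t)%:E * PY (Th @^-1` B))%E.
Proof.
move=> mB; set s := Num.max 1 t.
have s1 : 1 <= s by rewrite le_max lexx.
have s0 : 0 < s by exact: lt_le_trans s1.
have mVt : measurable (V @^-1` `]t, +oo[%classic).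
  by rewrite -[X in measurable X]setTI; exact: mV.
have mThB : measurable (Th @^-1` B).
  by rewrite -[X in measurable X]setTI; exact: mTh.
pose g x : R := \1_B (angle x).
have bg : bm (g : S -> R) by exact: (bm_comp measurable_angle (bm_indic mB)).
have gE x : g (scale s x) = g x by rewrite /g angle_scale.
have := Y_scale bg s1; under [X in _ * Ex _ X]eq_fun do rewrite gE.
have PE (C : set T2) : measurable C -> (Ex PY \1_C)%:E = PY C.
  by move=> mC; rewrite ExE; [rewrite integral_indic ?setIT|exact: bm_indic].
have -> : EY g = Ex PY \1_(Th @^-1` B).
  by congr Ex; apply/funext => x; rewrite /g !indicE; congr (nat_of_bool _)%:R;
    apply/idP/idP; rewrite !inE.
have mVB : measurable (V @^-1` `]t, +oo[%classic `&` Th @^-1` B).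
  exact: measurableI.
have -> : EY (fun x => g x * exceed 0 s x) =
    Ex PY \1_(V @^-1` `]t, +oo[%classic `&` Th @^-1` B).
  apply: ae_Ex; [|exact: bm_indic|].
    by apply: (bmY Y (f := fun x => g x * exceed 0 s x)); apply: bmM => //; exact: bm_exceed.
  apply: filterS Y_exceed0 => w w0; rewrite indicI /= mulrC; congr (_ * _).
    rewrite indicE /s gt_max w0 /=; congr (nat_of_bool _)%:R.
    by apply/idP/idP; rewrite inE /= in_itv/= andbT.
by move=> E; apply: etrans (esym (PE _ mVB)) _; rewrite E EFinM PE.
Qed.

Lemma seq_norm_max x : (forall j, N (x j) <= N (x 0)) -> seq_norm N x = (N (x 0))%:E.
Proof.
move=> h; apply/eqP; rewrite eq_le; apply/andP; split; last exact: le_sup_on.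
by apply: sup_on_le => j _; rewrite lee_fin.
Qed.

Lemma first_max_scale (c : R) x i : 0 < c -> first_max N (scale c x) i <-> first_max N x i.
Proof.
move=> c0; rewrite /first_max /scale.
have E j : N (c *: x j) = c * N (x j) by rewrite (normZ hN) gtr0_norm.
split=> -[h1 h2]; split=> j ji.
- by have := h1 j ji; rewrite !E ltr_pM2l.
- by have := h2 j ji; rewrite !E ler_pM2l.
- by rewrite !E ltr_pM2l//; exact: h1.
- by rewrite !E ler_pM2l//; exact: h2.
Qed.

(** The first maximum over time is unaffected by a change of scale. *)
Lemma first0_angle x : 1 < N (x 0) ->
  (exists m : nat, forall j : int, (m <= `|j|)%N -> N (x j) <= 1) ->
  (anchor0 N (angle x) = ((0 : int)%:~R)%:E <-> first_max N x 0) /\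
  (anchor0 N x = ((0 : int)%:~R)%:E <-> first_max N x 0).
Proof.
move=> x0 [m xm]; have N0 : 0 < (N (x 0))^-1 by rewrite invr_gt0; lra.
have xm' j : (m < `|j|)%N -> N (x j) <= 1 by move=> mj; apply: xm; exact: ltnW.
have NE j : N (angle x j) = (N (x 0))^-1 * N (x j).
  by rewrite /angle /scale (normZ hN) gtr0_norm.
split; last exact: (anchor0_max xm' x0).
rewrite -(first_max_scale x 0 N0); apply: (@anchor0_max _ _ N m _ _ (N (x 0))^-1).
  by move=> j mj; rewrite NE ger_pMr// xm'.
by rewrite NE ltr_pMr.
Qed.

Hypothesis Q_law : is_conditional_spectral N Y Q.

(** Otherwise every conditional probability would be 0, by division by 0,
    while the law of [Q] has mass 1. *)
Lemma vartheta_neq0 : vartheta N Y != 0.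
Proof.
have := Q_law measurableT; rewrite /cond_prob.
have -> : prob PQ [set q | setT (Q q)] = 1.
  by rewrite /prob (_ : [set q | _] = setT) ?probability_setT//; apply/seteqP.
rewrite -/(vartheta N Y) => E; apply/eqP => t0; move: E; rewrite t0 invr0 mulr0.
by move/eqP; rewrite oner_eq0.
Qed.

Let Ystar (t : T2) : S := scale (fine (seq_norm N (Y t)))^-1 (Y t).

Let mYstar : measurable_fun setT Ystar.
Proof.
apply: measurable_scale2; last exact: measurable_funPT.
have m1 : measurable_fun setT (fun t => fine (seq_norm N (Y t))).
  apply: (measurableT_comp (f := fine : \bar R -> R)) => //.
  exact: (measurableT_comp (measurable_sup_on hN setT) (measurable_funPT Y)).
have p0 t : 0 <= fine (seq_norm N (Y t)).
  apply: fine_ge0; apply: le_trans (le_sup_on N (Y t) (_ : setT 0)) => //.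
  by rewrite lee_fin norm_ge0.
exact: measurable_inv_ge0.
Qed.

Let bm_first0 : bm (first0 : S -> R).
Proof.
apply: bm_bool; apply: (measurable_anchor hN (A := anchor0 N)).
by constructor 1.
Qed.

Lemma spectral_expect g : bm (g : S -> R) ->
  Ex PQ (fun q => g (Q q)) =
  Ex PY (fun t => g (Ystar t) * ((vartheta N Y)^-1 * first0 (Y t))).
Proof.
move=> bg.
have bw : bm (fun t => (vartheta N Y)^-1 * first0 (Y t)).
  by apply: bmM; [exact: bm_cst|exact: (bmY Y bm_first0)].
have := @indic_determine _ _ _ _ _ _ PQ PY Q Ystar (fun=> 1) _
  (measurable_funPT Q) mYstar (bm_cst 1) bw.
have -> : Ex PQ (fun q => g (Q q)) = Ex PQ (fun q => g (Q q) * 1).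
  by congr Ex; apply/funext => q; rewrite mulr1.
apply=> // B mB.
have mQB : measurable [set q | B (Q q)].
  by rewrite -[X in measurable X]setTI; exact: (measurable_funPT Q).
have mYB : measurable [set t | B (Ystar t)].
  by rewrite -[X in measurable X]setTI; exact: mYstar.
have m0 : measurable [set t | anchor0 N (Y t) = 0%E].
  rewrite (_ : mkset _ = [set t | anchor0 N (Y t) == ((0 : int)%:~R)%:E]).
    apply: measurable_setb.
    apply: (measurableT_comp (measurable_anchor hN _ 0) (measurable_funPT Y)).
    by constructor 1.
  by apply/seteqP; split => t /= /eqP.
have PE dT (T : measurableType dT) (P : probability T R) (C : set T) (f : T -> R) :
    measurable C -> f = \1_C -> Ex P f = prob P C.
  by move=> mC ->; rewrite /Ex /Rintegral integral_indic ?setIT.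
transitivity (prob PQ [set q | B (Q q)]).
  apply: PE => //; apply/funext => q; rewrite mulr1 !indicE.
  by congr (nat_of_bool _)%:R; apply/idP/idP; rewrite !inE.
rewrite Q_law// /cond_prob mulrC -/(vartheta N Y).
transitivity (Ex PY (fun t => (vartheta N Y)^-1 * (\1_B (Ystar t) * first0 (Y t)))); last first.
  by congr Ex; apply/funext => t; rewrite mulrCA.
rewrite ExZ; last first.
  by apply: bmM; [exact: (bm_comp mYstar (bm_indic mB))|exact: (bmY Y bm_first0)].
congr (_ * _); apply/esym/PE; first exact: measurableI.
apply/funext => t; rewrite indicI /=; congr (_ * _).
by rewrite indicE; congr (nat_of_bool _)%:R; apply/eqP/idP; rewrite inE.
Qed.

(** In polar coordinates the radius is the Pareto variable and the angle has
    the spectral law on the event that the first maximum is at 0, because then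
    [seq_norm N (Y t) = N (Y t 0)]. The sequence [scale rho (angle (Y t))] has
    norm [rho], so the condition [1 < rho] of the Pareto density becomes the
    condition on the norm. *)
Lemma cluster_measureE (K : (int -> 'rV[R]_d) -> R) : bm (K : S -> R) ->
  (EY (fun x => K x * first0 x))%:E =
  cluster_measure N alpha Y Q
    (fun x => K x * ((1%:E < seq_norm N x)%E)%:R).
Proof.
move=> bK; set th := vartheta N Y; have th0 : th != 0 := vartheta_neq0.
(* the factor th^-1 is the one of the conditional law of Q; it cancels the
   factor in front of the cluster measure *)
pose F (rho : R) (z : S) : R := th^-1 * (K (scale rho z) * first0 z).
have bF : bm (fun z : measurableTypeR R * S => F z.1 z.2).
  apply: bmM; first exact: bm_cst.
  apply: bmM.
    have ms : measurable_fun setT (fun z : measurableTypeR R * S => scale z.1 z.2 : S).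
      by apply: measurable_scale2; [exact: measurable_fst|exact: measurable_snd].
    exact: (bm_comp ms bK).
  exact: (bm_comp (measurable_snd : measurable_fun setT (snd : measurableTypeR R * S -> S)) bm_first0).
have bF1 rho : bm (F rho : S -> R).
  by apply: bmM; [exact: bm_cst|apply: bmM => //; exact: bm_scale].
have -> : EY (fun x => K x * first0 x) = th * Ex PY (fun t => F (V t) (Th t)).
  rewrite -ExZ; last first.
    split; last by have [_ [M FM]] := bF; exists M => t; exact: (FM (V t, Th t)).
    apply: (measurableT_comp bF.1 (f := fun z : measurableTypeR R * S => F z.1 z.2)
      (g := fun t => (V t : measurableTypeR R, Th t))).
    by apply: measurable_fun_pair; [exact: mV|exact: mTh].
  apply: ae_Ex.
  - by apply: (bmY Y (f := fun x => K x * first0 x)); apply: bmM.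
  - apply: bmM; first exact: bm_cst.
    split; last by have [_ [M FM]] := bF; exists M => t; exact: (FM (V t, Th t)).
    apply: (measurableT_comp bF.1 (f := fun z : measurableTypeR R * S => F z.1 z.2)
      (g := fun t => (V t : measurableTypeR R, Th t))).
    by apply: measurable_fun_pair; [exact: mV|exact: mTh].
  apply: filterS2 Y_exceed0 Y_vanish => t t0 /(_ 1 ltr01) tv.
  have [a1 a2] := first0_angle t0 tv.
  rewrite /F mulrA mulfV// mul1r; congr (K _ * (nat_of_bool _)%:R).
    by rewrite /Th /angle /V scaleA_seq mulfV ?gt_eqF//; [apply/funext => j; rewrite /scale scale1r|lra].
  by apply/eqP/eqP => [/a2/a1|/a1/a2].
pose Vm : {mfun T2 >-> measurableTypeR R} :=
  HB.pack (V : T2 -> measurableTypeR R) (isMeasurableFun.Build _ _ _ _ _ mV).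
pose Thm : {mfun T2 >-> S} := HB.pack Th (isMeasurableFun.Build _ _ _ _ _ mTh).
rewrite EFinM (polar_integral alpha_gt0 (V := Vm) (Th := Thm) tail_polar bF).
congr (_ * _)%E; apply: eq_integral => rho; rewrite inE/= in_itv/= andbT => rho0.
have bKs : bm ((fun x => K x * ((1%:E < seq_norm N x)%E)%:R) : S -> R).
  apply: bmM => //; apply: bm_bool; apply: measurable_fun_lte => //.
  exact: measurable_sup_on.
rewrite ExpE; last exact: (bm_comp (measurable_funPT Q) (bm_scale rho bKs)).
rewrite (spectral_expect (bm_scale rho bKs)) -EFinM /pareto_pdf; congr EFin.
rewrite mulrA mulrAC; congr (_ * _); rewrite mulrC -ExZ; last first.
  exact: (bm_comp mTh (bF1 rho)).
apply: ae_Ex.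
- by apply: bmM; [exact: bm_cst|exact: (bm_comp mTh (bF1 rho))].
- apply: bmM; first exact: (bm_comp mYstar (bm_scale rho bKs)).
  by apply: bmM; [exact: bm_cst|exact: (bmY Y bm_first0)].
apply: filterS2 Y_exceed0 Y_vanish => t t0 /(_ 1 ltr01) tv.
have [a1 a2] := first0_angle t0 tv.
have N0 : 0 < N (Y t 0) by lra.
rewrite /F; case: (pselect (first_max N (Y t) 0)) => [fm|nfm]; last first.
  rewrite [anchor0 N (Th t) == _](_ : _ = false); last by apply/eqP => /a1.
  by rewrite [anchor0 N (Y t) == _](_ : _ = false) ?mulr0//; apply/eqP => /a2.
rewrite (introT eqP (a1.2 fm)) (introT eqP (a2.2 fm)) !mulr1.
have le0 j : N (Y t j) <= N (Y t 0).
  by have [lt ge] := fm; have [/lt/ltW|/ge] := ltP j 0.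
have sY : Ystar t = Th t by rewrite /Ystar seq_norm_max.
have NTh j : N (scale rho (Th t) j) = rho / N (Y t 0) * N (Y t j).
  by rewrite /Th /angle scaleA_seq /scale (normZ hN) gtr0_norm// divr_gt0.
rewrite sY (seq_norm_max (x := scale rho (Th t))); last first.
  by move=> j; rewrite !NTh ler_pM2l// divr_gt0.
rewrite NTh divfK ?gt_eqF// lte_fin -[vartheta N Y]/th.
by rewrite mulrC [th^-1 * _]mulrC mulrAC.
Qed.

End ClusterMeasure.

(** * The runs statistic *)

Lemma covarianceEx {R : realType} dT (T : measurableType dT) (P : probability T R)
    (f g : T -> R) : bm f -> bm g ->
  covariance P f g = (Ex P (fun t => f t * g t) - Ex P f * Ex P g)%:E.
Proof.
move=> bf bg.
have ba : bm (f \- cst (Ex P f) : T -> R) by apply: bmB => //; exact: bm_cst.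
have bb : bm (g \- cst (Ex P g) : T -> R) by apply: bmB => //; exact: bm_cst.
rewrite unlock (ExpE P bf) (ExpE P bg) ExpE; last exact: bmM.
rewrite /=; set a := Ex P f; set b := Ex P g.
have -> : ((f \- cst a) * (g \- cst b))%R =
    (fun t => f t * g t + (- a * g t + (- b * f t + a * b))).
  apply/funext => t; change ((f t - a) * (g t - b) =
    f t * g t + (- a * g t + (- b * f t + a * b))); ring.
have b1 : bm (fun t => f t * g t) by exact: bmM.
have b2 : bm (fun t => - a * g t) by apply: bmM => //; exact: bm_cst.
have b3 : bm (fun t => - b * f t) by apply: bmM => //; exact: bm_cst.
have b4 : bm (fun _ : T => a * b) by exact: bm_cst.
rewrite ExD//; last by do 2?apply: bmD.
rewrite ExD//; last exact: bmD.
rewrite ExD// Ex_cst (ExZ P _ bg) (ExZ P _ bf) -/a -/b; congr EFin; ring.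
Qed.

Lemma Ex_cov_sum {R : realType} dT (T : measurableType dT) (P : probability T R)
    (I : Type) (s : seq I) (a b : I -> T -> R) :
  (forall i, bm (a i)) -> (forall i, bm (b i)) ->
  Ex P (fun t => (\sum_(i <- s) a i t) * (\sum_(k <- s) b k t)) -
  Ex P (fun t => \sum_(i <- s) a i t) * Ex P (fun t => \sum_(k <- s) b k t) =
  \sum_(i <- s) \sum_(k <- s) (Ex P (fun t => a i t * b k t) - Ex P (a i) * Ex P (b k)).
Proof.
move=> ba bb.
have -> : (fun t => (\sum_(i <- s) a i t) * (\sum_(k <- s) b k t)) =
    (fun t => \sum_(i <- s) \sum_(k <- s) a i t * b k t).
  apply/funext => t; rewrite mulr_suml; apply: eq_bigr => i _.
  by rewrite mulr_sumr.
have bab i k : bm (fun t => a i t * b k t) by exact: bmM.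
rewrite (Ex_sum P s xpredT (f := fun i t => \sum_(k <- s) a i t * b k t)); last first.
  by move=> i; exact: (@bm_sum _ _ _ _ _ _ (fun k t => a i t * b k t)).
rewrite !Ex_sum// mulr_suml -sumrB; apply: eq_bigr => i _.
rewrite (Ex_sum P s xpredT (f := fun k t => a i t * b k t))//.
by rewrite mulr_sumr -sumrB.
Qed.

Section RunsStatistic.
Context {R : realType} {d : nat} {d1 : measure_display}
  {T1 : measurableType d1} {P : probability T1 R}.
Variables (N : 'rV[R]_d -> R) (X : {RV P >-> seq_space R d}).
Notation S := (seq_space R d).
Hypothesis hN : is_norm N.
Hypothesis X_stationary : stationary X.
Local Notation p := (tailp N X).
Hypothesis tailp_gt0 : forall x, 0 < p x.
Variables (r : nat -> nat) (u : nat -> R).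
Hypothesis u_gt0 : forall n, 0 < u n.
Local Notation w n := (p (u n)).
Local Notation Z := (block_anchored N r u).
Variables (H H' : (int -> 'rV[R]_d) -> R) (A A' : (int -> 'rV[R]_d) -> \bar R).
Hypotheses (H_shift : shift_invariant H) (H'_shift : shift_invariant H').
Hypotheses (hA : is_anchor N A) (hA' : is_anchor N A').

Lemma runs_statisticE K B n t : shift_invariant K -> is_anchor N B ->
  runs_statistic N X r u K B n t =
  (n%:R * w n)^-1 * \sum_(1 <= i < n.+1) Z K B n (shift i%:Z (X t)).
Proof.
move=> Ks hB; congr (_ * _); apply: eq_bigr => i _.
by rewrite block_anchored_shift.
Qed.

(** Each covariance of two summands depends on their lag only, by
    stationarity. *)
Lemma scaled_covE n : bm (H : S -> R) -> bm (H' : S -> R) ->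
  ((n%:R * w n)%:E * covariance P (runs_statistic N X r u H A n)
                                  (runs_statistic N X r u H' A' n))%E =
  ((\sum_(1 <= i < n.+1) \sum_(1 <= k < n.+1)
     lag_cov X (Z H A) (Z H' A') n (k%:Z - i%:Z)) / n%:R / w n)%:E.
Proof.
move=> bH bH'; have w0 := tailp_gt0 (u n).
have bZ K B : bm (K : S -> R) -> is_anchor N B -> bm (Z K B n : S -> R).
  move=> bK hB; have [_ [M KM]] := bK.
  have M0 : 0 <= M by apply: le_trans (KM (fun=> 0)).
  by have [/(_ n)] := block_functional_anchored hN r u_gt0 bK hB M0 KM.
pose a K B (i : nat) (t : T1) := Z K B n (shift i%:Z (X t)).
have ba K B i : bm (K : S -> R) -> is_anchor N B -> bm (a K B i).
  by move=> bK hB; exact: (bmX X (bm_shift i%:Z (bZ K B bK hB))).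
have bs K B : bm (K : S -> R) -> is_anchor N B ->
    bm (fun t => \sum_(1 <= i < n.+1) a K B i t).
  by move=> bK hB; apply: (@bm_sum _ _ _ _ _ _ (a K B)) => i; exact: ba.
pose c := (n%:R * w n)^-1.
have RE K B : shift_invariant K -> is_anchor N B -> runs_statistic N X r u K B n =
    (fun t => c * \sum_(1 <= i < n.+1) a K B i t).
  by move=> Ks hB; apply/funext => t; exact: runs_statisticE.
rewrite !RE// covarianceEx; [|by apply: bmM; [exact: bm_cst|exact: bs]..].
rewrite (ExZ P c (bs _ _ bH hA)) (ExZ P c (bs _ _ bH' hA')).
rewrite [X in Ex P X](_ : _ = fun t => c ^+ 2 *
    ((\sum_(1 <= i < n.+1) a H A i t) * (\sum_(1 <= i < n.+1) a H' A' i t))); last first.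
  by apply/funext => t; ring.
rewrite ExZ; last by apply: bmM; exact: bs.
set E1 := Ex P _; set E2 := Ex P _; set E3 := Ex P _.
have -> : c ^+ 2 * E1 - c * E2 * (c * E3) = c ^+ 2 * (E1 - E2 * E3) by ring.
rewrite /E1 /E2 /E3 Ex_cov_sum; [|by move=> i; exact: ba..].
rewrite -EFinM; congr EFin.
have -> : \sum_(1 <= i < n.+1) \sum_(1 <= k < n.+1)
     (Ex P (fun t => a H A i t * a H' A' k t) - Ex P (a H A i) * Ex P (a H' A' k)) =
  \sum_(1 <= i < n.+1) \sum_(1 <= k < n.+1)
     lag_cov X (Z H A) (Z H' A') n (k%:Z - i%:Z).
  apply: eq_bigr => i _; apply: eq_bigr => k _.
  rewrite /lag_cov -(cov_of_shift X_stationary i%:Z (bZ _ _ bH hA)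
    (bm_shift _ (bZ _ _ bH' hA'))).
  have -> : (fun x => Z H' A' n (shift (k%:Z - i%:Z) (shift i%:Z x))) =
      (fun x => Z H' A' n (shift k%:Z x)).
    by apply/funext => x; rewrite shift_shift subrK.
  by [].
have [->|n0] := posnP n; first by rewrite big_geq// mulr0 !mul0r.
by rewrite /c; field; rewrite !gt_eqF ?ltr0n.
Qed.

End RunsStatistic.

(** * The limit of the scaled covariance *)

Theorem lemma3p2 (R : realType) (d : nat) (N : 'rV[R]_d -> R)
    (hN : is_norm N)
    (d1 d2 d3 : measure_display) (T1 : measurableType d1)
    (T2 : measurableType d2) (T3 : measurableType d3)
    (P : probability T1 R) (PY : probability T2 R) (PQ : probability T3 R)
    (X : {RV P >-> seq_space R d}) (Y : {RV PY >-> seq_space R d})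
    (Q : {RV PQ >-> seq_space R d}) (alpha : R) (halpha : 0 < alpha)
    (X_stationary : stationary X)
    (X_rv : regularly_varying N X alpha)
    (Y_tail : is_tail_process N X Y)
    (Q_law : is_conditional_spectral N Y Q)
    (r : nat -> nat) (u : nat -> R)
    (r_gt0 : forall n, (0 < r n)%N) (u_gt0 : forall n, 0 < u n)
    (u_infty : u n @[n --> \oo] --> +oo)
    (r_infty : r n @[n --> \oo] --> \oo)
    (nw_infty :
      n%:R * prob P [set t | u n < N (X t 0)] @[n --> \oo] --> +oo)
    (r_over_n : (r n)%:R / n%:R @[n --> \oo] --> (0 : R))
    (rw_0 : (r n)%:R * prob P [set t | u n < N (X t 0)] @[n --> \oo]
      --> (0 : R))
    (hAC : anticlustering N X r u)
    (hS : summability N X r u)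
    (hbeta : ((prob P [set t | u n < N (X t 0%R)])^-1%:E *
        \sum_((r n).+1 <= i <oo) beta_mixing X i)%E @[n --> \oo]
      --> (0 : \bar R))
    (H H' : (int -> 'rV[R]_d) -> R)
    (H_L : class_L N Y H) (H'_L : class_L N Y H')
    (H_shift : shift_invariant H) (H'_shift : shift_invariant H')
    (A A' : (int -> 'rV[R]_d) -> \bar R)
    (hA : is_anchor N A) (hA' : is_anchor N A') :
  let scaled_cov := fun n : nat =>
    ((n%:R * prob P [set t | (u n < N (X t 0))%R])%:E *
     covariance P (runs_statistic N X r u H A n)
                  (runs_statistic N X r u H' A' n))%E in
  (scaled_cov n @[n --> \oo] -->
    cluster_measure N alpha Y Q
      (fun x => H x * H' x * ((1%:E < seq_norm N x)%E)%:R)) /\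
  ((forall x, (seq_norm N x <= 1%:E)%E -> H x * H' x = 0) ->
   scaled_cov n @[n --> \oo] -->
    cluster_measure N alpha Y Q (fun x => H x * H' x)).

Proof.
move=> scaled_cov.
have tailp_gt0 x : 0 < tailp N X x.
  have ux : \forall n \near \oo, x <= u n by exact: (u_infty _ (nbhs_pinfty_ge (num_real x))).
  have nw : \forall n \near \oo, 0 < n%:R * tailp N X (u n).
    exact: (nw_infty _ (nbhs_pinfty_gt (num_real 0))).
  have [n [xn nn]] := filter_ex (filterI ux nw).
  have wn : 0 < tailp N X (u n).
    by rewrite lt_neqAle tailp_ge0 andbT eq_sym; apply/eqP => w0; move: nn; rewrite w0 mulr0 ltxx.
  exact: (lt_le_trans wn (tailp_le X hN xn)).
have ratio := @rv_ratio _ _ _ _ _ _ _ hN alpha X_rv tailp_gt0.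
pose w n := tailp N X (u n).
have [M0 M01 HM0] := class_L_bounded H_L; have [M0' M0'1 HM0'] := class_L_bounded H'_L.
pose M := Num.max M0 M0'.
have M1 : 1 <= M by rewrite le_max M01.
have HM x : `|H x| <= M by rewrite (le_trans (HM0 x))// le_max lexx.
have HM' x : `|H' x| <= M by rewrite (le_trans (HM0' x))// le_max lexx orbT.
have M_ge0 : 0 <= M by exact: le_trans M1.
have hg := block_functional_anchored hN r u_gt0 (class_L_bm H_L) hA M_ge0 HM.
have hg' := block_functional_anchored hN r u_gt0 (class_L_bm H'_L) hA' M_ge0 HM'.
pose K x := H x * H' x.
have K_L : class_L N Y K by exact: class_LM.
have K_shift : shift_invariant K by move=> k x; rewrite /K H_shift H'_shift.
have hA0 : is_anchor N (anchor0 N) by constructor 1.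
have hA1 : is_anchor N (anchor1 N) by constructor 2.
pose L := Ex PY (fun t => K (Y t) * (anchor0 N (Y t) == ((0 : int)%:~R)%:E)%:R).
have lim1 : Ex P (fun t => block_anchored N r u K (anchor1 N) n (X t)) / w n @[n --> \oo] --> L.
  rewrite /L (tail_anchor_exchange hN X_stationary tailp_gt0 u_gt0 hS Y_tail u_infty
    r_infty halpha ratio (class_L_bm K_L) K_shift hA0 hA1).
  exact: (anchor1_limit hN X_stationary tailp_gt0 u_gt0 hS Y_tail u_infty r_infty
    halpha ratio K_L).
pose G n := (\sum_(1 <= i < n.+1) \sum_(1 <= k < n.+1)
   lag_cov X (block_anchored N r u H A) (block_anchored N r u H' A') n (k%:Z - i%:Z)) / n%:R.
have limG : G n / w n @[n --> \oo] --> L.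
  apply/cvgrPdist_le => e e0.
  have e4 : 0 < e / 4 by lra.
  have c1 := runs_cov_sum hN X_stationary tailp_gt0 r_gt0 hS rw_0 hbeta M1 hg hg' e4.
  have c2 := cross_anchor hN X_stationary tailp_gt0 u_gt0 hS Y_tail u_infty r_infty
    H_L H'_L H'_shift hA hA' e4.
  have c3 := anchor_exchange hN X_stationary tailp_gt0 u_gt0 hS Y_tail u_infty r_infty
    K_L K_shift hA hA1 e4.
  have /cvgrPdist_le/(_ _ e4) c4 := lim1.
  near \oo => m.
  have c1m : \forall n \near \oo, `|G n - cross X (block_anchored N r u H A) (block_anchored N r u H' A') n m|
    <= e / 4 * w n by near: m.
  have c2m : \forall n \near \oo, `|cross X (block_anchored N r u H A) (block_anchored N r u H' A') n m -
    Ex P (fun t => block_anchored N r u K A n (X t))| <= e / 4 * w n by near: m.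
  near=> n.
  have n1 : `|G n - cross X (block_anchored N r u H A) (block_anchored N r u H' A') n m| <= e / 4 * w n by near: n.
  have n2 : `|cross X (block_anchored N r u H A) (block_anchored N r u H' A') n m -
    Ex P (fun t => block_anchored N r u K A n (X t))| <= e / 4 * w n by near: n.
  have n3 : `|Ex P (fun t => block_anchored N r u K A n (X t)) -
    Ex P (fun t => block_anchored N r u K (anchor1 N) n (X t))| <= e / 4 * w n by near: n.
  have n4 : `|L - Ex P (fun t => block_anchored N r u K (anchor1 N) n (X t)) / w n| <= e / 4.
    by near: n.
  have w0 : 0 < w n by exact: tailp_gt0.
  have s1 := le_trans (ler_distD _ _ _) (lerD n1 n2).
  have s2 := le_trans (ler_distD _ _ _) (lerD s1 n3).
  have n5 : `|Ex P (fun t => block_anchored N r u K (anchor1 N) n (X t)) / w n - G n / w n|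
      <= e / 4 + e / 4 + e / 4.
    rewrite -mulrBl normrM [X in _ * X]gtr0_norm ?invr_gt0// distrC.
    by rewrite ler_pdivrMr// !mulrDl.
  have s3 := le_trans (ler_distD _ _ _) (lerD n4 n5).
  by apply: (le_trans s3); rewrite le_eqVlt; apply/orP; left; apply/eqP; field.
have covE n : scaled_cov n = (G n / w n)%:E.
  exact: (scaled_covE hN X_stationary tailp_gt0 r u_gt0 H_shift H'_shift hA hA' n
    (class_L_bm H_L) (class_L_bm H'_L)).
have LE : L%:E = cluster_measure N alpha Y Q
    (fun x => H x * H' x * ((1%:E < seq_norm N x)%E)%:R).
  apply: (cluster_measureE hN halpha _ _ _ Q_law (class_L_bm K_L)).
  - by move=> g t; exact: (tail_process_scale hN Y_tail tailp_gt0 ratio).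
  - exact: (ae_exceed0 hN tailp_gt0 Y_tail ratio).
  - exact: (tail_vanish hN X_stationary tailp_gt0 u_gt0 hS Y_tail u_infty r_infty).
have main : scaled_cov n @[n --> \oo] --> cluster_measure N alpha Y Q
    (fun x => H x * H' x * ((1%:E < seq_norm N x)%E)%:R).
  by rewrite -LE (funext covE); apply: cvg_EFin => //; exact: nearW.
split=> // H0; rewrite [X in cluster_measure _ _ _ _ X](_ : _ =
  (fun x => H x * H' x * ((1%:E < seq_norm N x)%E)%:R))//.
apply/funext => x; case: ltP => [_|/H0 ->]; first by rewrite mulr1.
by rewrite mul0r.
Unshelve. all: by end_near. Qed.
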